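(* Let $\mathbf{Z},\mathbf{Z}_1,\mathbf{Z}_2,\dots$ be i.i.d. $\mathbb{R}^d$-valued random vectors with $\mathbf{Z}\in\mathrm{RV}(\alpha,\mu)$ for some $\alpha>1$ and $\mathrm{E}(\mathbf{Z})=\mathbf{0}$. Let $\mathbf{S}_0=\mathbf{0}$, $\mathbf{S}_n=\mathbf{Z}_1+\cdots+\mathbf{Z}_n$, and for $A\in\mathcal{B}(\mathbb{R}^d)$ let $$R_n(A)=\sup\{k:\ \mathbf{S}_{i+k}-\mathbf{S}_i\in kA\text{ for some }i\in\{0,\dots,n-k\}\}.$$ Let $(a_n)$ be an increasing sequence of positive numbers such that $n\mathrm{P}(|\mathbf{Z}|>a_n)\to1$ as $n\to\infty$. Then for every $A\in\mathcal{B}(\mathbb{R}^d)$ bounded away from $\mathbf{0}$ and every $x>0$, $$\exp\Big\{-x^{-\alpha}\mu\Big(\bigcup_{s\ge1}s\overline{A}\Big)\Big\}\le\liminf_{n\to\infty}\mathrm{P}(a_n^{-1}R_n(A)\le x)\le\limsup_{n\to\infty}\mathrm{P}(a_n^{-1}R_n(A)\le x)\le\exp\Big\{-x^{-\alpha}\mu\Big(\bigcup_{s\ge1}sA^\circ\Big)\Big\},$$ where $\overline{A}$, $A^\circ$ denote the closure and interior of $A$. In particular, if $\mu(\bigcup_{s\ge1}sA^\circ)=\mu(\bigcup_{s\ge1}s\overline{A})=:v$, then $a_n^{-1}R_n(A)$ converges in distribution to $v^{1/\alpha}W$, where $W$ is a standard Fréchet random variable with distribution $\mathrm{P}(W\le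 w)=e^{-w^{-\alpha}}$, $w>0$.
   Context: $|\cdot|$ is the (Euclidean) norm on $\mathbb{R}^d$ and $\overline{\mathbb{R}}=\mathbb{R}\cup\{-\infty,\infty\}$. A set $A\subset\mathbb{R}^d$ is bounded away from $\mathbf{0}$ if $\mathbf{0}\notin\overline{A}$. In the definition of $R_n(A)$, $k$ ranges over $\{0,1,\dots,n\}$ and $\sup\varnothing=0$. Vague convergence. The space $\overline{\mathbb{R}}^d\setminus\{\mathbf{0}\}$ is topologized so that its Borel sets coincide with those of $\mathbb{R}^d$ on $\mathbb{R}^d\setminus\{\mathbf{0}\}$ and so that a Borel set $B$ is relatively compact iff $B\cap\mathbb{R}^d$ is bounded away from $\mathbf{0}$. Vague convergence $\mu_n\xrightarrow{v}\mu$ of Radon measures on it means $\mu_n(B)\to\mu(B)$ for every relatively compact Borel $B$ with $\mu(\partial B)=0$. Regular variation. $\mathbf{Z}\in\mathrm{RV}(\alpha,\mu)$ means: $\mu$ is a nonnull Radon measure on $\mathcal{B}(\overline{\mathbb{R}}^d\setminus\{\mathbf{0}\})$ with $\mu(\overline{\mathbb{R}}^d\setminus\mathbb{R}^d)=0$; there is a sequence $0<a_n\uparrow\infty$, chosen so that $n\mathrm{P}(|\mathbf{Z}|>a_n)\to1$, with $n\mathrm{P}(a_n^{-1}\mathbf{Z}\in\cdot)\xrightarrow{v}\mu(\cdot)$; and $\mu(uB)=u^{-\alpha}\mu(B)$ for all $u>0$ and Borel $B$. With this normalization, $\mathrm{P}(\mathbf{Z}\in u\,\cdot)/\mathrm{P}(|\mathbf{Z}|>u)\xrightarrow{v}\mu(\cdot)$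 as $u\to\infty$. *)

(* Defs.v *)
From HB Require Import structures.
From mathcomp Require Import all_boot all_order all_algebra.
From mathcomp Require Import all_classical all_reals all_analysis.
Import Order.TTheory GRing.Theory Num.Theory.
Import numFieldNormedType.Exports.

Set Implicit Arguments.
Unset Strict Implicit.
Unset Printing Implicit Defensive.

Local Open Scope classical_set_scope.
Local Open Scope ring_scope.

Notation borel T := (g_sigma_algebraType (@open T)).

(* R^d with d >= 1 is 'rV[R]_d.+1, with its library topology (that of the
   sup norm, hence the usual one). *)

Definition enorm (R : realType) (d : nat) (x : 'rV[R]_d.+1) : R :=
  Num.sqrt (\sum_j x ord0 j ^+ 2).

Definition dilate (R : realType) (d : nat) (s : R) (A : set 'rV[R]_d.+1) :
  set 'rV[R]_d.+1 := [set s *: y | y in A].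

Definition bounded_away0 (R : realType) (d : nat) (A : set 'rV[R]_d.+1) :
  Prop := ~ closure A 0.

(* The union of the sets s A over real s >= 1. *)
Definition up_dilations (R : realType) (d : nat) (A : set 'rV[R]_d.+1) :
  set 'rV[R]_d.+1 := \bigcup_(s in [set s : R | 1 <= s]) dilate s A.

(* [-oo, +oo]^d \ {0}, with the topology induced by the product topology.
   As [-oo, +oo]^d is compact, B is relatively compact here exactly when its
   finite part is bounded away from 0. *)
Definition punctured (R : realType) (d : nat) : Type :=
  set_type [set x : 'rV[\bar R]_d.+1 | x != const_mx 0%E].

Lemma punctured_inhabited (R : realType) (d : nat) : punctured R d.
Proof.
exists (const_mx 1%E); apply/mem_set => /=; apply/eqP => /matrixP/(_ ord0 ord0).
by rewrite !mxE => /eqP; rewrite onee_eq0.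
Qed.

HB.instance Definition _ (R : realType) (d : nat) :=
  Topological.copy (punctured R d)
    (set_type [set x : 'rV[\bar R]_d.+1 | x != const_mx 0%E]).
HB.instance Definition _ (R : realType) (d : nat) :=
  isPointed.Build (punctured R d) (punctured_inhabited R d).

Definition to_ext (R : realType) (d : nat) (x : 'rV[R]_d.+1) :
  'rV[\bar R]_d.+1 := map_mx EFin x.

(* U \ {0}, for U a subset of R^d, as a subset of [-oo, +oo]^d \ {0}. *)
Definition embed (R : realType) (d : nat) (U : set 'rV[R]_d.+1) :
  set (punctured R d) := [set z | exists2 y, U y & set_val z = to_ext y].

Definition ext_dilate (R : realType) (d : nat) (u : R)
    (B : set (punctured R d)) : set (punctured R d) :=
  [set z | exists2 y, B y &
    set_val z = map_mx (fun t => u%:E * t)%E (set_val y)].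

(* On a locally compact second countable Hausdorff space, a Borel measure that
   is finite on compact sets is automatically regular. *)
Definition radon (R : realType) (E : ptopologicalType)
    (mu : {measure set (borel E) -> \bar R}) : Prop :=
  forall K : set E, measurable (K : set (borel E)) -> compact K ->
    (mu K < +oo)%E.

Definition boundary (E : topologicalType) (B : set E) : set E :=
  closure B `\` interior B.

Definition vague_cvg (R : realType) (E : ptopologicalType)
    (mu_ : nat -> set E -> \bar R) (mu : set E -> \bar R) : Prop :=
  forall B : set E, measurable (B : set (borel E)) -> precompact B ->
    mu (boundary B) = 0%E -> mu_ n B @[n --> \oo] --> mu B.

Section random_vectors.
Context (R : realType) (d : nat) (disp : measure_display)
  (Omega : measurableType disp) (P : probability Omega R).
Local Notation Rd := 'rV[R]_d.+1.
Implicit Types (X : {RV P >-> borel Rd}) (Z : nat -> {RV P >-> borel Rd}).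

Definition normalizing X (a : nat -> R) : Prop :=
  (n%:R%:E * P [set w | (a n < enorm (X w : Rd))%R])%E @[n --> \oo] --> 1%E.

(* The set function n P(X / r \in .) on [-oo, +oo]^d \ {0}. *)
Definition scaled_law X (n : nat) (r : R) (B : set (punctured R d)) : \bar R :=
  (n%:R%:E * P [set w | exists2 z, B z &
                          set_val z = to_ext (r^-1 *: (X w : Rd))%R])%E.

Definition regularly_varying X (alpha : R)
    (mu : {measure set (borel (punctured R d)) -> \bar R}) : Prop :=
  [/\ mu setT <> 0%E,
      radon mu,
      mu (~` embed setT) = 0%E,
      exists a : nat -> R,
        [/\ forall n, 0 < a n,
            nondecreasing_seq a,
            a n @[n --> \oo] --> +oo,
            normalizing X a &
            vague_cvg (fun n => scaled_law X n (a n)) mu] &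
      forall (u : R) (B : set (punctured R d)), 0 < u ->
        measurable (B : set (borel (punctured R d))) ->
        mu (ext_dilate u B) = ((u `^ (- alpha))%:E * mu B)%E].

Definition iid Z : Prop :=
  (forall (J : seq nat) (B : nat -> set (borel Rd)), uniq J ->
     (forall i, measurable (B i)) ->
     P (\bigcap_(i in [set` J]) (Z i @^-1` B i)) =
       (\prod_(i <- J) P (Z i @^-1` B i))%E) /\
  (forall i (B : set (borel Rd)), measurable B ->
     P (Z i @^-1` B) = P (Z 0%N @^-1` B)).

Definition mean_zero X : Prop :=
  forall j, ('E_P[fun w => (X w : Rd) ord0 j] = 0)%E.

(* Z 0 plays the role of the generic copy; the steps are Z 1, Z 2, ... *)
Definition walk Z (n : nat) (w : Omega) : Rd :=
  \sum_(1 <= i < n.+1) (Z i w : Rd).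

Definition longest_segment Z (A : set Rd) (n : nat) (w : Omega) : nat :=
  \max_(k < n.+1 | `[< exists2 i, (i <= n - k)%N &
      dilate k%:R A (walk Z (i + k) w - walk Z i w) >]) k.

End random_vectors.

Definition std_frechet (R : realType) (disp : measure_display)
    (T : measurableType disp) (P : probability T R) (alpha : R)
    (W : {RV P >-> R}) : Prop :=
  forall x : R, 0 < x ->
    P [set t | W t <= x] = (expR (- (x `^ (- alpha))))%:E.

Definition cvg_in_distribution (R : realType)
    (disp disp' : measure_display) (T : measurableType disp)
    (T' : measurableType disp') (P : probability T R) (P' : probability T' R)
    (X : nat -> T -> R) (Y : T' -> R) : Prop :=
  [/\ forall n, measurable_fun setT (X n), measurable_fun setT Y &
    forall x : R,
      {for x, continuous (fun y : R => P' [set t | Y t <= y])} ->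
      P [set t | X n t <= x] @[n --> \oo] --> P' [set t | Y t <= x]].

(* Main.v *)
(* Up to events of vanishing probability (two jumps of size at least
   eta max(x a_n, r) at distance r, or some window of length k >= x a_n whose sum
   of truncated jumps exceeds delta k), a window of length k >= x a_n contains
   at most one jump exceeding eta k, and its sum differs from that jump by at
   most delta k.  Hence R_n(A) > x a_n forces some Z_j into a thickening of
   x a_n U, U being the union of the s cl(A), s >= 1; conversely a jump into
   the corresponding open set, eroded by a margin, yields such a window.  The
   two probabilities are (1 - P(Z in B_n))^n with n P(Z in B_n) controlled by
   regular variation.
   The truncated sums are handled by Chernoff's bound with h = H ln k / k: a
   moment of order q in (1, 2] exists because the tail drops by a factor below
   1/2 under doubling, and this gives the rate O(k^-Lam) for every Lam, which
   beats the n^2 windows since n is at most polynomial in a_n. *)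
Require Import Defs.
From HB Require Import structures.
From mathcomp Require Import all_boot all_order all_algebra.
From mathcomp Require Import all_classical all_reals all_analysis.
From mathcomp Require finmap.
From mathcomp Require Import measurable_realfun lra ring.
Import Order.TTheory GRing.Theory Num.Theory.
Import numFieldNormedType.Exports.

Local Open Scope classical_set_scope.
Local Open Scope ring_scope.

Set Implicit Arguments.
Unset Strict Implicit.

(** * Subsets of R^d inside the compactified punctured space *)

(** Every margin has to be proportional to the window length k, because k ranges from x a_n up to n
    while n / a_n tends to infinity. Hence the jump thresholds eta k, the errors delta k and a
    thickening measured relative to the norm of the point. The two limiting sets need not be
    continuity sets of mu, so vague convergence is used only through one-sided inequalities for
    closed and for open sets, and each of them leaves a small gap that pays for the next
    approximation. Regular variation is available only along its own norming sequence a'_n;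
    homogeneity makes any other normalizing sequence asymptotically equivalent to it, and stability
    of the sets under dilation by s >= 1 does the rest. The assumption alpha > 1 enters through
    2^-alpha < 1/2, which yields the moment of order q > 1. That moment makes the truncation bias of
    a centred step small, makes second jumps rare, feeds Chernoff's bound, and gives a_n = o(n), so
    that windows of length O(a_n) fit into {1, ..., n} from all but a vanishing fraction of the
    starting points. *)

Section ext.
Context (R : realType) (d : nat).
Local Notation Rd := 'rV[R]_d.+1.
Implicit Types (U : set Rd) (z : punctured R d).

Lemma to_ext_inj : injective (@to_ext R d).
Proof.
move=> x y /matrixP xy; apply/matrixP => i j.
by have := xy i j; rewrite !mxE => -[].
Qed.

Lemma set_val_continuous : continuous (set_val : punctured R d -> 'rV[\bar R]_d.+1).
Proof. by apply/continuousP => A ?; exists A. Qed.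

(** A finite point of [\bar R] has a neighbourhood basis of images of real neighbourhoods, so a
    small box around [to_ext y] contains finite points only. *)
Lemma embed_nbhs U z y : set_val z = to_ext y -> nbhs y U -> nbhs z (embed U).
Proof.
move=> zy [B yB sBU].
have : nbhs (set_val z) [set x : 'rV[\bar R]_d.+1 | exists2 u, U u & x = to_ext u].
  rewrite zy; exists (fun i j => EFin @` (B i j)).
    move=> i j; rewrite mxE.
    apply: (@filterS _ (nbhs (y i j)) _ (B i j)) (yB i j).
    by move=> t Bt; exists t.
  move=> x xB; exists (\matrix_(i, j) fine (x i j)).
    by apply: sBU => i j; rewrite mxE; have [t Bt <-] := xB i j.
  apply/matrixP => i j; rewrite !mxE; by have [t _ <-] := xB i j.
move=> h; have h' : nbhs z (set_val @^-1` [set x | exists2 u, U u & x = to_ext u]).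
  exact: set_val_continuous h.
by apply: filterS h' => w [u Uu wu]; exists u.
Qed.

Lemma embed_open U : open U -> open (embed U).
Proof.
rewrite !openE => oU z [y Uy zy]; apply: embed_nbhs zy _; exact: oU.
Qed.

Lemma embedC U : embed (~` U) = embed setT `\` embed U.
Proof.
apply/seteqP; split => z.
  move=> [y nUy zy]; split; first by exists y.
  by move=> [y' Uy]; rewrite zy => /to_ext_inj yy; apply: nUy; rewrite yy.
by move=> [[y _ zy] nU]; exists y => //= Uy; apply: nU; exists y.
Qed.

Lemma embed_bigcup (U : nat -> set Rd) : embed (\bigcup_i U i) = \bigcup_i embed (U i).
Proof.
apply/seteqP; split => z.
  by move=> [y [i _ Uy] zy]; exists i => //; exists y.
by move=> [i _ [y Uy zy]]; exists y => //; exists i.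
Qed.

Lemma embed_bigcap (U : nat -> set Rd) : embed (\bigcap_i U i) = \bigcap_i embed (U i).
Proof.
apply/seteqP; split => z.
  by move=> [y Uy zy] i _; exists y => //; exact: Uy.
move=> h; have [y Uy zy] := h 0%N I; exists y => // i _.
by have [y' Uy'] := h i I; rewrite zy => /to_ext_inj ->.
Qed.

Lemma sub_embed U V : U `<=` V -> embed U `<=` embed V.
Proof. by move=> UV z [y Uy zy]; exists y => //; exact: UV. Qed.

(** The sets with Borel image form a sigma-algebra containing the open sets. Complements are taken
    inside [embed setT], which is itself open. *)
Lemma embed_measurable U : measurable (U : set (borel Rd)) ->
  measurable (embed U : set (borel (punctured R d))).
Proof.
have mT : measurable (embed setT : set (borel (punctured R d))).
  by apply: sub_sigma_algebra; apply: embed_open; exact: openT.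
move: U; apply: smallest_sub.
  split.
  - rewrite (_ : embed set0 = set0) //; by apply/seteqP; split => z // -[].
  - by move=> U mU; rewrite setTD embedC; exact: measurableD.
  - by move=> U mU; rewrite embed_bigcup; exact: bigcup_measurable.
by move=> U oU; apply: sub_sigma_algebra; exact: embed_open.
Qed.

(** Passing to the compactification can only add boundary points at infinity, where [mu] will have
    no mass. *)
Lemma boundary_embed U : boundary (embed U) `<=` ~` embed setT `|` embed (boundary U).
Proof.
move=> z [clz niz]; have [[y _ zy]|?] := pselect (embed setT z); last by left.
right; exists y => //; split.
  move=> V yV; have [w []] := clz _ (embed_nbhs zy yV).
  by move=> [u Uu wu] [u' Vu]; rewrite wu => /to_ext_inj e; exists u; split => //; rewrite e.
by move=> yU; apply: niz; exact: embed_nbhs zy yU.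
Qed.

Lemma ext_dilate_embed (u : R) U : 0 < u ->
  ext_dilate u (embed U) = embed (dilate u U).
Proof.
move=> u0; apply/seteqP; split => z.
  move=> [y [x Ux yx]]; rewrite yx => zu; exists (u *: x); first by exists x.
  by rewrite zu; apply/matrixP => i j; rewrite !mxE.
move=> [_ [x Ux <-] zx].
have hx : to_ext x \in [set x : 'rV[\bar R]_d.+1 | x != const_mx 0%E].
  have hz : set_val z != const_mx 0%E by exact: (set_valP z).
  move: hz; rewrite zx inE /=; apply: contra => /eqP /matrixP e.
  apply/eqP/matrixP => i j; have := e i j; rewrite !mxE => -[->]; by rewrite mulr0.
exists (exist _ (to_ext x) hx : punctured R d); first by exists x.
by rewrite zx; apply/matrixP => i j; rewrite !mxE.
Qed.

(** [expand] maps the segment [-1, 1] onto [\bar R] and is an isometry there, because the metric of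
    [\bar R] is read through [contract]. *)
Lemma ereal_compact : compact [set: \bar R].
Proof.
have -> : [set: \bar R] = @expand R @` `[-1, 1]%classic.
  apply/seteqP; split => // x _; exists (contract x); last exact: contractK.
  by rewrite /= in_itv /= -ler_norml contract_le1.
apply: continuous_compact (@segment_compact R (-1) 1).
apply/subspace_continuousP => x; rewrite /= in_itv /= -ler_norml => x1.
apply/cvg_ballP => e e0.
apply: (@filterS _ (nbhs x) _ (ball x e)); last exact: nbhsx_ballx.
move=> y xy; rewrite /= in_itv /= -ler_norml => y1.
by rewrite /ball /= /ereal_ball !expandK ?inE.
Qed.

Definition far (e : R) : set 'rV[\bar R]_d.+1 :=
  [set x | exists j, (e%:E <= `|x ord0 j|)%E].

Lemma far_closed e : closed (far e).
Proof.
rewrite -openC openE => x /= /forallNP xe.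
exists (fun _ _ => [set t : \bar R | `|t| < e%:E]%E).
  move=> i j; apply: open_nbhs_nbhs; split; last first.
    by rewrite ord1 /= ltNge; exact/negP.
  exact: (open_comp (fun x _ => @abse_continuous R x) (@open_ereal_lt_ereal R e%:E)).
by move=> y ye [j]; rewrite leNgt => /negP; apply; exact: ye.
Qed.

(** The full product is compact, and a cluster point taken there lies in the closed set [far e]. It
    is therefore nonzero and belongs to the punctured space. *)
Lemma far_compact (e : R) : 0 < e -> compact (set_val @^-1` far e : set (punctured R d)).
Proof.
move=> e0 F FF FK.
have cT : compact [set v : 'rV[\bar R]_d.+1 | forall i, [set: \bar R] (v ord0 i)].
  by apply: (@rV_compact (\bar R) d.+1 (fun=> setT)) => _; exact: ereal_compact.
pose G := (set_val : punctured R d -> 'rV[\bar R]_d.+1) @ F.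
have GT : G [set v : 'rV[\bar R]_d.+1 | forall i, [set: \bar R] (v ord0 i)] by apply: filterS filterT.
have [x [_ Gx]] := cT G _ GT.
have xe : far e x.
  rewrite ((closure_id (far e)).1 (@far_closed e)).
  by move: Gx; rewrite clusterE; apply.
have x0 : x \in [set x : 'rV[\bar R]_d.+1 | x != const_mx 0%E].
  rewrite inE /=; apply/eqP => x0; have [j] := xe.
  by rewrite x0 mxE abse0 lee_fin leNgt e0.
exists (exist _ x x0 : punctured R d); split => //.
move=> A B FA [C [[D oD <-] Dx] CB].
have GA : G [set v | exists2 w : punctured R d, A w & set_val w = v].
  by apply: (@filterS _ F _ A) FA => w Aw; exists w.
have [y [[w Aw <-] Dw]] := Gx _ D GA (open_nbhs_nbhs (conj oD Dx)).
by exists w; split => //; exact: CB.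
Qed.

Lemma exists_coord_norm_ge (y : Rd) (e : R) : 0 < e -> e <= `|y| -> exists j, e <= `|y ord0 j|.
Proof.
rewrite [`|y|]/Num.norm /= mx_normrE => e0 /bigmax_geP [|[[i j] _ /=]].
  by rewrite leNgt e0.
by rewrite ord1 => ?; exists j.
Qed.

Lemma away0P U : ~ closure U 0 -> exists2 e : R, 0 < e & forall y, U y -> e <= `|y|.
Proof.
move=> U0; apply: contrapT => h; apply: U0 => B /nbhs_ballP [e /= e0 eB].
apply: contrapT => hB; apply: h; exists e => // y Uy.
rewrite leNgt; apply/negP => ye; apply: hB; exists y; split => //.
by apply: eB; rewrite -ball_normE /= sub0r normrN.
Qed.

Lemma precompact_embed U : ~ closure U 0 -> precompact (embed U).
Proof.
move=> /away0P[e e0 eU]; exists (set_val @^-1` far e).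
  move=> z [y Uy zy]; rewrite /= /far /= zy.
  have [j yj] := exists_coord_norm_ge e0 (eU _ Uy).
  by exists j; rewrite mxE.
split; first exact: far_compact.
rewrite -openC.
apply: (@open_comp (punctured R d) _ set_val (~` far e)); last by rewrite openC; exact: far_closed.
by move=> z _; exact: set_val_continuous.
Qed.

End ext.

(** * Borel measurability on R^d and the Euclidean norm *)

Section meas.
Context (R : realType) (d : nat).
Local Notation Rd := 'rV[R]_d.+1.

Lemma continuous_borel_measurable (T : ptopologicalType) (f : T -> R) :
  continuous f -> measurable_fun setT (f : borel T -> R).
Proof.
move=> /continuousP cf.
apply: (measurability _ (RGenOpens.measurableE R)) => _ [_ [a [b ->] <-]].
rewrite setTI; apply: sub_sigma_algebra; exact/cf/interval_open.
Qed.

Lemma continuous_borel_measurable_borel (T T' : ptopologicalType) (f : T -> T') :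
  continuous f -> measurable_fun setT (f : borel T -> borel T').
Proof.
move=> /continuousP cf; apply: (@measurability _ _ (borel T) (borel T') setT f (@open T')) => //.
by move=> _ [B oB <-]; rewrite setTI; apply: sub_sigma_algebra; exact: cf.
Qed.

Lemma borel_open (T : ptopologicalType) (U : set T) :
  open U -> measurable (U : set (borel T)).
Proof. exact: sub_sigma_algebra. Qed.

Lemma borel_closed (T : ptopologicalType) (U : set T) :
  closed U -> measurable (U : set (borel T)).
Proof.
by move=> cU; rewrite -(setCK U); apply: measurableC; apply: borel_open; rewrite openC.
Qed.

Definition rat_box (c : 'rV[rat]_d.+1 * nat) : set Rd :=
  [set y | forall j, `|y ord0 j - ratr (c.1 ord0 j)| < c.2.+1%:R^-1].

Lemma open_rat_box (U : set Rd) (x : Rd) : open U -> U x ->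
  exists c, rat_box c x /\ rat_box c `<=` U.
Proof.
rewrite openE => oU Ux; have /nbhs_ballP[e /= e0 eU] := oU _ Ux.
have [m me] : exists m : nat, (m.+1%:R^-1 : R) < e / 2.
  have e20 : 0 < e / 2 by rewrite divr_gt0.
  by have [m _ /(_ m (leqnn m))] := near_infty_natSinv_lt (PosNum e20); exists m.
have m0 : (0 : R) < m.+1%:R^-1 by rewrite invr_gt0.
have hq (j : 'I_d.+1) : exists q : rat, `|x ord0 j - ratr q| < m.+1%:R^-1.
  have [|q] := @rat_in_itvoo R (x ord0 j - m.+1%:R^-1) (x ord0 j + m.+1%:R^-1); first by rewrite ltrBlDr -addrA ltrDl addr_gt0.
  by rewrite in_itv /= => hq; exists q; rewrite ltr_distlC.
have [q hq'] := choice hq.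
exists (\row_j q j, m); split; first by move=> j /=; rewrite mxE.
move=> y /= hy; apply: eU; rewrite -ball_normE /=.
rewrite [ltLHS]/Num.norm /= mx_normrE; apply/bigmax_ltP; split => // -[i j] _ /=.
rewrite !mxE ord1; have := hy j; have := hq' j; rewrite mxE => h1 h2.
rewrite -(subrKA (ratr (q j))) (le_lt_trans (ler_normD _ _)) //.
by rewrite [ltRHS]splitr ltrD // ?(lt_trans h1) // distrC (lt_trans h2).
Qed.

(** An open set is a countable union of rational boxes, enumerated through [unpickle], and the
    preimage of a box is a finite intersection of coordinate conditions. *)
Lemma measurable_rV disp (T : measurableType disp) (X : T -> Rd) :
  (forall j, measurable_fun setT (fun w => X w ord0 j)) ->
  measurable_fun setT (X : T -> borel Rd).
Proof.
move=> mX; apply: (@measurability _ _ T (borel Rd) setT X (@open Rd)) => //.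
move=> _ [U oU <-]; rewrite setTI.
rewrite (_ : X @^-1` U = \bigcup_n (if unpickle n is Some c then
   if `[< rat_box c `<=` U >] then X @^-1` rat_box c else set0 else set0)); last first.
  apply/seteqP; split => w /=.
    move=> /(open_rat_box oU)[c [cX cU]]; exists (pickle c) => //.
    by rewrite pickleK; case: asboolP.
  by move=> [n _]; case: unpickle => // c; case: asboolP => // h; exact: h.
apply: bigcup_measurable => n _; case: unpickle => // c; case: asboolP => // _.
rewrite (_ : _ @^-1` _ = \bigcap_(j in [set: 'I_d.+1]) [set w | `|X w ord0 j - ratr (c.1 ord0 j)| < c.2.+1%:R^-1]); last first.
  by apply/seteqP; split => w h j //; [move=> _; exact: h|exact: h].
apply: fin_bigcap_measurable; first exact: (@finite_finset 'I_d.+1).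
move=> j _.
have -> : [set w | `|X w ord0 j - ratr (c.1 ord0 j)| < c.2.+1%:R^-1] =
  (fun w => `|X w ord0 j - ratr (c.1 ord0 j)|) @^-1` `]-oo, c.2.+1%:R^-1[%classic.
  by apply/seteqP; split => w /=; rewrite in_itv.
rewrite -[X in measurable X]setTI.
have mf : measurable_fun setT (fun w => `|X w ord0 j - ratr (c.1 ord0 j)|).
  by apply: measurableT_comp => //; apply: measurable_funB.
exact: mf.
Qed.

Lemma dilateE (s : R) (A : set Rd) : s != 0 -> dilate s A = [set x | A (s^-1 *: x)].
Proof.
move=> s0; apply/seteqP; split => x /=.
  by move=> [y Ay <-]; rewrite scalerA mulVf // scale1r.
by move=> Ax; exists (s^-1 *: x) => //; rewrite scalerA mulfV // scale1r.
Qed.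

Lemma dilate_measurable (s : R) (A : set Rd) : s != 0 ->
  measurable (A : set (borel Rd)) -> measurable (dilate s A : set (borel Rd)).
Proof.
move=> s0 mA; rewrite dilateE // -[X in measurable X]setTI.
exact: (continuous_borel_measurable_borel (@scaler_continuous R Rd s^-1) measurableT mA).
Qed.

Lemma enorm_continuous : continuous (@enorm R d).
Proof.
have c : continuous (fun x : Rd => \sum_j x ord0 j ^+ 2).
  apply: continuous_big => [|j _ x]; first exact: add_continuous.
  exact: (continuous_comp (@coord_continuous _ _ _ ord0 j x) (@exprn_continuous R 2 _)).
move=> x; exact: (continuous_comp (c x) (@sqrt_continuous R _)).
Qed.

Lemma enormZ (s : R) (x : Rd) : 0 <= s -> enorm (s *: x) = s * enorm x.
Proof.
move=> s0; rewrite /enorm -[in RHS](ger0_norm s0) -sqrtr_sqr -sqrtrM ?sqr_ge0 //.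
by congr Num.sqrt; rewrite mulr_sumr; apply: eq_bigr => j _; rewrite mxE exprMn.
Qed.

Lemma coord_le_enorm (x : Rd) j : `|x ord0 j| <= enorm x.
Proof.
rewrite -sqrtr_sqr ler_sqrt; last by apply: sumr_ge0 => i _; exact: sqr_ge0.
by rewrite (bigD1 j) //= lerDl; apply: sumr_ge0 => i _; exact: sqr_ge0.
Qed.

Lemma norm_le_enorm (x : Rd) : `|x| <= enorm x.
Proof.
rewrite [leLHS]/Num.norm /= mx_normrE; apply/bigmax_leP; split; first exact: sqrtr_ge0.
by move=> [i j] _ /=; rewrite ord1; exact: coord_le_enorm.
Qed.

End meas.

(** * Portmanteau inequalities *)

Section atoms.
Context disp (T : measurableType disp) (R : realType) (m : {measure set T -> \bar R}).

(** Otherwise every fiber over ]0, e[ has positive mass. Inside a set of finite mass only finitely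
    many disjoint fibers exceed 1/(n+1), so ]0, e[ would be countable, against its positive Lebesgue
    measure. *)
Lemma exists_null_fiber (S : R -> set T) (W : set T) (e : R) : 0 < e ->
  (forall r, measurable (S r)) -> trivIset setT S -> measurable W ->
  (forall r, S r `<=` W) -> (m W < +oo)%E ->
  exists2 r, 0 < r < e & m (S r) = 0%E.
Proof.
move=> e0 mS tS mW SW Woo; apply: contrapT => h.
have Spos r : 0 < r < e -> (0 < m (S r))%E.
  move=> re; rewrite lt0e measure_ge0 andbT; apply/eqP => mS0; apply: h; by exists r.
have Sfin r : m (S r) \is a fin_num.
  rewrite ge0_fin_numE //; apply: le_lt_trans Woo; apply: le_measure; rewrite ?inE //.
suff : countable (`]0, e[%classic : set R).
  move=> /countable_lebesgue_measure0; rewrite lebesgue_measure_itv /= lte_fin e0.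
  by rewrite -EFinB subr0 => -[] /eqP; rewrite gt_eqF.
apply: (@sub_countable _ _ _ (\bigcup_n [set r | n.+1%:R^-1 < fine (m (S r))])).
  apply: subset_card_le => r /=; rewrite in_itv /= => /Spos.
  rewrite -(fineK (Sfin r)) lte_fin => /ltr_add_invr[k]; rewrite add0r => kr.
  by exists k.
apply: bigcup_countable => // n _; apply: finite_set_countable.
apply: contrapT => /infiniteP/pcard_leP/injfunPex[/= q q_fun q_inj].
have mU : measurable (\bigcup_k S (q k)) by apply: bigcup_measurable.
have [N hN] : exists N : nat, fine (m W) * n.+1%:R < N%:R.
  have := archi_boundP (x := fine (m W) * n.+1%:R); rewrite mulr_ge0 // => /(_ isT) hh.
  by eexists; exact: hh.
have : (m (\bigcup_k S (q k)) <= m W)%E.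
  apply: le_measure; rewrite ?inE //; by move=> x [k _]; exact: SW.
rewrite leNgt => /negP; apply.
rewrite measure_bigcup //; last first.
  by move=> i j _ _ hij; apply: q_inj; rewrite ?inE //; exact: tS hij.
apply: (lt_le_trans _ (nneseries_lim_ge N _)) => //.
rewrite (eq_bigl xpredT) => [|i]; last by rewrite in_setT.
under eq_bigr do rewrite -(fineK (Sfin (q _))).
rewrite sumEFin -(fineK (x := m W)) ?ge0_fin_numE // lte_fin.
apply: (@lt_le_trans _ _ (\sum_(0 <= k < N) n.+1%:R^-1)).
  by rewrite big_mkord sumr_const card_ord -[ltRHS]mulr_natl ltr_pdivlMr.
by apply: ler_sum => k _; apply: ltW; exact: q_fun.
Qed.
End atoms.

Section dist.
Context (R : realType) (d : nat).
Local Notation Rd := 'rV[R]_d.+1.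
Implicit Types (A : set Rd).

(** Distance in the sup norm. For [A] empty the infimum is 0 by default, hence the nonemptiness
    hypotheses in what follows. *)
Definition dist_set A (z : Rd) : R := inf [set `|z - y| | y in A].

Lemma dist_set_le A z y : A y -> dist_set A z <= `|z - y|.
Proof.
move=> Ay; apply: ge_inf; last by exists y.
by exists 0 => _ [u _ <-].
Qed.

Lemma dist_set_lt A z r : A !=set0 -> dist_set A z < r -> exists2 y, A y & `|z - y| < r.
Proof.
move=> [y0 Ay0] h; have [|_ [y Ay <-] yr] := inf_lt _ h; last by exists y.
by exists `|z - y0|; exists y0.
Qed.

Lemma dist_set_lip A z w : A !=set0 -> dist_set A z <= dist_set A w + `|z - w|.
Proof.
move=> A0; apply/ler_addgt0Pr => e e0.
have [|y Ay yw] := @dist_set_lt A w (dist_set A w + e) A0; first by rewrite ltrDl.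
rewrite (le_trans (dist_set_le z Ay)) // -(subrKA w) (le_trans (ler_normD _ _)) //.
by rewrite addrC addrAC lerD2r ltW.
Qed.

Lemma dist_set_continuous A : A !=set0 -> continuous (dist_set A).
Proof.
move=> A0 z B /nbhs_ballP[e /= e0 eB].
apply/nbhs_ballP; exists e => //= w; rewrite -ball_normE /= => zw.
apply: eB; rewrite -ball_normE /=; apply: le_lt_trans zw; rewrite ler_distl lerBlDr dist_set_lip //=.
by rewrite distrC dist_set_lip.
Qed.

Lemma dist_set0 A z : closed A -> A !=set0 -> dist_set A z <= 0 -> A z.
Proof.
move=> cA A0 h; rewrite ((closure_id A).1 cA) => B /nbhs_ballP[e /= e0 eB].
have [|y Ay yz] := @dist_set_lt A z e A0; first exact: le_lt_trans e0.
by exists y; split => //; apply: eB; rewrite -ball_normE.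
Qed.

End dist.

Lemma cvge_near_lt (R : realFieldType) (u : nat -> \bar R) (l t : \bar R) :
  u @ \oo --> l -> (l < t)%E -> \forall n \near \oo, (u n < t)%E.
Proof. by move=> ul lt; exact: (ul _ (open_ereal_lt' lt)). Qed.

Lemma cvge_near_gt (R : realFieldType) (u : nat -> \bar R) (l t : \bar R) :
  u @ \oo --> l -> (t < l)%E -> \forall n \near \oo, (t < u n)%E.
Proof. by move=> ul lt; exact: (ul _ (open_ereal_gt' lt)). Qed.

Section portmanteau.
Context (R : realType) (d : nat).
Local Notation Rd := 'rV[R]_d.+1.
Context (mu : {measure set (borel (punctured R d)) -> \bar R}).
Hypothesis mu_radon : radon mu.
Hypothesis mu_inf : mu (~` embed setT) = 0%E.
Implicit Types (U V F G : set Rd).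

Definition emeas U := mu (embed U).

Lemma le_emeas U V : measurable (U : set (borel Rd)) -> measurable (V : set (borel Rd)) ->
  U `<=` V -> (emeas U <= emeas V)%E.
Proof.
move=> mU mV UV; apply: le_measure; rewrite ?inE; try exact: embed_measurable.
exact: sub_embed.
Qed.

Lemma emeas_fin U : measurable (U : set (borel Rd)) -> ~ closure U 0 -> (emeas U < +oo)%E.
Proof.
move=> mU /precompact_embed[K UK [cK clK]].
have mK : measurable (K : set (borel (punctured R d))) by exact: borel_closed.
apply: le_lt_trans (mu_radon mK cK); apply: le_measure; rewrite ?inE //.
exact: embed_measurable.
Qed.

Lemma away0_sub U V : U `<=` V -> ~ closure V 0 -> ~ closure U 0.
Proof. by move=> /closureS UV; apply: contra_not; exact: UV. Qed.

Lemma away0_ge U (e : R) : 0 < e -> (forall y, U y -> e <= `|y|) -> ~ closure U 0.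
Proof.
move=> e0 Ue /(_ _ (nbhsx_ballx _ _ e0))[y [Uy]].
by rewrite -ball_normE /= sub0r normrN ltNge Ue.
Qed.

Lemma null_level (f : Rd -> R) (V : set Rd) (e : R) : 0 < e -> continuous f ->
  measurable (V : set (borel Rd)) -> ~ closure V 0 ->
  exists2 r, 0 < r < e & emeas ([set x | f x = r] `&` V) = 0%E.
Proof.
move=> e0 cf mV V0.
have mf r : measurable ([set x | f x = r] : set (borel Rd)).
  apply: borel_closed; apply: (@preimage_closed _ _ f [set r]); last exact: closed_eq.
  by move=> x _; exact: cf.
apply: (@exists_null_fiber _ _ _ mu (fun r => embed ([set x | f x = r] `&` V)) (embed V)) => //.
- by move=> r; apply: embed_measurable; exact: measurableI.
- move=> i j _ _ [z [[x [fx _] zx] [y [fy _]]]]; rewrite zx => /to_ext_inj xy.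
  by rewrite -fx xy fy.
- exact: embed_measurable.
- by move=> r; apply: sub_embed => x [].
- exact: emeas_fin.
Qed.

Context (disp : measure_display) (Omega : measurableType disp) (P : probability Omega R).
Context (X : {RV P >-> borel Rd}) (a : nat -> R).
Hypothesis a_gt0 : forall n, 0 < a n.
Hypothesis Xmu : vague_cvg (fun n => scaled_law X n (a n)) mu.

Definition tail_law (n : nat) (r : R) U : \bar R :=
  (n%:R%:E * P [set w | U (r^-1 *: (X w : Rd))])%E.

(** The punctured space has no point over 0, hence the condition on [U]: otherwise outcomes with
    rescaled value 0 would count on the right only. *)
Lemma scaled_law_embed n r U : ~ U 0 -> scaled_law X n r (embed U) = tail_law n r U.
Proof.
move=> U0; rewrite /scaled_law /tail_law; congr (_ * P _)%E.
apply/seteqP; split => w /=.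
  by move=> [z [y Uy ->]] /to_ext_inj <-.
move=> Uw; set y := r^-1 *: _ in Uw *.
have hy : to_ext y \in [set x : 'rV[\bar R]_d.+1 | x != const_mx 0%E].
  rewrite inE /=; apply/eqP => /matrixP e; apply: U0; rewrite (_ : 0 = y) //.
  by apply/matrixP => i j; have := e i j; rewrite !mxE => -[->].
by exists (exist _ (to_ext y) hy : punctured R d) => //; exists y.
Qed.

Lemma tail_law_measurable r U : measurable (U : set (borel Rd)) ->
  measurable [set w | U (r^-1 *: (X w : Rd))].
Proof.
move=> mU.
have mX : measurable_fun setT (X : Omega -> borel Rd) by exact: measurable_funPT.
have ms := continuous_borel_measurable_borel (@scaler_continuous R Rd r^-1).
have := measurableT_comp ms mX; move=> /(_ measurableT U mU); by rewrite setTI.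
Qed.

Lemma le_tail_law n r r' U V : measurable (U : set (borel Rd)) ->
  measurable (V : set (borel Rd)) ->
  (forall x, U (r^-1 *: x) -> V (r'^-1 *: x)) -> (tail_law n r U <= tail_law n r' V)%E.
Proof.
move=> mU mV UV; apply: lee_wpmul2l; first by rewrite lee_fin.
by apply: le_measure; rewrite ?inE; try exact: tail_law_measurable; move=> w; exact: UV.
Qed.

(** The boundary taken in the punctured space exceeds that of [U] only by points at infinity, so it
    is [mu]-null as well. *)
Lemma tail_law_cvg U : measurable (U : set (borel Rd)) -> ~ closure U 0 ->
  emeas (boundary U) = 0%E -> tail_law n (a n) U @[n --> \oo] --> emeas U.
Proof.
move=> mU U0 bU.
have U0' : ~ U 0 by move=> /subset_closure.
have := @Xmu (embed U) (embed_measurable mU) (precompact_embed U0).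
under eq_cvg do rewrite scaled_law_embed //.
apply.
have mb : measurable (boundary U : set (borel Rd)).
  apply: measurableD; first by apply: borel_closed; exact: closed_closure.
  by apply: borel_open; exact: open_interior.
apply: (@subset_measure0 _ (borel (punctured R d)) R mu (boundary (embed U)) (~` embed setT `|` embed (boundary U))).
- apply: measurableD; first by apply: borel_closed; exact: closed_closure.
  by apply: borel_open; exact: open_interior.
- apply: measurableU; last exact: embed_measurable.
  by apply: measurableC; exact: embed_measurable.
- exact: boundary_embed.
- apply: null_set_setU => //; last exact: embed_measurable.
  by apply: measurableC; exact: embed_measurable.
Qed.

(* The boundaries of the sets {dist(., F) <= r} are disjoint, so that all but
   countably many of these sets are continuity sets of mu. *)
Lemma tail_law_lt F t : closed F -> ~ closure F 0 -> (emeas F < t)%E ->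
  \forall n \near \oo, (tail_law n (a n) F < t)%E.
Proof.
move=> cF F0 Ft.
have mF := borel_closed cF.
(* The distance to the empty set has the default value 0, so this case is settled apart. *)
have [F00|/set0P Fne] := eqVneq F set0.
  apply: nearW => n; rewrite /tail_law F00.
  have -> : [set w | set0 ((a n)^-1 *: (X w : Rd))] = set0 by apply/seteqP; split => w.
  rewrite measure0 mule0; apply: le_lt_trans Ft; exact: measure_ge0.
have [e e0 Fe] := away0P F0.
pose f := dist_set F.
have cf : continuous f by exact: dist_set_continuous.
pose C r := [set x | f x <= r].
have clC r : closed (C r).
  apply: (@preimage_closed _ _ f [set x | x <= r]); last exact: closed_le.
  by move=> x _; exact: cf.
have mC r := borel_closed (clC r).
(* The [e / 2] thickening still stays at distance at least [e / 4] from 0, so all smaller ones have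
   finite mass. *)
have C0 : ~ closure (C (e / 2)) 0.
  apply: (@away0_ge _ (e / 4)); first by rewrite divr_gt0.
  move=> y Cy; have [|u Fu yu] := @dist_set_lt _ _ F y (3 / 4 * e) Fne.
    by apply: le_lt_trans Cy _; lra.
  have := Fe _ Fu; have : `|u| <= `|y| + `|y - u|.
    by rewrite -{1}(subKr y u) (le_trans (ler_normB _ _)).
  lra.
have CS r s : r <= s -> C r `<=` C s by move=> rs x /= /le_trans; apply.
pose c0 k : R := e / 2 * k.+1%:R^-1.
have c0_le k : c0 k <= e / 2.
  rewrite /c0 ger_pMr ?divr_gt0 // invf_le1 // ?ltr0n // ler1n //.
have c0_gt0 k : 0 < c0 k by rewrite /c0 mulr_gt0 ?divr_gt0 ?invr_gt0.
have c0S k l : (k <= l)%N -> c0 l <= c0 k.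
  by move=> kl; rewrite /c0 ler_pM2l ?divr_gt0 // lef_pV2 ?posrE ?ltr0n // ler_nat.
have FE : F = \bigcap_k C (c0 k).
  apply/seteqP; split => [x Fx k _|x hx].
    apply: (@le_trans _ _ 0); last exact: ltW.
    by have := dist_set_le x Fx; rewrite subrr normr0.
  apply: dist_set0 => //; apply/ler_addgt0Pr => h h0; rewrite add0r.
  have [k /= kh] : exists k : nat, c0 k < h.
    have h' : 0 < h / (e / 2) by rewrite !divr_gt0.
    have [k] := ltr_add_invr h'; rewrite add0r => kh; exists k.
    by rewrite /c0 mulrC -ltr_pdivlMr // divr_gt0.
  by apply: le_trans (hx k I) _; exact: ltW.
have cvC : emeas (C (c0 k)) @[k --> \oo] --> emeas F.
  rewrite /emeas [in X in _ --> X]FE embed_bigcap.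
  apply: (@nonincreasing_cvg_mu _ (borel (punctured R d)) R mu (fun k => embed (C (c0 k)))).
  - by apply: emeas_fin => //; apply: away0_sub C0; exact: CS.
  - by move=> k; exact: embed_measurable.
  - by apply: bigcapT_measurable => k; exact: embed_measurable.
  - by move=> k l kl; apply/subsetPset; apply: sub_embed; apply: CS; exact: c0S.
(* The radius [c0 k] brings the mass below [t], and any smaller [r] does too, which leaves room to
   pick one with a null level set. *)
have [k _ /(_ _ (leqnn k)) kt] := cvge_near_lt cvC Ft.
have [r /andP[r0 rk] mr] := null_level (c0_gt0 k) cf (mC (e / 2)) C0.
have rC := CS _ _ (ltW rk).
have re : C r `<=` C (e / 2) by apply: CS; exact: le_trans (ltW rk) _.
have Cr0 : ~ closure (C r) 0 by apply: away0_sub C0.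
have bC : boundary (C r) `<=` [set x | f x = r] `&` C (e / 2).
  move=> x [clx nix]; have Cx : C r x by rewrite ((closure_id (C r)).1 (clC r)).
  split; last exact: re.
  apply/eqP; rewrite eq_le Cx /= leNgt; apply/negP => fxr; apply: nix.
  have ol : open [set y | f y < r].
    by apply: (@open_comp _ _ f [set y | y < r]); [move=> y _; exact: cf|exact: open_lt].
  by apply: filterS (open_nbhs_nbhs (conj ol fxr)) => y /= /ltW.
have mbC : measurable (boundary (C r) : set (borel Rd)).
  apply: measurableD; first by apply: borel_closed; exact: closed_closure.
  by apply: borel_open; exact: open_interior.
have bC0 : emeas (boundary (C r)) = 0%E.
  apply/eqP; rewrite eq_le measure_ge0 andbT -mr; apply: le_emeas => //.
  apply: measurableI => //; apply: borel_closed.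
  apply: (@preimage_closed _ _ f [set r]); last exact: closed_eq.
  by move=> x _; exact: cf.
have crt : (emeas (C r) < t)%E by apply: le_lt_trans kt; exact: le_emeas.
apply: filterS (cvge_near_lt (tail_law_cvg (mC r) Cr0 bC0) crt) => n.
apply: le_lt_trans; apply: le_tail_law => // x Fx.
rewrite /C /=; apply: le_trans (ltW r0).
by have := dist_set_le ((a n)^-1 *: x) Fx; rewrite subrr normr0.
Qed.

(** Dual to the closed case: the sets of points at distance more than [r] from the complement
    increase to [G] as [r] decreases to 0, and the boundary of each lies in a level set of the
    distance, null for suitable [r]. *)
Lemma tail_law_gt G t : open G -> ~ closure G 0 -> (t < emeas G)%E ->
  \forall n \near \oo, (t < tail_law n (a n) G)%E.
Proof.
move=> oG G0 Gt.
have mG := borel_open oG.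
have Gne : ~` G !=set0 by exists 0 => /subset_closure.
pose f := dist_set (~` G).
have cf : continuous f by exact: dist_set_continuous.
pose C r := [set x | r < f x].
have opC r : open (C r).
  by apply: (@open_comp _ _ f [set x | r < x]); [move=> x _; exact: cf|exact: open_gt].
have mC r := borel_open (opC r).
have CG r : 0 <= r -> C r `<=` G.
  move=> r0 x; rewrite /C /= ltNge => /negP rx; apply: contrapT => nGx; apply: rx.
  by apply: le_trans (@dist_set_le _ _ (~` G) x x nGx) _; rewrite subrr normr0.
have CS r s : r <= s -> C s `<=` C r by move=> rs x /=; exact: le_lt_trans.
pose c0 k : R := k.+1%:R^-1.
have c0_gt0 k : 0 < c0 k by rewrite invr_gt0.
have c0S k l : (k <= l)%N -> c0 l <= c0 k.
  by move=> kl; rewrite lef_pV2 ?posrE ?ltr0n // ler_nat.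
have GE : G = \bigcup_k C (c0 k).
  apply/seteqP; split => [x Gx|x [k _ /CG]]; last by apply; exact: ltW.
  have fx : 0 < f x.
    rewrite ltNge; apply/negP => /dist_set0; move/(_ _ Gne) => h.
    by apply: (h _ Gx); rewrite closedC.
  by have [k] := ltr_add_invr fx; rewrite add0r => kh; exists k.
have cvC : emeas (C (c0 k)) @[k --> \oo] --> emeas G.
  rewrite /emeas [in X in _ --> X]GE embed_bigcup.
  apply: (@nondecreasing_cvg_mu _ (borel (punctured R d)) R mu (fun k => embed (C (c0 k)))).
  - by move=> k; exact: embed_measurable.
  - by apply: bigcup_measurable => k _; exact: embed_measurable.
  - by move=> k l kl; apply/subsetPset; apply: sub_embed; apply: CS; exact: c0S.
have [k _ /(_ _ (leqnn k)) kt] := cvge_near_gt cvC Gt.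
have [r /andP[r0 rk] mr] := null_level (c0_gt0 k) cf mG G0.
have rC := CS _ _ (ltW rk).
have Cr0 : ~ closure (C r) 0 by apply: away0_sub G0; apply: CG; exact: ltW.
have bC : boundary (C r) `<=` [set x | f x = r] `&` G.
  move=> x [clx nix].
  have clC : closed [set x | r <= f x].
    by apply: (@preimage_closed _ _ f [set x | r <= x]); [move=> y _; exact: cf|exact: closed_ge].
  have Cx : r <= f x.
    have : closure [set x | r <= f x] x by apply: closureS clx => y /= /ltW.
    by rewrite -((closure_id _).1 clC).
  split; last by apply: (CG (r / 2)); rewrite /C /=; [apply: ltW; rewrite divr_gt0|apply: lt_le_trans Cx; lra].
  apply/eqP; rewrite eq_le Cx andbT leNgt; apply/negP => fxr; apply: nix.
  exact: (open_nbhs_nbhs (conj (opC r) fxr)).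
have mbC : measurable (boundary (C r) : set (borel Rd)).
  apply: measurableD; first by apply: borel_closed; exact: closed_closure.
  by apply: borel_open; exact: open_interior.
have bC0 : emeas (boundary (C r)) = 0%E.
  apply/eqP; rewrite eq_le measure_ge0 andbT -mr; apply: le_emeas => //.
  apply: measurableI => //; apply: borel_closed.
  apply: (@preimage_closed _ _ f [set r]); last exact: closed_eq.
  by move=> x _; exact: cf.
have crt : (t < emeas (C r))%E by apply: lt_le_trans kt _; exact: le_emeas.
apply: filterS (cvge_near_gt (tail_law_cvg (mC r) Cr0 bC0) crt) => n.
move/lt_le_trans; apply; apply: le_tail_law => // x; apply: CG; exact: ltW.
Qed.

End portmanteau.

(** * Change of normalizing sequence *)

Section powR_facts.
Context (R : realType) (alpha : R) (alpha_gt0 : 0 < alpha).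

Lemma powRN_lt1 (c : R) : 1 < c -> c `^ (- alpha) < 1.
Proof.
move=> c1; have c0 : 0 < c by exact: lt_trans c1.
rewrite powRN invf_lt1 ?powR_gt0 //.
by have := gt0_ltr_powR alpha_gt0 (x := 1) (y := c); rewrite powR1 !nnegrE ler01 (ltW c0); apply.
Qed.

Lemma powRN_gt1 (c : R) : 0 < c -> c < 1 -> 1 < c `^ (- alpha).
Proof.
move=> c0 c1; rewrite powRN invf_gt1 ?powR_gt0 //.
by have := gt0_ltr_powR alpha_gt0 (x := c) (y := 1); rewrite powR1 !nnegrE ler01 (ltW c0); apply.
Qed.

(** Converts a factor [m] of slack in the mass into a dilation by [c], since dilating by [c]
    multiplies [mu] by the power [- alpha] of [c]. *)
Lemma powRN_surj (m : R) : 0 < m -> exists c : R,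
  [/\ 0 < c, c `^ (- alpha) = m, 1 < m -> c < 1 & m < 1 -> 1 < c].
Proof.
move=> m0.
have e : (m `^ (- alpha^-1)) `^ (- alpha) = m.
  by rewrite -powRrM mulrNN mulVf ?gt_eqF // powRr1 // ltW.
have c0 : 0 < m `^ (- alpha^-1) by exact: powR_gt0.
exists (m `^ (- alpha^-1)); split => // h; rewrite ltNge le_eqVlt; apply/negP => /orP[/eqP c1|c1].
- by move: e; rewrite -c1 powR1 => me; move: h; rewrite -me ltxx.
- by have := lt_trans h (eq_ind _ (fun x => x < 1) (powRN_lt1 c1) _ e); rewrite ltxx.
- by move: e; rewrite c1 powR1 => me; move: h; rewrite -me ltxx.
- by have := lt_trans (eq_ind _ (fun x => 1 < x) (powRN_gt1 c0 c1) _ e) h; rewrite ltxx.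
Qed.
End powR_facts.

(** Above the level [L] the first power is traded for the power [q] with a gain of order [1 - q] in
    [L]; this is how a moment of order [q] makes truncation errors small. *)
Lemma le_powR_split (R : realType) (q L t : R) : 1 <= q -> 0 < L -> L <= t -> t <= L `^ (1 - q) * t `^ q.
Proof.
move=> q1 L0 Lt; have tpos := lt_le_trans L0 Lt.
have tE : t = t `^ (1 - q) * t `^ q.
  by rewrite -powRD ?subrK ?powRr1 ?(ltW tpos) // gt_eqF ?implybT.
rewrite [leLHS]tE ler_wpM2r ?powR_ge0 // -opprB !powRN lef_pV2 ?posrE ?powR_gt0 //.
by apply: ge0_ler_powR; rewrite ?nnegrE ?subr_ge0 // ltW.
Qed.

Lemma powRN_small (R : realType) (kap m : R) : 0 < kap -> 0 < m ->
  exists2 y : R, 0 < y & forall L, y <= L -> L `^ (- kap) <= m.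
Proof.
move=> kap0 m0; have [y [y0 <- _ _]] := powRN_surj kap0 m0; exists y => // L yL.
have L0 := lt_le_trans y0 yL.
rewrite !powRN lef_pV2 ?posrE ?powR_gt0 //.
by apply: ge0_ler_powR; rewrite ?nnegrE // ltW.
Qed.

Lemma ln_le_powR (R : realType) (s k : R) : 0 < s -> 0 < k -> ln k <= k `^ s / s.
Proof.
move=> s0 k0; rewrite ler_pdivlMr // mulrC -ln_powR ltW // ln_sublinear // powR_gt0 //.
Qed.

Section transfer.
Context (R : realType) (d : nat).
Local Notation Rd := 'rV[R]_d.+1.
Context (mu : {measure set (borel (punctured R d)) -> \bar R}).
Context (disp : measure_display) (Omega : measurableType disp) (P : probability Omega R).
Context (X : {RV P >-> borel Rd}) (alpha : R).
Implicit Types (U V F G : set Rd).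

(** [fine] sends +oo to 0, so the real value is faithful only on sets bounded away from 0, where
    [mu] is finite. *)
Definition rmeas U : R := fine (mu (embed U)).
Definition rlaw (n : nat) (r : R) U : R := n%:R * fine (P [set w | U (r^-1 *: (X w : Rd))]).
Definition tailp (u : R) : R := fine (P [set w | u < enorm (X w : Rd)]).

Definition enorm_ge (c : R) : set Rd := [set x | c <= enorm x].
Definition enorm_gt (c : R) : set Rd := [set x | c < enorm x].

Lemma enorm_ge_closed c : closed (enorm_ge c).
Proof.
apply: (@preimage_closed _ _ (@enorm R d) [set x | c <= x]); last exact: closed_ge.
by move=> x _; exact: enorm_continuous.
Qed.

Lemma enorm_gt_open c : open (enorm_gt c).
Proof.
apply: (@open_comp _ _ (@enorm R d) [set x | c < x]); last exact: open_gt.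
by move=> x _; exact: enorm_continuous.
Qed.

Lemma borel_enorm_ge c : measurable (enorm_ge c : set (borel Rd)).
Proof. by apply: borel_closed; exact: enorm_ge_closed. Qed.

Lemma borel_enorm_gt c : measurable (enorm_gt c : set (borel Rd)).
Proof. by apply: borel_open; exact: enorm_gt_open. Qed.

Lemma enorm0 : enorm (0 : Rd) = 0.
Proof. by rewrite /enorm big1 ?sqrtr0 // => i _; rewrite mxE expr0n. Qed.

Lemma enorm_ge_away c : 0 < c -> ~ closure (enorm_ge c) 0.
Proof.
move=> c0; rewrite -((closure_id _).1 (@enorm_ge_closed c)) /enorm_ge /= enorm0.
by apply/negP; rewrite -ltNge.
Qed.

Lemma enorm_gt_away c : 0 < c -> ~ closure (enorm_gt c) 0.
Proof. by move=> /enorm_ge_away; apply: away0_sub => x /ltW. Qed.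

Lemma dilate_enorm_ge c : 0 < c -> dilate c (enorm_ge 1) = enorm_ge c.
Proof.
move=> c0; rewrite dilateE ?gt_eqF //; apply/seteqP; split => x; rewrite /enorm_ge /=
 enormZ ?invr_ge0 ?(ltW c0) // mulrC ler_pdivlMr // mul1r //.
Qed.

Lemma dilate_enorm_gt c : 0 < c -> dilate c (enorm_gt 1) = enorm_gt c.
Proof.
move=> c0; rewrite dilateE ?gt_eqF //; apply/seteqP; split => x; rewrite /enorm_gt /=
 enormZ ?invr_ge0 ?(ltW c0) // mulrC ltr_pdivlMr // mul1r //.
Qed.

Lemma measurable_enorm_gt u : measurable [set w | u < enorm (X w : Rd)].
Proof.
have := tail_law_measurable X 1 (borel_open (@enorm_gt_open u)).
by rewrite /enorm_gt; under eq_set do rewrite invr1 scale1r.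
Qed.

Lemma tailp_ge0 u : 0 <= tailp u. Proof. exact: fine_ge0. Qed.

Lemma le_fine_prob (A B : set Omega) : measurable A -> measurable B -> A `<=` B ->
  fine (P A) <= fine (P B).
Proof.
move=> mA mB AB; apply: fine_le; rewrite ?fin_num_measure //.
by apply: le_measure; rewrite ?inE.
Qed.

Lemma tailp_le u v : u <= v -> tailp v <= tailp u.
Proof.
move=> uv; apply: le_fine_prob; try exact: measurable_enorm_gt.
by move=> w /=; exact: le_lt_trans.
Qed.

Lemma rlaw_enorm_gt n r c : 0 < r -> rlaw n r (enorm_gt c) = n%:R * tailp (c * r).
Proof.
move=> r0; rewrite /rlaw /tailp; congr (_ * fine (P _)); apply/seteqP; split => w;
by rewrite /enorm_gt /= enormZ ?invr_ge0 ?(ltW r0) // [r^-1 * _]mulrC ltr_pdivlMr.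
Qed.

Lemma rlaw_dilate n r c U : 0 < c -> rlaw n (c * r) U = rlaw n r (dilate c U).
Proof.
move=> c0; rewrite /rlaw dilateE ?gt_eqF //; congr (_ * fine (P _)).
by apply/seteqP; split => w /=; rewrite scalerA invfM.
Qed.

Lemma le_rlaw n r r' U V : measurable (U : set (borel Rd)) -> measurable (V : set (borel Rd)) ->
  (forall x, U (r^-1 *: x) -> V (r'^-1 *: x)) -> rlaw n r U <= rlaw n r' V.
Proof.
move=> mU mV UV; apply: ler_wpM2l => //.
by apply: le_fine_prob; try exact: tail_law_measurable; move=> w; exact: UV.
Qed.

Lemma tail_lawE n r U : measurable (U : set (borel Rd)) ->
  tail_law X n r U = (rlaw n r U)%:E.
Proof.
by move=> mU; rewrite EFinM fineK // fin_num_measure //; exact: tail_law_measurable.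
Qed.

Hypothesis alpha_gt0 : 0 < alpha.
Hypothesis mu_radon : radon mu.
Hypothesis mu_inf : mu (~` embed setT) = 0%E.
Hypothesis mu_hom : forall (u : R) (B : set (punctured R d)), 0 < u ->
  measurable (B : set (borel (punctured R d))) ->
  mu (ext_dilate u B) = ((u `^ (- alpha))%:E * mu B)%E.

Lemma emeasE U : measurable (U : set (borel Rd)) -> ~ closure U 0 ->
  mu (embed U) = (rmeas U)%:E.
Proof. by move=> mU U0; rewrite fineK // ge0_fin_numE //; exact: emeas_fin. Qed.

Lemma rmeas_ge0 U : 0 <= rmeas U. Proof. exact: fine_ge0. Qed.

Lemma le_rmeas U V : measurable (U : set (borel Rd)) -> measurable (V : set (borel Rd)) ->
  ~ closure V 0 -> U `<=` V -> rmeas U <= rmeas V.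
Proof.
move=> mU mV V0 UV; have U0 := away0_sub UV V0.
by rewrite -lee_fin -!emeasE //; exact: le_emeas.
Qed.

Lemma rmeas_dilate c U : 0 < c -> measurable (U : set (borel Rd)) -> ~ closure U 0 ->
  rmeas (dilate c U) = c `^ (- alpha) * rmeas U.
Proof.
move=> c0 mU U0; rewrite /rmeas -ext_dilate_embed // mu_hom //; last exact: embed_measurable.
by rewrite emeasE.
Qed.

Lemma away0_dilate c U : 0 < c -> ~ closure U 0 -> ~ closure (dilate c U) 0.
Proof.
move=> c0 /away0P[e e0 eU]; apply: (@away0_ge _ _ _ (c * e)); first exact: mulr_gt0.
by move=> _ [y Uy <-]; rewrite normrZ gtr0_norm // ler_pM2l // eU.
Qed.

Lemma dilate_closed c U : 0 < c -> closed U -> closed (dilate c U).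
Proof.
move=> c0 cU; rewrite dilateE ?gt_eqF //.
by apply: (@preimage_closed _ _ (fun x : Rd => c^-1 *: x) U) => // x _; exact: scaler_continuous.
Qed.

Lemma dilate_open c U : 0 < c -> open U -> open (dilate c U).
Proof.
move=> c0 cU; rewrite dilateE ?gt_eqF //.
by apply: (@open_comp _ _ (fun x : Rd => c^-1 *: x) U) => // x _; exact: scaler_continuous.
Qed.

Context (a' : nat -> R).
Hypothesis a'_gt0 : forall n, 0 < a' n.
Hypothesis Xmu : vague_cvg (fun n => scaled_law X n (a' n)) mu.

Lemma rlaw_lt F t : closed F -> ~ closure F 0 -> rmeas F < t ->
  \forall n \near \oo, rlaw n (a' n) F < t.
Proof.
move=> cF F0 Ft; have mF := borel_closed cF.
have : (emeas mu F < t%:E)%E by rewrite /emeas emeasE // lte_fin.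
move=> /(tail_law_lt mu_radon mu_inf Xmu cF F0); apply: filterS => n.
by rewrite tail_lawE // lte_fin.
Qed.

Lemma rlaw_gt G t : open G -> ~ closure G 0 -> t < rmeas G ->
  \forall n \near \oo, t < rlaw n (a' n) G.
Proof.
move=> cF F0 Ft; have mF := borel_open cF.
have : (t%:E < emeas mu G)%E by rewrite /emeas emeasE // lte_fin.
move=> /(tail_law_gt mu_radon mu_inf Xmu cF F0); apply: filterS => n.
by rewrite tail_lawE // lte_fin.
Qed.

Lemma rlaw_dilate_lt c F t : 0 < c -> closed F -> ~ closure F 0 ->
  c `^ (- alpha) * rmeas F < t -> \forall n \near \oo, rlaw n (c * a' n) F < t.
Proof.
move=> c0 cF F0 Ft; under eq_near do rewrite rlaw_dilate //.
apply: rlaw_lt; [exact: dilate_closed|exact: away0_dilate|].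
by rewrite rmeas_dilate //; exact: borel_closed.
Qed.

Lemma rlaw_dilate_gt c G t : 0 < c -> open G -> ~ closure G 0 ->
  t < c `^ (- alpha) * rmeas G -> \forall n \near \oo, t < rlaw n (c * a' n) G.
Proof.
move=> c0 cF F0 Ft; under eq_near do rewrite rlaw_dilate //.
apply: rlaw_gt; [exact: dilate_open|exact: away0_dilate|].
by rewrite rmeas_dilate //; exact: borel_open.
Qed.

Lemma normalizing_cvg b : normalizing X b -> n%:R * tailp (b n) @[n --> \oo] --> (1 : R).
Proof.
move=> /fine_cvg h; apply: cvg_trans h; apply: near_eq_cvg; apply: nearW => n /=.
by rewrite fineM // fin_num_measure //; exact: measurable_enorm_gt.
Qed.

Lemma near_tailp_lt b t : normalizing X b -> 1 < t ->
  \forall n \near \oo, n%:R * tailp (b n) < t.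
Proof. by move=> hb t1; exact: cvgr_lt (normalizing_cvg hb) _ t1. Qed.

Lemma near_tailp_gt b t : normalizing X b -> t < 1 ->
  \forall n \near \oo, t < n%:R * tailp (b n).
Proof. by move=> hb t1; exact: cvgr_gt (normalizing_cvg hb) _ t1. Qed.

Hypothesis a'_norm : normalizing X a'.

Lemma rmeas_enorm_gt_le1 : rmeas (enorm_gt 1) <= 1.
Proof.
rewrite leNgt; apply/negP => h.
pose t := (1 + rmeas (enorm_gt 1)) / 2.
have t1 : 1 < t by rewrite /t; lra.
have th : t < rmeas (enorm_gt 1) by rewrite /t; lra.
have h1 := rlaw_gt (@enorm_gt_open 1) (enorm_gt_away ltr01) th.
have h2 := near_tailp_lt a'_norm t1.
have [n [h3 h4]] := filter_ex (filterI h1 h2); move: h3.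
by rewrite rlaw_enorm_gt // mul1r => /lt_trans /(_ h4); rewrite ltxx.
Qed.

Lemma rlaw_enorm_gt_le_ge n r c : 0 < r -> n%:R * tailp (c * r) <= rlaw n r (enorm_ge c).
Proof.
move=> r0; rewrite -rlaw_enorm_gt //; apply: le_rlaw.
- exact: borel_enorm_gt.
- exact: borel_enorm_ge.
- by move=> x; rewrite /enorm_gt /enorm_ge /= => /ltW.
Qed.

Lemma rmeas_enorm_ge_ge1 : 1 <= rmeas (enorm_ge 1).
Proof.
rewrite leNgt; apply/negP => h.
pose t := (1 + rmeas (enorm_ge 1)) / 2.
have t1 : t < 1 by rewrite /t; lra.
have th : rmeas (enorm_ge 1) < t by rewrite /t; lra.
have h1 := rlaw_lt (@enorm_ge_closed 1) (enorm_ge_away ltr01) th.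
have h2 := near_tailp_gt a'_norm t1.
have [n [h3 h4]] := filter_ex (filterI h1 h2).
have := rlaw_enorm_gt_le_ge n 1 (a'_gt0 n); rewrite mul1r.
by move=> /(lt_le_trans h4) /(lt_trans h3); rewrite ltxx.
Qed.

(** The limit inequalities alone give mass at most 1 to [enorm_gt 1] and at least 1 to [enorm_ge 1].
    Homogeneity closes the gap: for [c < 1] the set [enorm_ge 1] lies in [enorm_gt c], whose mass
    exceeds that of [enorm_gt 1] only by a factor as close to 1 as desired. *)
Lemma rmeas_enorm_ge_le1 : rmeas (enorm_ge 1) <= 1.
Proof.
rewrite leNgt; apply/negP => h.
pose t := (1 + rmeas (enorm_ge 1)) / 2.
have t1 : 1 < t by rewrite /t; lra.
have th : t < rmeas (enorm_ge 1) by rewrite /t; lra.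
have [c [c0 ct /(_ t1) c1 _]] := powRN_surj alpha_gt0 (lt_trans ltr01 t1).
have : rmeas (enorm_ge 1) <= rmeas (enorm_gt c).
  apply: le_rmeas; [exact: borel_enorm_ge|exact: borel_enorm_gt|exact: enorm_gt_away|].
  by move=> x; rewrite /enorm_gt /enorm_ge /=; exact: lt_le_trans.
rewrite -dilate_enorm_gt // rmeas_dilate //; [|exact: borel_enorm_gt|exact: enorm_gt_away].
rewrite ct => h'; have := rmeas_enorm_gt_le1; have := rmeas_ge0 (enorm_gt 1); nra.
Qed.

Lemma rmeas_enorm_gt_ge1 : 1 <= rmeas (enorm_gt 1).
Proof.
rewrite leNgt; apply/negP => h.
pose t := (1 + rmeas (enorm_gt 1)) / 2.
have t1 : t < 1 by rewrite /t; lra.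
have th : rmeas (enorm_gt 1) < t by rewrite /t; lra.
have t0 : 0 < t by rewrite (le_lt_trans _ th) // rmeas_ge0.
have [c [c0 ct _ /(_ t1) c1]] := powRN_surj alpha_gt0 t0.
have : rmeas (enorm_ge c) <= rmeas (enorm_gt 1).
  apply: le_rmeas; [exact: borel_enorm_ge|exact: borel_enorm_gt|exact: enorm_gt_away|].
  by move=> x; rewrite /enorm_gt /enorm_ge /=; exact: lt_le_trans.
rewrite -dilate_enorm_ge // rmeas_dilate //; [|exact: borel_enorm_ge|exact: enorm_ge_away].
rewrite ct => h'; have := rmeas_enorm_ge_ge1; nra.
Qed.

Lemma near_tailpM_lt c t : 0 < c -> c `^ (- alpha) < t ->
  \forall n \near \oo, n%:R * tailp (c * a' n) < t.
Proof.
move=> c0 ct; have : \forall n \near \oo, rlaw n (a' n) (enorm_ge c) < t.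
  apply: rlaw_lt; [exact: enorm_ge_closed|exact: enorm_ge_away|].
  rewrite -dilate_enorm_ge // rmeas_dilate //; [|exact: borel_enorm_ge|exact: enorm_ge_away].
  apply: le_lt_trans ct; rewrite ler_piMr ?powR_ge0 //; exact: rmeas_enorm_ge_le1.
by apply: filterS => n; apply: le_lt_trans; exact: rlaw_enorm_gt_le_ge.
Qed.

Lemma near_tailpM_gt c t : 0 < c -> t < c `^ (- alpha) ->
  \forall n \near \oo, t < n%:R * tailp (c * a' n).
Proof.
move=> c0 ct; have : \forall n \near \oo, t < rlaw n (a' n) (enorm_gt c).
  apply: rlaw_gt; [exact: enorm_gt_open|exact: enorm_gt_away|].
  rewrite -dilate_enorm_gt // rmeas_dilate //; [|exact: borel_enorm_gt|exact: enorm_gt_away].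
  apply: lt_le_trans ct _; rewrite ler_peMr ?powR_ge0 //; exact: rmeas_enorm_gt_ge1.
by apply: filterS => n; rewrite rlaw_enorm_gt.
Qed.

Context (a : nat -> R).
Hypothesis a_gt0 : forall n, 0 < a n.
Hypothesis a_norm : normalizing X a.

(** If [a n] exceeded [c * a' n], its tail would be at most the tail at [c * a' n], which is
    asymptotically at most [c ^ (- alpha) / n], too small for a normalizing sequence. *)
Lemma near_a_le c : 1 < c -> \forall n \near \oo, a n <= c * a' n.
Proof.
move=> c1; have c0 := lt_trans ltr01 c1; have cl := powRN_lt1 alpha_gt0 c1.
pose t := (c `^ (- alpha) + 1) / 2.
have ct : c `^ (- alpha) < t by rewrite /t; lra.
have t1 : t < 1 by rewrite /t; lra.
have hA := near_tailp_gt a_norm t1.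
have hB := near_tailpM_lt c0 ct.
apply: filterS (filterI hB hA) => n [h1 h2].
rewrite leNgt; apply/negP => /ltW /tailp_le h.
have : n%:R * tailp (a n) <= n%:R * tailp (c * a' n) by rewrite ler_wpM2l.
by move=> /(lt_le_trans h2) /(lt_trans h1); rewrite ltxx.
Qed.

Lemma near_a_ge c : 0 < c -> c < 1 -> \forall n \near \oo, c * a' n <= a n.
Proof.
move=> c0 c1; have cl := powRN_gt1 alpha_gt0 c0 c1.
pose t := (c `^ (- alpha) + 1) / 2.
have ct : t < c `^ (- alpha) by rewrite /t; lra.
have t1 : 1 < t by rewrite /t; lra.
have hA := near_tailp_lt a_norm t1.
have hB := near_tailpM_gt c0 ct.
apply: filterS (filterI hB hA) => n [h1 h2].
rewrite leNgt; apply/negP => /ltW /tailp_le h.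
have : n%:R * tailp (c * a' n) <= n%:R * tailp (a n) by rewrite ler_wpM2l.
by move=> /(lt_le_trans h1) /lt_trans /(_ h2); rewrite ltxx.
Qed.

(* For such U, P(Z / r in U) is monotone in r: the norming sequence given by
   regular variation can be replaced by any a_n with c a'_n <= a_n <= c' a'_n. *)
Definition upset U := forall (s : R) x, 1 <= s -> U x -> U (s *: x).

Lemma upset_scale U r s x : upset U -> 0 < r -> r <= s -> U (s^-1 *: x) -> U (r^-1 *: x).
Proof.
move=> uU r0 rs; have s0 := lt_le_trans r0 rs.
move=> /(uU (s / r)); rewrite ler_pdivlMr // mul1r => /(_ rs).
by rewrite scalerA mulrAC mulfV ?gt_eqF // mul1r.
Qed.

(** The slack between the mass of [F] and [t] is spent on a dilation by [c < 1]. Eventually [a n] is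
    at least [c * a' n], and a larger norming only shrinks the event because [F] is an up-set. *)
Lemma upset_rlaw_lt F t : upset F -> closed F -> ~ closure F 0 -> rmeas F < t ->
  \forall n \near \oo, rlaw n (a n) F < t.
Proof.
move=> uF cF F0 Ft; have M0 := rmeas_ge0 F; set M := rmeas F in Ft M0 *.
(* [m] is above 1 with [m * M < t]; the denominator uses [M + 1] because [M] may vanish. *)
pose m := 1 + (t - M) / (2 * (M + 1)).
have m1 : 1 < m by rewrite ltrDl divr_gt0 // ?mulr_gt0 ?subr_gt0 //; lra.
have mMt : m * M < t.
  have k0 : 0 < (2 * (M + 1))^-1 by rewrite invr_gt0 mulr_gt0 //; lra.
  have : 2 * (M + 1) * (2 * (M + 1))^-1 = 1 by rewrite mulfV // gt_eqF // mulr_gt0 //; lra.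
  rewrite /m; set k := _^-1 in k0 *; move=> kE; nra.
have [c [c0 ct /(_ m1) c1 _]] := powRN_surj alpha_gt0 (lt_trans ltr01 m1).
have h : c `^ (- alpha) * rmeas F < t by rewrite ct.
apply: filterS (filterI (rlaw_dilate_lt c0 cF F0 h) (near_a_ge c0 c1)) => n [h1 h2].
apply: le_lt_trans h1; apply: le_rlaw; try exact: borel_closed.
by move=> x; apply: upset_scale => //; exact: mulr_gt0.
Qed.

Lemma upset_rlaw_gt G t : upset G -> open G -> ~ closure G 0 -> t < rmeas G ->
  \forall n \near \oo, t < rlaw n (a n) G.
Proof.
move=> uF cF F0 Ft.
have [t0|t0] := ltP t 0.
  by apply: nearW => n; apply: (lt_le_trans t0); rewrite mulr_ge0 // fine_ge0.
set M := rmeas G in Ft *; have M0 := le_lt_trans t0 Ft.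
pose m := (M + t) / 2 / M.
have m0 : 0 < m by rewrite !divr_gt0 //; lra.
have m1 : m < 1 by rewrite ltr_pdivrMr // mul1r; lra.
have mMt : t < m * M by rewrite divfK ?gt_eqF //; lra.
have [c [c0 ct _ /(_ m1) c1]] := powRN_surj alpha_gt0 m0.
have h : t < c `^ (- alpha) * rmeas G by rewrite ct.
apply: filterS (filterI (rlaw_dilate_gt c0 cF F0 h) (near_a_le c1)) => n [h1 h2].
apply: lt_le_trans h1 _; apply: le_rlaw; try exact: borel_open.
by move=> x; apply: upset_scale.
Qed.

End transfer.

(** * Tail growth and moments *)

Section doubling.
Context (R : realType) (p : R -> R) (alpha : R) (a : nat -> R).
Hypothesis alpha_gt1 : 1 < alpha.
Hypothesis p_ge0 : forall u, 0 <= p u.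
Hypothesis p_le : forall u v, u <= v -> p v <= p u.
Hypothesis a_gt0 : forall n, 0 < a n.
Hypothesis a_nd : nondecreasing_seq a.
Hypothesis a_oo : a n @[n --> \oo] --> +oo.
Hypothesis near_lt : forall c t, 0 < c -> c `^ (- alpha) < t ->
  \forall n \near \oo, n%:R * p (c * a n) < t.
Hypothesis near_gt : forall c t, 0 < c -> t < c `^ (- alpha) ->
  \forall n \near \oo, t < n%:R * p (c * a n).

Lemma seq_bracket N u : a N <= u -> exists n, [/\ (N <= n)%N, a n <= u & u < a n.+1].
Proof.
move=> Nu; have [m um] : exists m, u < a m.
  have /cvgryPgt/(_ u) := a_oo; move=> [m _ /(_ m (leqnn m))] h; by exists m.
case: (ex_minnP (ex_intro (fun m => u < a m) m um)) => -[|k] uk kmin.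
  by have := lt_le_trans uk (a_nd (leq0n N)); rewrite ltNge Nu.
have ak : a k <= u by rewrite leNgt; apply/negP => /kmin; rewrite ltnn.
exists k; split => //; rewrite leqNgt; apply/negP => kN.
by have := lt_le_trans uk (a_nd kN); rewrite ltNge Nu.
Qed.

(** The strict bound 1/2 is where [alpha > 1] enters; it makes the tail integrable with a power to
    spare. *)
Lemma two_powRN : 0 < (2 : R) `^ (- alpha) < 1 / 2.
Proof.
rewrite powR_gt0 //= /powR gt_eqF // div1r -[X in _ < X^-1](@lnK _ 2) ?posrE //.
by rewrite -expRN ltr_expR mulNr ltrN2 ltr_pMl // ln_gt0 // ltr1n.
Qed.

(** Regular variation controls [p] only along multiples of the sequence [a]. A general [u] is
    bracketed between [a n] and [a n.+1]; the mismatch between [n] and [n + 1] is harmless for large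
    [n]. *)
Lemma tail_doubling_le : exists c u0, [/\ 0 < c, c < 1 / 2, 0 < u0 &
  forall u, u0 <= u -> p (2 * u) <= c * p u].
Proof.
have /andP[l0 l12] := two_powRN; set l := 2 `^ (- alpha) in l0 l12.
(* With [l < t < c < 1 / 2] and [s < 1], the bounds will be [p (2 * u) < t / n] and
   [p u > s / (n + 1)]. Since [t < c * s], the first is at most [c] times the second once [n]
   exceeds [t / (c * s - t)]. *)
pose c := (l + 1 / 2) / 2; pose t := (l + c) / 2; pose s := (1 + t / c) / 2.
have lc : l < c by rewrite /c; lra.
have c12 : c < 1 / 2 by rewrite /c; lra.
have c0 : 0 < c by lra.
have lt : l < t by rewrite /t; lra.
have tc : t < c by rewrite /t; lra.
have tc1 : t / c < 1 by rewrite ltr_pdivrMr // mul1r.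
have s1 : s < 1 by rewrite /s; lra.
have cst : t < c * s.
  have e : c * (t / c) = t by rewrite mulrCA mulfV ?mulr1 // gt_eqF.
  by rewrite /s; nra.
have h1 := near_lt (ltr0n _ 2) lt.
have h2 : \forall n \near \oo, s < n%:R * p (1 * a n) by apply: near_gt => //; rewrite powR1.
have h3 : \forall n \near \oo, t / (c * s - t) < n%:R by exact: nbhs_infty_gtr.
have [N _ hN] : \forall n \near \oo, [/\ n%:R * p (2 * a n) < t, s < n%:R * p (1 * a n) & t / (c * s - t) < n%:R].
  by apply: filterS3 h1 h2 h3.
exists c, (a N); split => // u /seq_bracket[n [Nn au ua]].
have [g1 _ g3] := hN n Nn; have [_ g2 _] := hN n.+1 (leqW Nn).
have p1 : p (2 * u) <= p (2 * a n) by apply: p_le; rewrite ler_pM2l.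
have p2 : p (1 * a n.+1) <= p u by apply: p_le; rewrite mul1r ltW.
have n0 : 0 < (n%:R : R) by apply: le_lt_trans g3; rewrite divr_ge0 // ?subr_ge0 ?ltW //; lra.
move: g3; rewrite ltr_pdivrMr ?subr_gt0 // => g3.
have q1 : n%:R * p (2 * u) < t by apply: le_lt_trans g1; rewrite ler_pM2l.
have q2 : s < (n%:R + 1) * p u.
  by apply: lt_le_trans g2 _; rewrite -natr1 ler_wpM2l // addr_ge0.
have := p_ge0 u; have := p_ge0 (2 * u); set x := p (2 * u) in q1 *; set y := p u in q2 *.
move=> x0 y0; set m := n%:R in n0 g3 q1 q2 *.
have k1 : 0 < (m * c) * ((m + 1) * y - s) by apply: mulr_gt0; [exact: mulr_gt0|rewrite subr_gt0].
have k2 : 0 < (m + 1) * (t - m * x) by apply: mulr_gt0; [rewrite addr_gt0|rewrite subr_gt0].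
have m2 : 0 < m * (m + 1) by rewrite mulr_gt0 // addr_gt0.
by rewrite -(ler_pM2l m2); lra.
Qed.

Lemma tail_doubling_ge : exists c u0, [/\ 0 < c, c < 1, 0 < u0 &
  forall u, u0 <= u -> c * p u <= p (2 * u)].
Proof.
have /andP[l0 l12] := two_powRN; set l := 2 `^ (- alpha) in l0 l12.
have h1 : \forall n \near \oo, l / 2 < n%:R * p (2 * a n) by apply: near_gt => //; rewrite -/l; lra.
have h2 : \forall n \near \oo, n%:R * p (1 * a n) < 2 by apply: near_lt => //; rewrite powR1; lra.
have h3 : \forall n \near \oo, 1 < (n%:R : R) by exact: nbhs_infty_gtr.
have [N _ hN] : \forall n \near \oo, [/\ l / 2 < n%:R * p (2 * a n), n%:R * p (1 * a n) < 2 & 1 < (n%:R : R)].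
  by apply: filterS3 h1 h2 h3.
(* [p (2 * u)] is above [(l / 2) / (n + 1)] and [p u] below [2 / n]; as [n > 1], the ratio is at
   least [l / 8]. *)
exists (l / 8), (a N); split => //; try lra.
move=> u /seq_bracket[n [Nn au ua]].
have [_ g2 g3] := hN n Nn; have [g1 _ _] := hN n.+1 (leqW Nn).
have p1 : p (2 * a n.+1) <= p (2 * u) by apply: p_le; rewrite ler_pM2l // ltW.
have p2 : p u <= p (1 * a n) by apply: p_le; rewrite mul1r.
have n0 : 0 < (n%:R : R) by lra.
have q1 : l / 2 < (n%:R + 1) * p (2 * u).
  by apply: lt_le_trans g1 _; rewrite -natr1 ler_wpM2l // addr_ge0.
have q2 : n%:R * p u < 2 by apply: le_lt_trans g2; rewrite ler_pM2l.
have := p_ge0 u; have := p_ge0 (2 * u); set x := p (2 * u) in q1 *; set y := p u in q2 *.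
move=> x0 y0; set m := n%:R in n0 g3 q1 q2 *.
rewrite -(ler_pM2l n0); nra.
Qed.

Lemma tail_gt0 u : 0 < p u.
Proof.
rewrite lt0r p_ge0 andbT; apply/eqP => pu0.
have h1 : \forall n \near \oo, 0 < n%:R * p (1 * a n) by apply: near_gt; rewrite // powR1.
have /cvgryPge/(_ u) h2 := a_oo.
have [n [g1 g2]] := filter_ex (filterI h1 h2); move: g1; rewrite mul1r.
have -> : p (a n) = 0 by apply/eqP; rewrite eq_le p_ge0 andbT -pu0 p_le.
by rewrite mulr0 ltxx.
Qed.

End doubling.

Section polynomial_tail.
Context (R : realType) (p : R -> R).
Hypothesis p_ge0 : forall u, 0 <= p u.
Hypothesis p_le : forall u v, u <= v -> p v <= p u.

Lemma dyadic_bracket (u0 u : R) : 0 < u0 -> u0 < u ->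
  exists m : nat, 2 ^+ m * u0 < u <= 2 ^+ m.+1 * u0.
Proof.
move=> u00 u0u.
have [k hk] : exists k : nat, u <= 2 ^+ k * u0.
  have [k uk] : exists k : nat, u / u0 < k%:R.
    by exists (Num.bound (u / u0)); apply: archi_boundP; rewrite divr_ge0 ?ltW // (lt_trans u00).
  exists k; rewrite -ler_pdivrMr //; apply: (ltW (lt_le_trans uk _)).
  by rewrite -natrX ler_nat ltnW // ltn_expl.
case: (ex_minnP (ex_intro (fun k : nat => u <= 2 ^+ k * u0) k hk)) => -[|m] um mmin.
  by move: um; rewrite expr0 mul1r leNgt u0u.
by exists m; rewrite um andbT ltNge; apply/negP => /mmin; rewrite ltnn.
Qed.

(** Iterating the doubling bound costs a factor [c] whenever [u] doubles; with [c * 2 ^+ g >= 1]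
    this loss is compensated by [u ^+ g]. It will make [n] at most polynomial in [a n]. *)
Lemma tail_poly_lower (c u0 : R) : 0 < c -> c < 1 -> 0 < u0 -> 0 < p u0 ->
  (forall u, u0 <= u -> c * p u <= p (2 * u)) ->
  exists (C : R) (g : nat), 0 < C /\ forall u, u0 < u -> C <= p u * u ^+ g.
Proof.
move=> c0 c1 u00 pu0 dbl.
have [g cg] : exists g : nat, 1 <= c * 2 ^+ g.
  have [k uk] : exists k : nat, c^-1 < k%:R.
    by exists (Num.bound c^-1); apply: archi_boundP; rewrite invr_ge0 ltW.
  exists k; rewrite -ler_pdivrMl // mulr1; apply: (ltW (lt_le_trans uk _)).
  by rewrite -natrX ler_nat ltnW // ltn_expl.
have iter m : c ^+ m * p u0 <= p (2 ^+ m * u0).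
  elim: m => [|m IH]; first by rewrite !expr0 !mul1r.
  rewrite exprS -mulrA (le_trans (_ : _ <= c * p (2 ^+ m * u0))) //; first by rewrite ler_pM2l.
  rewrite exprS -mulrA; apply: dbl.
  by apply: ler_peMl; [exact: ltW|rewrite exprn_ege1 // ler1n].
exists (c * p u0 * u0 ^+ g), g; split; first by rewrite !mulr_gt0 ?exprn_gt0.
move=> u u0u; have [m /andP[mu um]] := dyadic_bracket u00 u0u.
have h1 : c ^+ m.+1 * p u0 <= p u by apply: le_trans (iter m.+1) _; exact: p_le.
have h2 : (2 ^+ m * u0) ^+ g <= u ^+ g.
  by rewrite lerXn2r ?nnegrE ?mulr_ge0 ?exprn_ge0 ?ltW // (lt_trans u00).
have h3 : 1 <= c ^+ m * (2 ^+ m) ^+ g.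
  have -> : c ^+ m * (2 ^+ m) ^+ g = (c * 2 ^+ g) ^+ m by rewrite exprMn exprAC.
  exact: exprn_ege1.
have k0 : 0 <= c ^+ m.+1 * p u0 by rewrite mulr_ge0 ?exprn_ge0 ?ltW.
have k1 : 0 <= (2 ^+ m * u0) ^+ g by rewrite exprn_ge0 // mulr_ge0 ?exprn_ge0 ?ltW.
apply: le_trans (ler_pM k0 k1 h1 h2).
rewrite exprMn [in leRHS]exprS.
have -> : c * c ^+ m * p u0 * ((2 ^+ m) ^+ g * u0 ^+ g) = (c * p u0 * u0 ^+ g) * (c ^+ m * (2 ^+ m) ^+ g) by ring.
by rewrite ler_peMr // !mulr_ge0 ?exprn_ge0 ?ltW.
Qed.

End polynomial_tail.

Section moment.
Local Open Scope ereal_scope.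
Context disp (T : measurableType disp) (R : realType) (P : probability T R).
Context (X : T -> R) (mX : measurable_fun setT X) (X_ge0 : forall w, (0 <= X w)%R).
Let p u : R := fine (P [set w | (u < X w)%R]).

Lemma measurable_lt_fun u : measurable [set w | (u < X w)%R].
Proof.
have -> : [set w | (u < X w)%R] = X @^-1` `]u, +oo[%classic.
  by apply/seteqP; split => w /=; rewrite in_itv /= andbT.
by rewrite -[X in measurable X]setTI; exact: mX.
Qed.

(** On the dyadic layer from [2 ^+ m * u0] to [2 ^+ m.+1 * u0] the integrand is of order
    [(2 ^ q) ^+ m], and the layer has probability at most [c ^+ m]: the sum is geometric with ratio
    [2 ^ q * c]. *)
Lemma finite_moment (c u0 : R) : (0 < c)%R -> (c < 1 / 2)%R -> (0 < u0)%R ->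
  (forall u, u0 <= u -> p (2 * u) <= c * p u)%R ->
  exists q : R, [/\ (1 < q)%R, (q <= 2)%R & \int[P]_w (X w `^ q)%:E < +oo].
Proof.
move=> c0 c12 u00 dbl.
have lc : (ln (2 * c) < 0)%R by rewrite ln_lt0 //; apply/andP; split; lra.
(* [q = 1 + kp] must satisfy [ln (2 * c) + kp * ln 2 < 0]. As [ln 2 < 2], a quarter of
   [- ln (2 * c)] is small enough; the cap 1 keeps [q] at most 2. *)
pose kp : R := Num.min 1%R (- ln (2 * c) / 4)%R.
have kp0 : (0 < kp)%R by rewrite lt_min ltr01 /= divr_gt0 // oppr_gt0.
have kp1 : (kp <= 1)%R by rewrite ge_min lexx.
have kp4 : (kp <= - ln (2 * c) / 4)%R by rewrite ge_min lexx orbT.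
pose q := (1 + kp)%R; exists q; split; [by rewrite /q; lra|by rewrite /q; lra|].
have q0 : (0 < q)%R by rewrite /q; lra.
pose rho := (2 `^ q * c)%R.
have rho0 : (0 < rho)%R by rewrite mulr_gt0 // powR_gt0.
have rho1 : (rho < 1)%R.
  have -> : rho = expR (ln (2 * c) + kp * ln 2).
    rewrite expRD lnK ?posrE ?mulr_gt0 // /rho /q powRD ?powRr1 //; last by rewrite pnatr_eq0 implybT.
    by rewrite /powR pnatr_eq0 /=; ring.
  rewrite -[X in (_ < X)%R]expR0 ltr_expR; have : (ln (2 : R) < 2)%R by exact: ln_sublinear.
  rewrite -(ltr_pM2l kp0) => h2; lra.
have iter m : (p (2 ^+ m * u0) <= c ^+ m)%R.
  elim: m => [|m IH].
    by rewrite !expr0 mul1r -lee_fin fineK ?fin_num_measure ?probability_le1 //; exact: measurable_lt_fun.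
  rewrite exprS -mulrA (le_trans (dbl _ _)) //.
    by apply: ler_peMl; [exact: ltW|rewrite exprn_ege1 // ler1n].
  by rewrite exprS ler_pM2l.
(* The full tail event replaces the dyadic layer: an upper bound suffices, and [iter] controls its
   probability directly. *)
pose f m w : \bar R := (((2 ^+ m.+1 * u0) `^ q) * \1_[set w | (2 ^+ m * u0 < X w)%R] w)%:E.
have f0 m w : 0 <= f m w by rewrite lee_fin mulr_ge0 // powR_ge0.
have mf m : measurable_fun setT (f m).
  apply/measurable_EFinP; apply: measurable_funM => //; exact/measurable_indic/measurable_lt_fun.
have mS : measurable_fun setT (fun w => \sum_(m <oo) f m w) by exact: ge0_emeasurable_sum.
have le w : (X w `^ q)%:E <= (u0 `^ q)%:E + \sum_(m <oo) f m w.
  have [Xu|uX] := leP (X w) u0.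
    apply: (@le_trans _ _ (u0 `^ q)%:E); last by rewrite leeDl // nneseries_ge0.
    by rewrite lee_fin; apply: ge0_ler_powR; rewrite ?nnegrE //; exact: ltW.
  have [m /andP[m1 m2]] := dyadic_bracket u00 uX.
  apply: (@le_trans _ _ (f m w)); last first.
    apply: (@le_trans _ _ (\sum_(m <oo) f m w)); last by rewrite leeDr // lee_fin powR_ge0.
    apply: le_trans (nneseries_lim_ge m.+1 _); last by [].
    by rewrite big_nat_recr //= leeDr // sume_ge0.
  rewrite /f indicE mem_set // mulr1 lee_fin.
  apply: ge0_ler_powR; rewrite ?nnegrE //; first exact: ltW.
  by rewrite mulr_ge0 ?exprn_ge0 // ltW.
have mXq : measurable_fun setT (fun w => (X w `^ q)%:E).
  by apply/measurable_EFinP; exact: (measurableT_comp (measurable_powR q)).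
apply: (@le_lt_trans _ _ (\int[P]_w ((u0 `^ q)%:E + \sum_(m <oo) f m w))).
  apply: ge0_le_integral => //.
  - by move=> w _; rewrite lee_fin powR_ge0.
  - exact: emeasurable_funD.
rewrite ge0_integralD //; last 2 first.
  by move=> w _; rewrite lee_fin powR_ge0.
  by move=> w _; rewrite nneseries_ge0.
have -> : \int[P]_w (u0 `^ q)%:E = (u0 `^ q)%:E.
  by rewrite integral_cst // [X in _ * X](probability_setT P) mule1.
rewrite integral_nneseries //.
have e m : \int[P]_w f m w <= ((2 * u0) `^ q * rho ^+ m)%:E.
  under eq_integral do rewrite /f EFinM.
  rewrite ge0_integralZl_EFin ?powR_ge0 //; last first.
    by apply/measurable_EFinP; exact/measurable_indic/measurable_lt_fun.
  rewrite integral_indic //; last exact: measurable_lt_fun.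
  rewrite setIT -[X in _ * X]fineK ?fin_num_measure //; last exact: measurable_lt_fun.
  rewrite -EFinM lee_fin.
  have -> : ((2 * u0) `^ q * rho ^+ m = (2 ^+ m.+1 * u0) `^ q * c ^+ m)%R.
    have e1 : ((2 ^+ m) `^ q = (2 `^ q) ^+ m)%R by rewrite -(powR_mulrn m (ler0n R 2)) powRAC powR_mulrn ?powR_ge0.
    have -> : (2 ^+ m.+1 * u0 = 2 ^+ m * (2 * u0))%R by rewrite exprS; ring.
    rewrite [in RHS]powRM ?exprn_ge0 //; last by rewrite mulr_ge0 // ltW.
    by rewrite e1 /rho exprMn; ring.
  by rewrite ler_wpM2l ?powR_ge0 //; exact: iter.
rewrite lte_add_pinfty ?ltry //.
apply: (@le_lt_trans _ _ (\sum_(m <oo) ((2 * u0) `^ q * rho ^+ m)%:E)).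
  by apply: lee_nneseries => // m _ _; exact: integral_ge0.
apply: (@le_lt_trans _ _ ((2 * u0) `^ q * (1 - rho)^-1)%:E); last by rewrite ltry.
apply: lime_le.
  by apply: is_cvg_nneseries => m _ _; rewrite lee_fin mulr_ge0 ?powR_ge0 // exprn_ge0 // ltW.
apply: nearW => n; rewrite sumEFin lee_fin -mulr_sumr ler_wpM2l ?powR_ge0 //.
rewrite -(ler_pM2l (_ : 0 < 1 - rho)%R) ?subr_gt0 // mulfV ?gt_eqF ?subr_gt0 //.
have := subrX1 rho n; rewrite big_mkord => e1.
have : (0 <= rho ^+ n)%R by rewrite exprn_ge0 // ltW.
move: e1; set S := (\sum_(i < n) _)%R; nra.
Qed.

End moment.

(** * Expectations of products of independent variables *)

Section factor.
Context disp disp' (T : measurableType disp) (T' : measurableType disp') (R : realType).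
Context (m : {measure set T -> \bar R}) (Y : T -> T').
Hypothesis mY : measurable_fun setT Y.
Import finmap HBNNSimple.

Lemma integral_simple_factor (W : T -> R) (c : R) (h : {nnsfun T' >-> R}) : 0 <= c ->
  measurable_fun setT W -> (forall w, 0 <= W w) ->
  (forall B, measurable B ->
    (\int[m]_w (W w * \1_B (Y w))%:E = c%:E * m (Y @^-1` B))%E) ->
  (\int[m]_w (W w * h (Y w))%:E =
   c%:E * \sum_(i < #|` fset_set (range h)|)
     ((fset_set (range h))`_i)%:E * m (Y @^-1` (h @^-1` [set (fset_set (range h))`_i])))%E.
Proof.
move=> c0 mW W0 Wc; set s := fset_set (range h).
have s0 (i : 'I_#|` s|) : 0 <= s`_i.
  have : s`_i \in s by exact: mem_nth.
  by rewrite in_fset_set // => /set_mem[x _ <-].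
have mh (i : 'I_#|` s|) : measurable (h @^-1` [set s`_i]) by exact: measurable_funPTI.
transitivity (\int[m]_w \sum_(i < #|` s|) (s`_i * (W w * \1_(h @^-1` [set s`_i]) (Y w)))%:E)%E.
  apply: eq_integral => w _; rewrite sumEFin; congr (_%:E).
  rewrite (fimfunEord h) mulr_sumr; apply: eq_bigr => i _; by rewrite mulrCA.
have mI (i : 'I_#|` s|) : measurable_fun setT (fun w => W w * \1_(h @^-1` [set s`_i]) (Y w)).
  apply: measurable_funM => //; apply: measurableT_comp => //; exact: measurable_indic.
rewrite ge0_integral_sum //=; last 2 first.
- move=> i; apply/measurable_EFinP; exact: measurable_funM.
- by move=> i w _; rewrite lee_fin !mulr_ge0.
rewrite ge0_sume_distrr; last by move=> i _; rewrite mule_ge0 // lee_fin.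
apply: eq_bigr => i _; under eq_integral do rewrite EFinM.
rewrite ge0_integralZl_EFin //; last 2 first.
- by move=> w _; rewrite lee_fin mulr_ge0.
- exact/measurable_EFinP.
by rewrite Wc // muleCA.
Qed.

(** The hypothesis says that the measure with density [W], transported by [Y], is [c] times the
    image of [m]. Simple functions and monotone convergence pass from sets to nonnegative [g]. *)
Lemma integral_factor (W : T -> R) (c : R) (g : T' -> R) : 0 <= c ->
  measurable_fun setT W -> (forall w, 0 <= W w) ->
  measurable_fun setT g -> (forall y, 0 <= g y) ->
  (forall B, measurable B ->
    (\int[m]_w (W w * \1_B (Y w))%:E = c%:E * m (Y @^-1` B))%E) ->
  (\int[m]_w (W w * g (Y w))%:E = c%:E * \int[m]_w (g (Y w))%:E)%E.
Proof.
move=> c0 mW W0 mg g0 Wc.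
have mEg : measurable_fun setT (EFin \o g) by exact/measurable_EFinP.
pose h := nnsfun_approx measurableT mEg.
have h_cvg y : (h n y)%:E @[n --> \oo] --> (g y)%:E.
  by apply: (@cvg_nnsfun_approx _ _ _ _ measurableT (EFin \o g) mEg) => //= x _; rewrite lee_fin.
have h_nd y : {homo (fun n => h n y) : a b / (a <= b)%N >-> a <= b}.
  by move=> a b ab; exact/lefP/nd_nnsfun_approx.
have mhY n : measurable_fun setT (fun w => h n (Y w)) by exact: measurableT_comp.
have cvgW : (\int[m]_w (W w * h n (Y w))%:E)%E @[n --> \oo] --> (\int[m]_w (W w * g (Y w))%:E)%E.
  rewrite [X in _ --> X](_ : _ = (\int[m]_w limn (fun n => (W w * h n (Y w))%:E))%E).
    apply: cvg_monotone_convergence => //.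
    - by move=> n; apply/measurable_EFinP; exact: measurable_funM.
    - by move=> n w _; rewrite lee_fin mulr_ge0.
    - by move=> w _ a b ab; rewrite lee_fin ler_wpM2l // h_nd.
  apply: eq_integral => w _; apply/esym/cvg_lim => //.
  under eq_fun do rewrite EFinM; rewrite EFinM; apply: cvgeZl => //; exact: h_cvg.
have cvg1 : (\int[m]_w (h n (Y w))%:E)%E @[n --> \oo] --> (\int[m]_w (g (Y w))%:E)%E.
  rewrite [X in _ --> X](_ : _ = (\int[m]_w limn (fun n => (h n (Y w))%:E))%E).
    apply: cvg_monotone_convergence => //.
    - by move=> n; apply/measurable_EFinP.
    - by move=> n w _; rewrite lee_fin.
    - by move=> w _ a b ab; rewrite lee_fin // h_nd.
  by apply: eq_integral => w _; apply/esym/cvg_lim => //; exact: h_cvg.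
have e n : (\int[m]_w (W w * h n (Y w))%:E = c%:E * \int[m]_w (h n (Y w))%:E)%E.
  rewrite (integral_simple_factor _ c0 mW W0 Wc); congr (_ * _)%E.
  (* The same lemma with weight 1 turns the sum back into an integral. *)
  have := @integral_simple_factor (cst 1) 1 (h n) ler01 (measurable_cst _) (fun _ => ler01).
  rewrite mul1e => <-; first by apply: eq_integral => w _; rewrite mul1r.
  move=> B mB; rewrite mul1e; under eq_integral do rewrite mul1r.
  rewrite -[in RHS](setIT (Y @^-1` B)) -integral_indic //.
  by rewrite -[X in measurable X]setTI; exact: mY.
have cvgW' : (c%:E * \int[m]_w (h n (Y w))%:E)%E @[n --> \oo] --> (\int[m]_w (W w * g (Y w))%:E)%E.
  by apply: cvg_trans cvgW; apply: near_eq_cvg; apply: nearW => n; rewrite e.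
have cvg1' := cvgeZl (y := c%:E) isT cvg1.
by apply: (cvg_unique _ cvgW' cvg1').
Qed.

End factor.

Section independence.
Context disp disp' (T : measurableType disp) (T' : measurableType disp') (R : realType).
Context (P : probability T R) (Z : nat -> T -> T').
Hypothesis mZ : forall i, measurable_fun setT (Z i).
Hypothesis indepZ : forall (J : seq nat) (B : nat -> set T'), uniq J ->
  (forall i, measurable (B i)) ->
  P (\bigcap_(i in [set` J]) (Z i @^-1` B i)) = (\prod_(i <- J) P (Z i @^-1` B i))%E.

Lemma indep_indic_prod (J : seq nat) (B : nat -> set T') : uniq J ->
  (forall i, measurable (B i)) ->
  (\int[P]_w (\prod_(j <- J) \1_(B j) (Z j w))%:E = (\prod_(j <- J) fine (P (Z j @^-1` B j)))%:E)%E.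
Proof.
move=> uJ mB.
have mZB i : measurable (Z i @^-1` B i) by rewrite -[X in measurable X]setTI; exact: mZ.
have mI : measurable (\bigcap_(i in [set` J]) (Z i @^-1` B i)).
  apply: fin_bigcap_measurable => //; exact: finite_seq.
transitivity (\int[P]_w (\1_(\bigcap_(i in [set` J]) (Z i @^-1` B i)) w)%:E)%E.
  apply: eq_integral => w _; congr (_%:E).
  have [h|h] := pselect ((\bigcap_(i in [set` J]) (Z i @^-1` B i)) w).
    rewrite indicE mem_set // big_seq big1 // => j jJ; rewrite indicE mem_set //; exact: h.
  rewrite indicE memNset //.
  have [j jJ nB] : exists2 j, j \in J & ~ B j (Z j w).
    apply: contrapT => hj; apply: h => j jJ; apply: contrapT => nB; apply: hj; by exists j.
  by rewrite (big_rem j) //= indicE memNset // mul0r.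
transitivity (P (\bigcap_(i in [set` J]) (Z i @^-1` B i))); first by rewrite integral_indic // setIT.
rewrite indepZ //.
elim: J {uJ mI} => [|j J IH]; first by rewrite !big_nil.
by rewrite !big_cons IH EFinM fineK // fin_num_measure.
Qed.

(* The indicators are replaced by general functions one at a time. *)
Lemma indep_expectation_gen (J1 J2 : seq nat) (g : nat -> T' -> R) (e : nat -> R)
    (B : nat -> set T') : uniq (J1 ++ J2) ->
  (forall i, measurable_fun setT (g i)) -> (forall i y, 0 <= g i y) ->
  (forall i, \int[P]_w (g i (Z i w))%:E = (e i)%:E)%E ->
  (forall i, measurable (B i)) ->
  (\int[P]_w ((\prod_(j <- J1) g j (Z j w)) * (\prod_(j <- J2) \1_(B j) (Z j w)))%:E =
   ((\prod_(j <- J1) e j) * \prod_(j <- J2) fine (P (Z j @^-1` B j)))%:E)%E.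
Proof.
move=> + mg g0 ge; elim: J1 J2 B => [|j J1 IH] J2 B uJ mB.
  under eq_integral do rewrite big_nil mul1r.
  by rewrite big_nil mul1r indep_indic_prod.
pose W w := (\prod_(i <- J1) g i (Z i w)) * \prod_(i <- J2) \1_(B i) (Z i w).
have e0 i : 0 <= e i by rewrite -lee_fin -ge; apply: integral_ge0 => w _; rewrite lee_fin.
have mW : measurable_fun setT W.
  apply: measurable_funM; apply: measurable_prod => i _; apply: measurableT_comp => //.
have uJ' : uniq (J1 ++ j :: J2) by rewrite -cat1s uniq_catCA.
have /andP[jN _] : (j \notin J1 ++ J2) && uniq (J1 ++ J2) by [].
have jN2 : j \notin J2 by move: jN; rewrite mem_cat negb_or => /andP[].
pose c := (\prod_(i <- J1) e i) * \prod_(i <- J2) fine (P (Z i @^-1` B i)).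
have := @integral_factor _ _ _ _ _ P (Z j) (mZ j) W c (g j) _ mW _ (mg j) (g0 j) _.
rewrite ge => h.
transitivity (\int[P]_w (W w * g j (Z j w))%:E)%E.
  by apply: eq_integral => w _; congr (_%:E); rewrite big_cons /W; ring.
rewrite h.
- by rewrite -EFinM big_cons; congr (_%:E); rewrite /c; ring.
- by rewrite /c mulr_ge0 // prodr_ge0 // => i _; exact: fine_ge0.
- by move=> w; rewrite /W mulr_ge0 // prodr_ge0.
(* The event for [C] joins the indicators at index [j]; as [j] is not in [J2], the other indicators
   are unchanged and the induction hypothesis applies to [j :: J2]. *)
- move=> C mC; pose B' i := if i == j then C else B i.
  have mB' i : measurable (B' i) by rewrite /B'; case: ifP.
  have Bj : B' j = C by rewrite /B' eqxx.
  have BB' (F : nat -> set T' -> R) : \prod_(i <- J2) F i (B' i) = \prod_(i <- J2) F i (B i).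
    apply: eq_big_seq => i iJ; rewrite /B'; case: eqP => // ij.
    by move: jN2; rewrite -ij iJ.
  have := IH (j :: J2) B' uJ' mB'.
  rewrite big_cons (BB' (fun i S => fine (P (Z i @^-1` S)))) Bj => IH'.
  transitivity (\int[P]_w (\prod_(i <- J1) g i (Z i w) * \prod_(i <- (j :: J2)) \1_(B' i) (Z i w))%:E)%E.
    apply: eq_integral => w _; congr (_%:E).
    by rewrite big_cons (BB' (fun i S => \1_S (Z i w))) /W Bj; ring.
  rewrite IH' /c mulrCA mulrC EFinM fineK // fin_num_measure //.
  by rewrite -[X in measurable X]setTI; exact: mZ.
Qed.

Lemma indep_expectation (J : seq nat) (g : nat -> T' -> R) (e : nat -> R) : uniq J ->
  (forall i, measurable_fun setT (g i)) -> (forall i y, 0 <= g i y) ->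
  (forall i, \int[P]_w (g i (Z i w))%:E = (e i)%:E)%E ->
  (\int[P]_w (\prod_(j <- J) g j (Z j w))%:E = (\prod_(j <- J) e j)%:E)%E.
Proof.
move=> uJ mg g0 ge.
have := @indep_expectation_gen J [::] g e (fun=> setT); rewrite cats0 => /(_ uJ mg g0 ge (fun=> measurableT)).
by rewrite big_nil mulr1 => <-; apply: eq_integral => w _; rewrite big_nil mulr1.
Qed.

End independence.

(** * Large deviations of truncated sums *)

Section exp_ineq.
Context (R : realType).

(** From [expR (- x) >= 1 - x] the exponential is at most [1 / (1 - x)], and [(1 - x) * (1 + x + 2 *
    x ^+ 2) = 1 + x ^+ 2 * (1 - 2 * x)]. *)
Lemma expR_le_quadratic (x : R) : x <= 1 / 2 -> expR x <= 1 + x + 2 * x ^+ 2.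
Proof.
move=> x12; have h := expR_ge1Dx (- x).
have x0 : 0 < 1 - x by lra.
have : expR x * expR (- x) = 1 by rewrite -expRD subrr expR0.
have := expR_gt0 x; set e := expR x => e0 ee.
have : e * (1 - x) <= e * expR (- x) by rewrite ler_pM2l.
rewrite ee => h1.
rewrite -(ler_pM2r x0); apply: (le_trans h1).
have : 0 <= x ^+ 2 * (1 - 2 * x) by rewrite mulr_ge0 ?sqr_ge0 //; lra.
rewrite expr2; nra.
Qed.

(** Above 1/2 the constant 4 makes the power term at least [expR L], since [(1 / 2) ^ q >= 1 / 4].
    Between -1 and 1/2 the quadratic bound applies with [x ^+ 2 <= |x| ^ q]. Below -1 the
    exponential is at most 1 and [- x <= |x| ^ q]. *)
Lemma expR_le_power (q x L : R) : 1 <= q -> q <= 2 -> 0 <= L -> x <= L ->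
  expR x <= 1 + x + 4 * `|x| `^ q * expR L.
Proof.
move=> q1 q2 L0 xL.
have q0 : 0 <= q by lra.
have eL : 1 <= expR L by rewrite -[leLHS]expR0 ler_expR.
have eL0 : 0 <= expR L by rewrite ltW // expR_gt0.
have p0 : 0 <= `|x| `^ q by exact: powR_ge0.
have pe : `|x| `^ q <= `|x| `^ q * expR L by rewrite ler_peMr.
have [x12|x12] := leP x (1 / 2); last first.
  have x0 : 0 < x by lra.
  have h : 1 <= 4 * `|x| `^ q.
    have h2 : (1 / 2 : R) `^ 2 <= (1 / 2) `^ q by apply: ger_powR => //; lra.
    have h3 : (1 / 2 : R) `^ q <= `|x| `^ q.
      apply: ge0_ler_powR => //; rewrite ?nnegrE ?normr_ge0 //.
      by rewrite gtr0_norm // ltW.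
    have h4 : (1 / 2 : R) `^ 2 = 1 / 4.
      by rewrite powR_mulrn ?expr2; lra.
    lra.
  have : expR x <= expR L by rewrite ler_expR.
  nra.
have [x1|x1] := leP `|x| 1.
  apply: (le_trans (expR_le_quadratic x12)).
  have : x ^+ 2 <= `|x| `^ q.
    rewrite -[x ^+ 2]real_normK ?num_real // -powR_mulrn //.
    have [->|x0] := eqVneq x 0; first by rewrite normr0 powR0 ?powR_ge0 // pnatr_eq0.
    by apply: ger_powR => //; rewrite normr_gt0 x0.
  lra.
have xq : `|x| <= `|x| `^ q by apply: le1r_powR => //; exact: ltW.
have xn : x < -1.
  by move: x1; rewrite ltNge ler_norml negb_and -!ltNge => /orP[|]; lra.
have : expR x <= 1 by rewrite -[leRHS]expR0 ler_expR; lra.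
have : - x <= `|x| by rewrite -normrN ler_norm.
lra.
Qed.

Lemma expR_truncated_le (q h z t L : R) : 1 <= q -> q <= 2 -> 0 <= h -> 0 < L ->
  `|z| <= t ->
  expR (h * (z * (t <= L)%R%:R)) <=
    1 + h * z + (h * L `^ (1 - q) + 4 * h `^ q * expR (h * L)) * t `^ q.
Proof.
move=> q1 q2 h0 L0 zt; have t0 : 0 <= t := le_trans (normr_ge0 _) zt.
have q0 : 0 <= q by lra.
have tq := powR_ge0 t q; have Lq := powR_ge0 L (1 - q); have hq := powR_ge0 h q.
have e0 := expR_gt0 (h * L).
have [tL|Lt] := leP t L.
  rewrite mulr1.
  have hz : h * z <= h * L by rewrite ler_wpM2l // (le_trans _ tL) // (le_trans _ zt) // ler_norm.
  apply: (le_trans (@expR_le_power q (h * z) (h * L) q1 q2 _ hz)); first by rewrite mulr_ge0 // ltW.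
  have : `|h * z| `^ q <= h `^ q * t `^ q.
    rewrite -powRM //; apply: ge0_ler_powR; rewrite ?nnegrE ?mulr_ge0 //.
    by rewrite normrM ger0_norm // ler_wpM2l.
  move=> hh.
  have k1 : 4 * `|h * z| `^ q * expR (h * L) <= 4 * (h `^ q * t `^ q) * expR (h * L).
    by rewrite ler_wpM2r ?(ltW e0) // ler_wpM2l.
  have k2 : 0 <= h * L `^ (1 - q) * t `^ q by rewrite !mulr_ge0.
  lra.
rewrite mulr0 mulr0 expR0.
have tLq : t <= L `^ (1 - q) * t `^ q := le_powR_split q1 L0 (ltW Lt).
have k1 : - z <= t by rewrite (le_trans _ zt) // -normrN ler_norm.
have k2 : 0 <= h * (L `^ (1 - q) * t `^ q + z).
  by apply: mulr_ge0 => //; rewrite -lerBlDr sub0r (le_trans k1).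
have k3 : 0 <= 4 * h `^ q * expR (h * L) * t `^ q by rewrite !mulr_ge0 // ltW.
lra.
Qed.

End exp_ineq.

Section deviations.
Context (R : realType) (d : nat) (disp : measure_display)
  (Omega : measurableType disp) (P : probability Omega R).
Local Notation Rd := 'rV[R]_d.+1.
Context (Z : nat -> {RV P >-> borel Rd}).
Hypothesis iidZ : iid Z.
Hypothesis mean0 : mean_zero (Z 0%N).
Context (q M : R).
Hypothesis q_gt1 : 1 < q.
Hypothesis q_le2 : q <= 2.
Hypothesis momentZ : (\int[P]_w (enorm (Z 0%N w : Rd) `^ q)%:E = M%:E)%E.

Lemma moment_ge0 : 0 <= M.
Proof. by rewrite -lee_fin -momentZ; apply: integral_ge0 => w _; rewrite lee_fin powR_ge0. Qed.

Lemma measurable_comp_rv j (g : Rd -> R) : measurable_fun setT (g : borel Rd -> R) ->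
  measurable_fun setT (fun w => g (Z j w : Rd)).
Proof. by move=> mg; apply: (measurableT_comp mg); exact: measurable_funPT. Qed.

(** Both signs of each coordinate, so that one-sided exponential bounds control the sup norm. *)
Definition signed_coord (c : 'I_d.+1) (b : bool) (z : Rd) : R := (-1) ^+ b * z ord0 c.

Lemma measurable_signed_coord c b : measurable_fun setT (signed_coord c b : borel Rd -> R).
Proof.
apply: measurable_funM => //; apply: continuous_borel_measurable; exact: coord_continuous.
Qed.

Lemma measurable_enorm : measurable_fun setT (@enorm R d : borel Rd -> R).
Proof. exact: (continuous_borel_measurable (@enorm_continuous R d)). Qed.

Lemma signed_coord_le c b z : `|signed_coord c b z| <= enorm z.
Proof. by rewrite /signed_coord normrM normrX normrN1 expr1n mul1r coord_le_enorm. Qed.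

Lemma integrable_moment : P.-integrable setT (fun w => (enorm (Z 0%N w : Rd) `^ q)%:E).
Proof.
apply/integrableP; split.
  apply/measurable_EFinP; apply: (measurableT_comp (measurable_powR q)).
  exact: (measurable_comp_rv _ measurable_enorm).
under eq_integral do rewrite gee0_abs ?lee_fin ?powR_ge0 //.
by rewrite momentZ ltry.
Qed.

Lemma integrable_signed_coord c b : P.-integrable setT (fun w => (signed_coord c b (Z 0%N w : Rd))%:E).
Proof.
have i1 : P.-integrable setT (fun w => ((1 : R)%:E + (enorm (Z 0%N w : Rd) `^ q)%:E)%E).
  by apply: integrableD => //; [exact: finite_measure_integrable_cst|exact: integrable_moment].
apply: le_integrable i1 => //.
  apply/measurable_EFinP; exact: (measurable_comp_rv _ (measurable_signed_coord c b)).
move=> w _ /=; rewrite lee_fin.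
apply: (le_trans (signed_coord_le _ _ _)); set t := enorm _.
have tq := powR_ge0 t q.
rewrite ger0_norm; last by rewrite addr_ge0.
have [t1|t1] := leP t 1; first by rewrite ler_wpDr.
by rewrite ler_wpDl // le1r_powR // ltW.
Qed.

Lemma integral_signed_coord c b : (\int[P]_w (signed_coord c b (Z 0%N w : Rd))%:E = 0)%E.
Proof.
have := mean0 c; rewrite unlock => h.
under eq_integral do rewrite /signed_coord EFinM.
rewrite integralZl //; last first.
  have := integrable_signed_coord c false; rewrite /signed_coord.
  by under eq_fun do rewrite expr0 mul1r.
by rewrite h mule0.
Qed.

Definition trunc_exp (h L : R) c b (z : Rd) : R :=
  expR (h * (signed_coord c b z * (enorm z <= L)%R%:R)).

Lemma measurable_trunc_exp h L c b : measurable_fun setT (trunc_exp h L c b : borel Rd -> R).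
Proof.
apply: (measurableT_comp (@measurable_expR R)).
apply: measurable_funM => //; apply: measurable_funM; first exact: measurable_signed_coord.
have -> : (fun z : Rd => (enorm z <= L)%R%:R) = \1_[set z : Rd | enorm z <= L] :> (Rd -> R).
  apply/funext => z; rewrite indicE; congr (nat_of_bool _)%:R.
  by apply/idP/idP; rewrite inE.
apply: measurable_indic; apply: borel_closed.
apply: (@preimage_closed _ _ (@enorm R d) [set x | x <= L]); last exact: closed_le.
by move=> x _; exact: enorm_continuous.
Qed.

(** Expectation of the correction term of [expR_truncated_le], with [t] the norm of a step. *)
Definition exp_rate (h L : R) : R := (h * L `^ (1 - q) + 4 * h `^ q * expR (h * L)) * M.

Lemma integral_trunc_exp_le h L c b : 0 <= h -> 0 < L ->
  (\int[P]_w (trunc_exp h L c b (Z 0%N w : Rd))%:E <= (1 + exp_rate h L)%:E)%E.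
Proof.
move=> h0 L0; set K := h * L `^ (1 - q) + 4 * h `^ q * expR (h * L).
have -> : (1 + exp_rate h L)%:E = (\int[P]_w (1%:E + h%:E * (signed_coord c b (Z 0%N w : Rd))%:E
     + K%:E * (enorm (Z 0%N w : Rd) `^ q)%:E))%E.
  have i1 : P.-integrable setT (fun w => h%:E * (signed_coord c b (Z 0%N w : Rd))%:E)%E.
    by apply: integrableZl => //; exact: integrable_signed_coord.
  have i2 : P.-integrable setT (fun w => K%:E * (enorm (Z 0%N w : Rd) `^ q)%:E)%E.
    by apply: integrableZl => //; exact: integrable_moment.
  have i3 : P.-integrable setT (fun w => 1%:E + h%:E * (signed_coord c b (Z 0%N w : Rd))%:E)%E.
    by apply: integrableD => //; exact: finite_measure_integrable_cst.
  rewrite integralD // integralD //; last exact: finite_measure_integrable_cst.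
  rewrite integralZl //; last exact: integrable_signed_coord.
  rewrite integralZl //; last exact: integrable_moment.
  rewrite integral_signed_coord momentZ mule0 adde0 -EFinM integral_cst // [X in (_ * X + _)%E](probability_setT P) mule1.
  by rewrite -EFinD.
apply: ge0_le_integral => //.
- by move=> w _; rewrite lee_fin expR_ge0.
- by apply/measurable_EFinP; exact: (measurable_comp_rv _ (measurable_trunc_exp h L c b)).
- apply: emeasurable_funD.
    apply: emeasurable_funD => //; apply/measurable_EFinP; apply: measurable_funM => //.
    exact: (measurable_comp_rv _ (measurable_signed_coord c b)).
  apply/measurable_EFinP; apply: measurable_funM => //.
  apply: (measurableT_comp (measurable_powR q)).
  exact: (measurable_comp_rv _ measurable_enorm).
- move=> w _; rewrite -!EFinM -!EFinD lee_fin.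
  by apply: expR_truncated_le => //; [exact: ltW|exact: signed_coord_le].
Qed.

Lemma integral_iid (g : Rd -> R) j : measurable_fun setT (g : borel Rd -> R) ->
  (forall z, 0 <= g z) ->
  (\int[P]_w (g (Z j w : Rd))%:E = \int[P]_w (g (Z 0%N w : Rd))%:E)%E.
Proof.
move=> mg g0.
have mZ i : measurable_fun setT (Z i : Omega -> borel Rd) by exact: measurable_funPT.
have e i : (\int[P]_w (g (Z i w : Rd))%:E = \int[pushforward P (Z i : Omega -> borel Rd)]_y (g y)%:E)%E.
  rewrite ge0_integral_pushforward //; first exact/measurable_EFinP.
  by move=> y _; rewrite lee_fin.
rewrite !e; apply: eq_measure_integral => B mB _; exact: (iidZ.2 j B mB).
Qed.

Definition trunc_sum (L : R) c b (J : seq nat) (w : Omega) : R :=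
  \sum_(j <- J) signed_coord c b (Z j w : Rd) * (enorm (Z j w : Rd) <= L)%R%:R.

Lemma measurable_trunc_sum L c b J : measurable_fun setT (trunc_sum L c b J).
Proof.
apply: measurable_sum => j; apply: measurable_funM.
  exact: (measurable_comp_rv _ (measurable_signed_coord c b)).
have -> : (fun w => (enorm (Z j w : Rd) <= L)%R%:R) = \1_(~` [set w | L < enorm (Z j w : Rd)]) :> (Omega -> R).
  apply/funext => w; rewrite indicE; case: leP => h.
    by rewrite mem_set //=; apply/negP; rewrite -leNgt.
  by rewrite memNset //= => /(_ h).
apply: measurable_indic; apply: measurableC; exact: measurable_enorm_gt.
Qed.

Lemma trunc_sum_chernoff h L c b J x : uniq J -> 0 <= h -> 0 < L ->
  fine (P [set w | x < trunc_sum L c b J w]) <=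
  expR (- (h * x) + (size J)%:R * exp_rate h L).
Proof.
move=> uJ h0 L0.
have mE : measurable [set w | x < trunc_sum L c b J w] by exact: measurable_lt_fun (measurable_trunc_sum _ _ _ _) _.
pose g := trunc_exp h L c b.
have g0 z : 0 <= g z by exact: expR_ge0.
have I0 : (0 <= \int[P]_w (g (Z 0%N w : Rd))%:E)%E by apply: integral_ge0 => w _; rewrite lee_fin.
have Ile := @integral_trunc_exp_le h L c b h0 L0; rewrite -/g in Ile.
pose e := fine (\int[P]_w (g (Z 0%N w : Rd))%:E)%E.
have eE : (\int[P]_w (g (Z 0%N w : Rd))%:E)%E = e%:E.
  by rewrite /e fineK // ge0_fin_numE // (le_lt_trans Ile) ?ltry.
have ele : e <= expR (exp_rate h L).
  by rewrite (le_trans _ (expR_ge1Dx _)) // -lee_fin -eE.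
have e0 : 0 <= e by rewrite -lee_fin -eE.
have mZ i : measurable_fun setT (Z i : Omega -> borel Rd) by exact: measurable_funPT.
have ind : (\int[P]_w (\prod_(j <- J) g (Z j w : Rd))%:E = (\prod_(j <- J) e)%:E)%E.
  apply: (@indep_expectation _ _ _ _ _ P (fun j => Z j : Omega -> borel Rd) mZ iidZ.1 J (fun=> g) (fun=> e) uJ).
  - by move=> _; exact: measurable_trunc_exp.
  - by move=> _; exact: g0.
  - by move=> i; rewrite integral_iid //; exact: measurable_trunc_exp.
have mprod : measurable_fun setT (fun w => (\prod_(j <- J) g (Z j w : Rd))).
  apply: measurable_prod => j _; exact: (measurable_comp_rv _ (measurable_trunc_exp h L c b)).
have : (P [set w | (x < trunc_sum L c b J w)%R] <= (expR (- (h * x)))%:E * \int[P]_w (\prod_(j <- J) g (Z j w : Rd))%:E)%E.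
  rewrite -ge0_integralZl_EFin ?expR_ge0 //; [|by move=> w _; rewrite lee_fin prodr_ge0|exact/measurable_EFinP].
  rewrite -[X in P X]setIT -integral_indic //.
  apply: ge0_le_integral => //.
  - apply/measurable_EFinP; exact: measurable_indic.
  - by apply/measurable_EFinP; exact: measurable_funM.
  - move=> w _; rewrite -EFinM lee_fin.
    have -> : \prod_(j <- J) g (Z j w : Rd) = expR (h * trunc_sum L c b J w).
      by rewrite /trunc_sum mulr_sumr expR_sum.
    rewrite -expRD indicE; case: (boolP (w \in _)) => [|_]; last exact: expR_ge0.
    rewrite inE /= => xw; rewrite -[leLHS]expR0 ler_expR addrC subr_ge0.
    by rewrite ler_wpM2l // ltW.
rewrite ind -EFinM -[X in (X <= _)%E]fineK ?fin_num_measure // lee_fin => /le_trans; apply.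
rewrite expRD ler_wpM2l ?expR_ge0 // expRM_natl.
rewrite (big_const_seq) count_predT iter_mulr_1.
by rewrite lerXn2r ?nnegrE ?expR_ge0.
Qed.

End deviations.

Section union_bound.
Context disp (T : measurableType disp) (R : realType) (P : probability T R).

Lemma fine_probU (A B : set T) : measurable A -> measurable B ->
  fine (P (A `|` B)) <= fine (P A) + fine (P B).
Proof.
move=> mA mB; rewrite -fineD ?fin_num_measure //; apply: fine_le.
- by rewrite fin_num_measure //; exact: measurableU.
- by rewrite fin_numD !fin_num_measure.
- exact: measureU2.
Qed.

Lemma union_bound I (s : seq I) (A : I -> set T) : (forall i, measurable (A i)) ->
  fine (P (\big[setU/set0]_(i <- s) A i)) <= \sum_(i <- s) fine (P (A i)).
Proof.
move=> mA; elim: s => [|i s IH]; first by rewrite !big_nil measure0.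
rewrite !big_cons (le_trans (fine_probU _ _)) // ?lerD2l //; exact: bigsetU_measurable.
Qed.

Lemma union_bound_const (I : eqType) (s : seq I) (A : I -> set T) (t : R) :
  (forall i, measurable (A i)) -> (forall i, i \in s -> fine (P (A i)) <= t) ->
  fine (P (\big[setU/set0]_(i <- s) A i)) <= (size s)%:R * t.
Proof.
move=> mA At; apply: (le_trans (union_bound _ mA)).
rewrite big_seq (le_trans (ler_sum _ At)) // -big_seq big_const_seq count_predT.
by rewrite iter_addr_0 mulr_natl.
Qed.

Lemma mem_bigsetU (I : eqType) (s : seq I) (A : I -> set T) w i : i \in s -> A i w ->
  (\big[setU/set0]_(i <- s) A i) w.
Proof.
elim: s => // j s IH; rewrite inE big_cons => /orP[/eqP <-|/IH h] Aw; [by left|by right; exact: h].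
Qed.

End union_bound.

Section poly_deviation.
Context (R : realType) (d : nat) (disp : measure_display)
  (Omega : measurableType disp) (P : probability Omega R).
Local Notation Rd := 'rV[R]_d.+1.
Context (Z : nat -> {RV P >-> borel Rd}).
Hypothesis iidZ : iid Z.
Hypothesis mean0 : mean_zero (Z 0%N).
Context (q M : R).
Hypothesis q_gt1 : 1 < q.
Hypothesis q_le2 : q <= 2.
Hypothesis momentZ : (\int[P]_w (enorm (Z 0%N w : Rd) `^ q)%:E = M%:E)%E.

(** For [h = H ln k / k] and truncation at [eta * k], the bias term grows like [ln k] with a slope
    that the negative power of the truncation level makes small, while the other term stays bounded
    in [k]. *)
Lemma exp_rate_le (delta H eta k : R) : 0 < delta -> 0 <= H -> 0 < eta -> 1 <= k ->
  H * eta <= (q - 1) / 2 -> M * (eta * k) `^ (1 - q) <= delta / 2 ->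
  k * exp_rate q M (H * ln k / k) (eta * k) <=
    H * delta / 2 * ln k + 4 * M * (H / ((q - 1) / (2 * q))) `^ q.
Proof.
move=> delta0 H0 eta0 k1 Heta ML.
have k0 : 0 < k := lt_le_trans ltr01 k1.
have lnk : 0 <= ln k by exact: ln_ge0.
have M0 : 0 <= M by exact: moment_ge0 momentZ.
have q0 : 0 < q := lt_trans ltr01 q_gt1.
(* [s] balances the exponents: [ln k <= k ^ s / s] bounds [h ^ q] by a multiple of
   [k ^ ((s - 1) * q)], [expR (h * L)] is at most [k ^ ((q - 1) / 2)], and with the factor [k] the
   total exponent is 0. *)
set s := (q - 1) / (2 * q); have s0 : 0 < s by rewrite divr_gt0 ?mulr_gt0 // subr_gt0.
have sq : s * q = (q - 1) / 2 by rewrite /s; field; rewrite gt_eqF.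
have kne : k != 0 by rewrite gt_eqF.
clearbody s.
set L := eta * k in ML *; set h := H * ln k / k.
have h0 : 0 <= h by rewrite /h divr_ge0 ?mulr_ge0 // ltW.
have -> : k * exp_rate q M h L = (H * ln k) * (M * L `^ (1 - q)) + 4 * M * (k * (h `^ q * expR (h * L))).
  by rewrite /exp_rate /h; field; rewrite gt_eqF.
apply: lerD.
  have -> : H * delta / 2 * ln k = (H * ln k) * (delta / 2) by ring.
  by rewrite ler_wpM2l // mulr_ge0.
rewrite ler_wpM2l ?mulr_ge0 //.
have hq : h `^ q <= (H / s) `^ q * k `^ ((s - 1) * q).
  rewrite powRrM -powRM ?divr_ge0 ?powR_ge0 ?(ltW s0) //.
  apply: ge0_ler_powR; rewrite ?nnegrE ?(ltW q0) ?mulr_ge0 ?invr_ge0 ?powR_ge0 ?(ltW s0) ?(ltW k0) //.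
  rewrite powRB ?kne ?implybT // powRr1 ?(ltW k0) // /h mulrA ler_wpM2r ?invr_ge0 ?(ltW k0) //.
  by rewrite -mulrA ler_wpM2l // mulrC ln_le_powR.
have he : expR (h * L) <= k `^ ((q - 1) / 2).
  rewrite /powR gt_eqF // ler_expR /h /L.
  have -> : H * ln k / k * (eta * k) = H * eta * ln k by field; rewrite gt_eqF.
  by rewrite ler_wpM2r.
apply: (@le_trans _ _ (k * ((H / s) `^ q * k `^ ((s - 1) * q) * k `^ ((q - 1) / 2)))).
  by rewrite ler_wpM2l ?(ltW k0) // ler_pM ?powR_ge0 ?expR_ge0.
have -> : k * ((H / s) `^ q * k `^ ((s - 1) * q) * k `^ ((q - 1) / 2)) =
   (H / s) `^ q * (k `^ 1 * k `^ ((s - 1) * q) * k `^ ((q - 1) / 2)).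
  by rewrite powRr1 ?(ltW k0) //; ring.
rewrite -!powRD ?kne ?implybT //.
have -> : 1 + (s - 1) * q + (q - 1) / 2 = 0 by rewrite mulrBl sq; field.
by rewrite powRr0 mulr1.
Qed.

Lemma trunc_sum_poly (delta : R) (Lam : nat) : 0 < delta -> (0 < Lam)%N ->
  exists2 eta0 : R, 0 < eta0 & forall eta, 0 < eta -> eta <= eta0 ->
  exists C k0 : R, 0 < C /\ forall (k : nat) c b J, k0 <= k%:R -> uniq J -> size J = k ->
    fine (P [set w | delta * k%:R < trunc_sum Z (eta * k%:R) c b J w]) <= C / k%:R ^+ Lam.
Proof.
(* The Chernoff gain is [h * delta * k = 2 * Lam * ln k] and the bias costs
   [H * delta / 2 * ln k = Lam * ln k]; what remains is the power [- Lam] of [k]. *)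
move=> delta0 Lam0; pose H : R := 2 * Lam%:R / delta.
have H0 : 0 < H by rewrite divr_gt0 // mulr_gt0 // ltr0n.
have M0 : 0 <= M by exact: moment_ge0 momentZ.
exists ((q - 1) / 2 / H); first by rewrite divr_gt0 // divr_gt0 // subr_gt0.
move=> eta eta0 etale.
have m0 : 0 < delta / (2 * (M + 1)) by rewrite divr_gt0 // mulr_gt0 //; lra.
have kap0 : 0 < q - 1 by rewrite subr_gt0.
have [y y0 hy] := powRN_small kap0 m0.
pose C1 := 4 * M * (H / ((q - 1) / (2 * q))) `^ q.
(* From [y / eta] on, the truncation level [eta * k] is at least [y], which brings
   [M * (eta * k) ^ (1 - q)] below [delta / 2]. *)
exists (expR C1), (Num.max 1 (y / eta)); split; first exact: expR_gt0.
move=> k c b J.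
rewrite ge_max => /andP[k1 ky] uJ sJ.
have k0 : 0 < (k%:R : R) by exact: lt_le_trans k1.
have L0 : 0 < eta * k%:R by exact: mulr_gt0.
have yL : y <= eta * k%:R by rewrite mulrC -ler_pdivrMr.
have ML : M * (eta * k%:R) `^ (1 - q) <= delta / 2.
  have h1 : (eta * k%:R) `^ (1 - q) <= delta / (2 * (M + 1)) by rewrite -opprB hy.
  apply: (le_trans (ler_wpM2l M0 h1)).
  have -> : M * (delta / (2 * (M + 1))) = delta / 2 * (M / (M + 1)) by field; rewrite gt_eqF //; lra.
  rewrite ler_piMr ?divr_ge0 ?(ltW delta0) // ler_pdivrMr ?mul1r; lra.
have Heta : H * eta <= (q - 1) / 2 by rewrite mulrC -ler_pdivlMr.
have lnk : 0 <= ln (k%:R : R) by exact: ln_ge0.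
have h0 : 0 <= H * ln k%:R / k%:R by rewrite divr_ge0 // mulr_ge0 // ltW.
apply: (le_trans (trunc_sum_chernoff iidZ mean0 q_gt1 q_le2 momentZ c b _ uJ h0 L0)).
have := exp_rate_le delta0 (ltW H0) eta0 k1 Heta ML.
rewrite sJ -/C1 => hr.
have -> : expR C1 / k%:R ^+ Lam = expR (C1 - Lam%:R * ln k%:R).
  rewrite expRD; congr (_ * _); rewrite expRN; congr (_^-1).
  by rewrite expRM_natl lnK // posrE.
rewrite ler_expR.
have -> : H * ln k%:R / k%:R * (delta * k%:R) = 2 * (Lam%:R * ln k%:R) :> R.
  by rewrite /H; field; rewrite !gt_eqF.
have e : H * delta / 2 * ln k%:R = Lam%:R * ln k%:R :> R.
  by rewrite /H; field; rewrite gt_eqF.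
rewrite e in hr; lra.
Qed.

End poly_deviation.

Section lattice_count.
Context (R : realType).

Lemma count_lt_le (y : R) n : 0 <= y -> \sum_(r <- iota 1 n) (r%:R < y)%R%:R <= y.
Proof.
move=> y0; elim: n => [|n IH]; first by rewrite big_nil.
rewrite -[n.+1]addn1 iotaD big_cat /= big_seq1 add1n.
have [yn|yn] := leP y n.+1%:R; first by rewrite addr0.
apply: le_trans (ltW yn); rewrite -natr1 lerD2r.
rewrite (le_trans (ler_sum _ (_ : forall r, true -> _ <= 1))) //.
  by move=> r _; case: (_ < _).
by rewrite big_const_seq count_predT size_iota iter_addr_0.
Qed.

End lattice_count.

(** * The two exceptional events *)

Section bad_events.
Context (R : realType) (d : nat) (disp : measure_display)
  (Omega : measurableType disp) (P : probability Omega R).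
Local Notation Rd := 'rV[R]_d.+1.
Context (Z : nat -> {RV P >-> borel Rd}).
Hypothesis iidZ : iid Z.
Hypothesis mean0 : mean_zero (Z 0%N).
Context (q M : R).
Hypothesis q_gt1 : 1 < q.
Hypothesis q_le2 : q <= 2.
Hypothesis momentZ : (\int[P]_w (enorm (Z 0%N w : Rd) `^ q)%:E = M%:E)%E.
Local Notation p := (tailp (Z 0%N)).

Lemma measurable_rv_preimage j (B : set Rd) : measurable (B : set (borel Rd)) ->
  measurable [set w | B (Z j w : Rd)].
Proof.
move=> mB; have mZ : measurable_fun setT (Z j : Omega -> borel Rd) by exact: measurable_funPT.
by have := mZ measurableT B mB; rewrite setTI.
Qed.

Lemma iid_pair j l (B : set Rd) : measurable (B : set (borel Rd)) -> j != l ->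
  fine (P ([set w | B (Z j w : Rd)] `&` [set w | B (Z l w : Rd)])) =
  fine (P [set w | B (Z 0%N w : Rd)]) ^+ 2.
Proof.
move=> mB jl.
have := iidZ.1 [:: j; l] (fun=> B); rewrite /= inE jl => /(_ isT (fun=> mB)).
rewrite !big_cons big_nil mule1 !(iidZ.2 _ _ mB) => h.
rewrite expr2 -fineM ?fin_num_measure //; try exact: measurable_rv_preimage.
rewrite -[in RHS]h; congr (fine (P _)); apply/seteqP; split => w.
  by move=> [Bj Bl] i /=; rewrite !inE => /orP[/eqP ->|/eqP ->].
by move=> hw; split; apply: hw; rewrite /= !inE eqxx ?orbT.
Qed.

(** A relevant window holding both jumps has length [k >= b] and [k >= r], so its threshold
    [eta * k] is at least the one used here. One event thus serves all window lengths, without a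
    union over [k]. *)
Definition two_jumps n (b eta : R) : set Omega :=
  \big[setU/set0]_(j <- iota 1 n) \big[setU/set0]_(r <- iota 1 n)
    ([set w | eta * Num.max b r%:R < enorm (Z j w : Rd)] `&`
     [set w | eta * Num.max b r%:R < enorm (Z (j + r)%N w : Rd)]).

Lemma measurable_two_jumps n b eta : measurable (two_jumps n b eta).
Proof.
apply: bigsetU_measurable => j _; apply: bigsetU_measurable => r _.
by apply: measurableI; exact: measurable_enorm_gt.
Qed.

(* The sum is at most E[|Z| / eta; |Z| > eta b]: count the r < |Z| / eta. *)
Lemma sum_tailp_le n b eta : 0 < b -> 0 < eta ->
  \sum_(r <- iota 1 n) p (eta * Num.max b r%:R) <= M * (eta * b) `^ (1 - q) / eta.
Proof.
move=> b0 eta0; rewrite -lee_fin -sumEFin.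
have mA u : measurable [set w | u < enorm (Z 0%N w : Rd)] by exact: measurable_enorm_gt.
under eq_bigr => r _ do
  rewrite /tailp fineK ?fin_num_measure // -(setIT [set w | _]) -integral_indic //.
rewrite -ge0_integral_sum //; last first.
  by move=> r; apply/measurable_EFinP; exact: measurable_indic.
have cge0 : 0 <= (eta * b) `^ (1 - q) / eta by rewrite divr_ge0 ?powR_ge0 // ltW.
have -> : (M * (eta * b) `^ (1 - q) / eta)%:E =
    (\int[P]_w (((eta * b) `^ (1 - q) / eta)%:E * (enorm (Z 0%N w : Rd) `^ q)%:E))%E.
  rewrite integralZl //; last exact: integrable_moment momentZ.
  by rewrite momentZ -EFinM; congr (_%:E); ring.
apply: ge0_le_integral => //.
- by move=> w _; apply: sume_ge0.
- by apply: emeasurable_sum => r; apply/measurable_EFinP; exact: measurable_indic.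
- by have /integrableP[mm _] := integrable_moment momentZ; apply: measurable_funeM.
move=> w _; rewrite sumEFin -EFinM lee_fin; set t := enorm _.
have t0 : 0 <= t by exact: sqrtr_ge0.
have [tb|bt] := leP t (eta * b).
  rewrite big1; first by rewrite mulr_ge0 // powR_ge0.
  move=> r _; rewrite indicE memNset //= -/t; apply/negP; rewrite -leNgt (le_trans tb) //.
  by rewrite ler_pM2l // le_max lexx.
apply: (@le_trans _ _ (t / eta)); last first.
  rewrite mulrAC ler_wpM2r ?invr_ge0 ?(ltW eta0) //.
  by apply: le_powR_split; [exact: ltW|exact: mulr_gt0|exact: ltW].
apply: le_trans (@count_lt_le _ (t / eta) n _); last by rewrite divr_ge0 // ltW.
apply: ler_sum => r _; rewrite indicE ler_nat.
case: (boolP (w \in _)) => //; rewrite inE /= -/t => h.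
suff -> : r%:R < t / eta by [].
rewrite ltr_pdivlMr // mulrC; apply: le_lt_trans h.
by rewrite ler_pM2l // le_max lexx orbT.
Qed.

(** The positions and one of the jumps contribute [n * p (eta * b)], bounded when [b] is of the
    order of the norming; the other jump, summed over the distance, contributes a factor that
    vanishes like [b ^ (1 - q)]. *)
Lemma two_jumps_le n b eta : 0 < b -> 0 < eta ->
  fine (P (two_jumps n b eta)) <= n%:R * p (eta * b) * (M * (eta * b) `^ (1 - q) / eta).
Proof.
move=> b0 eta0; rewrite -mulrA -[in leRHS](size_iota 1 n).
apply: union_bound_const => [j|j _].
  by apply: bigsetU_measurable => r _; apply: measurableI; exact: measurable_enorm_gt.
have mA r : measurable ([set w | eta * Num.max b r%:R < enorm (Z j w : Rd)] `&`
    [set w | eta * Num.max b r%:R < enorm (Z (j + r)%N w : Rd)]).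
  by apply: measurableI; exact: measurable_enorm_gt.
apply: (le_trans (union_bound P _ mA)).
apply: (@le_trans _ _ (\sum_(r <- iota 1 n) p (eta * b) * p (eta * Num.max b r%:R))).
  rewrite big_seq [leRHS]big_seq; apply: ler_sum => r; rewrite mem_iota => /andP[r1 _].
  have := @iid_pair j (j + r)%N _ (@borel_enorm_gt R d (eta * Num.max b r%:R)).
  rewrite -{1}[j]addn0 eqn_add2l eq_sym -lt0n => /(_ r1).
  rewrite /enorm_gt /= => ->; rewrite expr2 -/(tailp _ _).
  apply: ler_pM; rewrite ?tailp_ge0 //; apply: tailp_le.
  by rewrite ler_pM2l // le_max lexx.
by rewrite -mulr_sumr ler_wpM2l ?tailp_ge0 // sum_tailp_le.
Qed.

(** [iota i.+1 k] lists the steps between times [i] and [i + k]. The ranges of [i] and [k] are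
    independent, so windows reaching beyond [n] are covered too, which only enlarges the event. *)
Definition large_dev n (b delta eta : R) : set Omega :=
  \big[setU/set0]_(i <- iota 0 n) \big[setU/set0]_(k <- [seq k <- iota 0 n.+1 | b <= k%:R])
  \big[setU/set0]_(c <- enum 'I_d.+1) \big[setU/set0]_(s <- [:: true; false])
    [set w | delta * k%:R < trunc_sum Z (eta * k%:R) c s (iota i.+1 k) w].

Lemma measurable_dev_event x L c s J : measurable [set w | x < trunc_sum Z L c s J w].
Proof. exact: measurable_lt_fun (measurable_trunc_sum _ _ _ _ _) _. Qed.

Lemma measurable_large_dev n b delta eta : measurable (large_dev n b delta eta).
Proof.
do 4 (apply: bigsetU_measurable => ? _); exact: measurable_dev_event.
Qed.

Lemma large_dev_le n b delta eta t : (forall (k : nat) c s J, b <= k%:R -> uniq J -> size J = k ->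
    fine (P [set w | delta * k%:R < trunc_sum Z (eta * k%:R) c s J w]) <= t) -> 0 <= t ->
  fine (P (large_dev n b delta eta)) <= n%:R * (n.+1%:R * (d.+1%:R * (2 * t))).
Proof.
move=> h t0; rewrite /large_dev -[in leRHS](size_iota 0 n).
apply: union_bound_const => [i|i _].
  do 3 (apply: bigsetU_measurable => ? _); exact: measurable_dev_event.
apply: (@le_trans _ _ ((size [seq k <- iota 0 n.+1 | b <= k%:R])%:R * (d.+1%:R * (2 * t)))); last first.
  rewrite ler_wpM2r ?mulr_ge0 // ler_nat.
  by rewrite size_filter (leq_trans (count_size _ _)) // !size_iota.
apply: union_bound_const => [k|k].
  do 2 (apply: bigsetU_measurable => ? _); exact: measurable_dev_event.
rewrite mem_filter => /andP[bk _].
rewrite -[in leRHS](card_ord d.+1) cardE.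
apply: union_bound_const => [c|c _].
  apply: bigsetU_measurable => ? _; exact: measurable_dev_event.
apply: (@union_bound_const _ _ _ _ _ [:: true; false]) => [s|s _].
  exact: measurable_dev_event.
by apply: h => //; [exact: iota_uniq|rewrite size_iota].
Qed.

Lemma bad_event_small (b : nat -> R) (K delta : R) (g : nat) : 0 < delta ->
  (forall n, 0 < b n) -> b n @[n --> \oo] --> +oo ->
  (\forall n \near \oo, n%:R <= K * b n ^+ g) ->
  (forall c, 0 < c -> exists t, \forall n \near \oo, n%:R * p (c * b n) <= t) ->
  exists2 eta0 : R, 0 < eta0 & forall eta, 0 < eta -> eta <= eta0 -> forall e, 0 < e ->
    \forall n \near \oo, fine (P (two_jumps n (b n) eta `|` large_dev n (b n) delta eta)) < e.
Proof.
move=> delta0 b0 boo nK pb.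
(* The decay exponent [2 * g + 1] leaves one negative power of [b n] once the number of windows, of
   order [n ^ 2], is bounded by a multiple of the power [2 * g] of [b n]. *)
have [eta0 eta00 heta] := trunc_sum_poly iidZ mean0 q_gt1 q_le2 momentZ delta0 (ltn0Sn (g + g)).
exists eta0 => // eta etagt etale e e0.
have [C [k0 [C0 hC]]] := heta eta etagt etale.
have [t ht] := pb eta etagt.
have M0 : 0 <= M by exact: moment_ge0 momentZ.
have kap0 : 0 < q - 1 by rewrite subr_gt0.
pose t' := Num.max t 1.
have t'0 : 0 < t' by rewrite lt_max ltr01 orbT.
(* Chosen so that [t' * M / eta] times this value is at most [e / 4]; [M + 1] guards against
   [M = 0]. *)
have m0 : 0 < e * eta / (4 * t' * (M + 1)) by rewrite divr_gt0 ?mulr_gt0 //; lra.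
have [y y0 hy] := powRN_small kap0 m0.
pose D := 2 * K ^+ 2 * (d.+1%:R * (2 * C)).
have /cvgryPge boo' := boo.
have h1 := boo' (Num.max k0 1); have h2 := boo' (y / eta); have h3 := boo' (4 * (D + 1) / e).
have h4 := nbhs_infty_gt 0.
apply: filterS (filterI (filterI (filterI h1 h2) (filterI h3 nK)) (filterI ht h4)) => n.
move=> [[[]]]; rewrite ge_max => /andP[bk b1] by_ [bD nKn] [htn n0].
have bpos := b0 n; set B := b n in bk b1 by_ bD nKn htn bpos *.
have n1 : (1 : R) <= n%:R by rewrite ler1n.
have T1 : fine (P (two_jumps n B eta)) <= e / 4.
  apply: (le_trans (two_jumps_le n bpos etagt)).
  have yL : y <= eta * B by rewrite mulrC -ler_pdivrMr.
  have h5 := hy _ yL; rewrite opprB in h5.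
  have h6 : n%:R * p (eta * B) <= t' by rewrite (le_trans htn) // le_max lexx.
  have h7 : M * (eta * B) `^ (1 - q) / eta <= M * (e * eta / (4 * t' * (M + 1))) / eta.
    by rewrite ler_wpM2r ?invr_ge0 ?(ltW etagt) // ler_wpM2l.
  apply: (@le_trans _ _ (t' * (M * (e * eta / (4 * t' * (M + 1))) / eta))).
    by apply: ler_pM => //; rewrite ?mulr_ge0 ?tailp_ge0 ?powR_ge0 ?invr_ge0 ?(ltW etagt).
  have -> : t' * (M * (e * eta / (4 * t' * (M + 1))) / eta) = e / 4 * (M / (M + 1)).
    by field; rewrite !gt_eqF //; lra.
  by rewrite ler_piMr ?divr_ge0 ?(ltW e0) // ler_pdivrMr ?mul1r; lra.
have T2 : fine (P (large_dev n B delta eta)) <= e / 4.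
  have tt : 0 <= C / B ^+ (g + g).+1 by rewrite divr_ge0 ?exprn_ge0 ?ltW.
  have hh (k : nat) c s J : B <= k%:R -> uniq J -> size J = k ->
      fine (P [set w | delta * k%:R < trunc_sum Z (eta * k%:R) c s J w]) <= C / B ^+ (g + g).+1.
    move=> Bk uJ sJ; apply: (le_trans (hC k c s J (le_trans bk Bk) uJ sJ)).
    have k0' := lt_le_trans bpos Bk.
    rewrite ler_wpM2l ?(ltW C0) // lef_pV2 ?posrE ?exprn_gt0 //.
    by rewrite lerXn2r ?nnegrE ?(ltW bpos) ?(ltW k0').
  apply: (le_trans (@large_dev_le n B delta eta _ hh tt)).
  have nn : n%:R * n.+1%:R <= 2 * (K * B ^+ g) ^+ 2.
    rewrite -natr1 expr2; have : n%:R * n%:R <= (K * B ^+ g) * (K * B ^+ g) by apply: ler_pM.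
    set v := (K * B ^+ g) * _; move=> hv; nra.
  have -> : n%:R * (n.+1%:R * (d.+1%:R * (2 * (C / B ^+ (g + g).+1)))) =
     (n%:R * n.+1%:R) * (d.+1%:R * (2 * (C / B ^+ (g + g).+1))) by ring.
  apply: (@le_trans _ _ (2 * (K * B ^+ g) ^+ 2 * (d.+1%:R * (2 * (C / B ^+ (g + g).+1))))).
    by rewrite ler_wpM2r // !mulr_ge0 // ?invr_ge0 ?exprn_ge0 ?(ltW C0) ?(ltW bpos).
  have -> : 2 * (K * B ^+ g) ^+ 2 * (d.+1%:R * (2 * (C / B ^+ (g + g).+1))) = D / B.
    by rewrite /D [B ^+ _.+1]exprS [B ^+ (g + g)]exprD; field; rewrite ?expf_neq0 ?gt_eqF.
  have D0 : 0 <= D by apply: mulr_ge0; [apply: mulr_ge0 => //; exact: sqr_ge0|rewrite !mulr_ge0 ?(ltW C0)].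
  rewrite ler_pdivrMr //; rewrite ler_pdivrMr // in bD; nra.
apply: (le_lt_trans (fine_probU P (measurable_two_jumps _ _ _) (measurable_large_dev _ _ _ _))).
by lra.
Qed.

End bad_events.

(** * Sums over windows outside the exceptional events *)

Section windows.
Context (R : realType) (d : nat) (disp : measure_display)
  (Omega : measurableType disp) (P : probability Omega R).
Local Notation Rd := 'rV[R]_d.+1.
Context (Z : nat -> {RV P >-> borel Rd}).

Lemma walk_diff i k w : walk Z (i + k) w - walk Z i w = \sum_(j <- iota i.+1 k) (Z j w : Rd).
Proof.
rewrite /walk (@big_cat_nat _ _ _ i.+1) //= ?ltnS ?leq_addr // addrAC subrr add0r.
by rewrite /index_iota subSS addKn.
Qed.

Lemma norm_rV_le (v : Rd) (x : R) : 0 <= x -> (forall c, `|v ord0 c| <= x) -> `|v| <= x.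
Proof.
move=> x0 h; rewrite [leLHS]/Num.norm /= mx_normrE; apply/bigmax_leP; split => // -[i j] _ /=.
by rewrite ord1.
Qed.

Lemma large_dev_trunc n b delta eta w i k c : ~ large_dev Z n b delta eta w ->
  (0 < k)%N -> (i + k <= n)%N -> b <= k%:R ->
  `|\sum_(j <- iota i.+1 k) (Z j w : Rd) ord0 c * (enorm (Z j w : Rd) <= eta * k%:R)%R%:R| <= delta * k%:R.
Proof.
move=> nD k0 ikn bk.
have h s : trunc_sum Z (eta * k%:R) c s (iota i.+1 k) w <= delta * k%:R.
  rewrite leNgt; apply/negP => hs; apply: nD.
  apply: (mem_bigsetU (i := i)); first by rewrite mem_iota add0n /= (leq_trans _ ikn) // -addn1 leq_add2l.
  apply: (mem_bigsetU (i := k)).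
    by rewrite mem_filter bk mem_iota add0n ltnS /= (leq_trans _ ikn) // leq_addl.
  apply: (mem_bigsetU (i := c)); first by rewrite mem_enum.
  by apply: (mem_bigsetU (i := s)) => //; case: s {hs}; rewrite !inE.
have := h true; have := h false; rewrite /trunc_sum /signed_coord.
under eq_bigr do rewrite expr0 mul1r.
move=> h1.
under eq_bigr do rewrite expr1 mulN1r mulNr.
rewrite sumrN => h2; rewrite ler_norml h1 andbT; lra.
Qed.

Lemma two_jumps_sep n b eta w i k j l : ~ two_jumps Z n b eta w -> 0 <= eta ->
  (0 < k)%N -> (i + k <= n)%N -> b <= k%:R ->
  j \in iota i.+1 k -> l \in iota i.+1 k -> (j < l)%N ->
  eta * k%:R < enorm (Z j w : Rd) -> eta * k%:R < enorm (Z l w : Rd) -> False.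
Proof.
move=> nT eta0 k0 ikn bk; rewrite !mem_iota => /andP[ij jk] /andP[il lk] jl Tj Tl; apply: nT.
have r1 : (0 < l - j)%N by rewrite subn_gt0.
have rk : (l - j <= k)%N.
  rewrite leq_subLR (leq_trans (ltnSE lk)) // leq_add2r; exact: ltnW.
apply: (mem_bigsetU (i := j)).
  by rewrite mem_iota (leq_trans _ ij) //= add1n ltnS (leq_trans _ ikn) // -ltnS.
apply: (mem_bigsetU (i := (l - j)%N)).
  by rewrite mem_iota r1 /= add1n ltnS (leq_trans rk) // (leq_trans _ ikn) // leq_addl.
have mk : eta * Num.max b (l - j)%:R <= eta * k%:R.
  by rewrite ler_wpM2l // ge_max bk ler_nat.
split => /=; first exact: le_lt_trans Tj.
by rewrite subnKC ?(ltnW jl) //; exact: le_lt_trans Tl.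
Qed.

Lemma window_no_jump n b delta eta w i k :
  ~ (two_jumps Z n b eta `|` large_dev Z n b delta eta) w -> 0 <= eta -> 0 <= delta ->
  (0 < k)%N -> (i + k <= n)%N -> b <= k%:R ->
  (forall j, j \in iota i.+1 k -> enorm (Z j w : Rd) <= eta * k%:R) ->
  `|walk Z (i + k) w - walk Z i w| <= delta * k%:R.
Proof.
move=> /not_orP[_ nD] eta0 delta0 k0 ikn bk h; rewrite walk_diff.
apply: norm_rV_le => [|c]; first by rewrite mulr_ge0.
rewrite summxE; apply: le_trans (large_dev_trunc c nD k0 ikn bk).
rewrite le_eqVlt; apply/orP; left; apply/eqP; congr (`|_|).
by apply: eq_big_seq => j /h ->; rewrite mulr1.
Qed.

(** A second jump above [eta * k] is excluded by [two_jumps_sep], so truncation removes exactly the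
    term [Z j]: the truncated sum is the window sum minus that jump. *)
Lemma window_one_jump n b delta eta w i k j :
  ~ (two_jumps Z n b eta `|` large_dev Z n b delta eta) w -> 0 <= eta -> 0 <= delta ->
  (0 < k)%N -> (i + k <= n)%N -> b <= k%:R ->
  j \in iota i.+1 k -> eta * k%:R < enorm (Z j w : Rd) ->
  `|walk Z (i + k) w - walk Z i w - (Z j w : Rd)| <= delta * k%:R.
Proof.
move=> /not_orP[nT nD] eta0 delta0 k0 ikn bk jI Tj; rewrite walk_diff.
apply: norm_rV_le => [|c]; first by rewrite mulr_ge0.
apply: le_trans (large_dev_trunc c nD k0 ikn bk).
rewrite !mxE summxE le_eqVlt; apply/orP; left; apply/eqP; congr (`|_|).
rewrite (big_rem j) //= [in RHS](big_rem j) //= [(Z j w : Rd) ord0 c + _]addrC addrK.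
rewrite leNgt Tj mulr0 add0r; apply: eq_big_seq => l lI.
have lj : l != j.
  by apply/eqP => e; move: lI; rewrite e (rem_filter _ (iota_uniq _ _)) mem_filter /= eqxx.
have lI' := mem_rem lI.
have -> : enorm (Z l w : Rd) <= eta * k%:R; last by rewrite mulr1.
rewrite leNgt; apply/negP => Tl; case: (ltngtP j l) lj => // jl _.
- exact: (two_jumps_sep nT eta0 k0 ikn bk jI lI' jl Tj Tl).
- exact: (two_jumps_sep nT eta0 k0 ikn bk lI' jI jl Tl Tj).
Qed.

(** The maximum over no admissible length is 0, and the length 0 never exceeds a nonnegative [b]. *)
Lemma longest_leP (A : set Rd) n w (b : R) : 0 <= b ->
  reflect (forall i k, (i + k <= n)%N -> dilate k%:R A (walk Z (i + k) w - walk Z i w) -> k%:R <= b)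
    ((longest_segment Z A n w)%:R <= b).
Proof.
move=> b0; rewrite -truncn_ge_nat //; apply: (iffP (bigmax_leqP _ _ _)) => [h i k ikn hd|h k /asboolP[i ik hd]].
  have k' : (k < n.+1)%N by rewrite ltnS (leq_trans _ ikn) // leq_addl.
  rewrite -truncn_ge_nat //; apply: (h (Ordinal k')); apply/asboolP; exists i => //=.
  by rewrite leq_subRL ?(leq_trans _ ikn) ?leq_addl // addnC.
rewrite truncn_ge_nat //; apply: h hd; rewrite addnC -leq_subRL // -ltnS; exact: ltn_ord.
Qed.

Lemma measurable_walk_diff i k : measurable_fun setT (fun w => walk Z (i + k) w - walk Z i w : borel Rd).
Proof.
apply: measurable_rV => j.
under eq_fun do rewrite walk_diff summxE.
apply: measurable_sum => l.
exact: (measurable_comp_rv Z l (continuous_borel_measurable (@coord_continuous R _ _ ord0 j))).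
Qed.

Lemma measurable_longest_le (A : set Rd) n (b : R) : measurable (A : set (borel Rd)) -> 0 <= b ->
  measurable [set w | (longest_segment Z A n w)%:R <= b].
Proof.
move=> mA b0.
have -> : [set w | (longest_segment Z A n w)%:R <= b] =
  \bigcap_(ik in [set ik : 'I_n.+1 * 'I_n.+1 | (ik.1 + ik.2 <= n)%N /\ ~ ((ik.2)%:R <= b)])
    ~` [set w | dilate (ik.2)%:R A (walk Z (ik.1 + ik.2) w - walk Z ik.1 w)].
  apply/seteqP; split => w /=.
    by move=> /(longest_leP _ _ _ b0) h [i k] /= [ikn kb] /(h _ _ ikn).
  move=> h; apply/(longest_leP _ _ _ b0) => i k ikn hd; apply: contrapT => kb.
  have i' : (i < n.+1)%N by rewrite ltnS (leq_trans _ ikn) // leq_addr.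
  have k' : (k < n.+1)%N by rewrite ltnS (leq_trans _ ikn) // leq_addl.
  by apply: (h (Ordinal i', Ordinal k')).
apply: fin_bigcap_measurable; first exact: finite_finset.
move=> [i k] /= [_ kb]; apply: measurableC.
have k0 : (k%:R : R) != 0 by apply/eqP => k0; apply: kb; rewrite k0.
by have := measurable_walk_diff i k measurableT (dilate_measurable k0 mA); rewrite setTI.
Qed.

End windows.

(** * Thickening and erosion of up-sets *)

Section upsets.
Context (R : realType) (d : nat).
Local Notation Rd := 'rV[R]_d.+1.
Implicit Types (A U : set Rd).

Lemma upset_up_dilations A : upset (up_dilations A).
Proof.
move=> s _ s1 [r r1 [y Ay <-]]; exists (s * r).
  by rewrite /= -[leLHS]mulr1 ler_pM.
by exists y => //; rewrite scalerA.
Qed.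

Lemma sub_up_dilations A B : A `<=` B -> up_dilations A `<=` up_dilations B.
Proof. by move=> AB _ [s s1 [y Ay <-]]; exists s => //; exists y => //; exact: AB. Qed.

Lemma up_dilations_open A : open A -> open (up_dilations A).
Proof.
move=> oA; apply: bigcup_open => s /= s1; apply: dilate_open => //.
exact: lt_le_trans ltr01 s1.
Qed.

Lemma up_dilations_norm_ge A (e : R) : 0 <= e -> (forall y, A y -> e <= `|y|) ->
  forall z, up_dilations A z -> e <= `|z|.
Proof.
move=> e0 h _ [s /= s1 [y Ay <-]]; rewrite normrZ.
apply: (@le_trans _ _ `|y|); first exact: h.
by rewrite ler_peMl // (le_trans s1) // ler_norm.
Qed.

Lemma closure_norm_ge A (e : R) : (forall y, A y -> e <= `|y|) ->
  forall y, closure A y -> e <= `|y|.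
Proof.
move=> h y cy; have cl : closed [set y : Rd | e <= `|y|].
  by apply: (@preimage_closed _ _ (@Num.norm R Rd) [set x | e <= x]); [move=> z _; exact: norm_continuous|exact: closed_ge].
have : closure [set y : Rd | e <= `|y|] y by apply: closureS cy.
by rewrite -((closure_id _).1 cl).
Qed.

(* dist(cl A, z / s) attains its minimum over the s that matter, a compact
   interval because A is bounded away from 0. *)
Lemma up_dilations_closed A : ~ closure A 0 -> closed (up_dilations (closure A)).
Proof.
move=> /away0P[e e0 Ae]; have cAe := closure_norm_ge Ae.
have [A0|Ane] := pselect (closure A !=set0); last first.
  rewrite (_ : up_dilations _ = set0); first exact: closed0.
  by apply/seteqP; split => // z [s _ [y Ay _]]; apply: Ane; exists y.
(* If [s *: y] is within 1 of [z], then [s * e <= |z| + 1]; the leading 1 ensures that [[1, S]] is a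
   genuine interval. *)
move=> z cz; pose S := 1 + (`|z| + 1) / e.
have S1 : 1 <= S by rewrite /S lerDl divr_ge0 ?addr_ge0 // ltW.
pose f (s : R) := dist_set (closure A) (s^-1 *: z).
have fc : {within `[1, S]%classic, continuous f}.
  apply: continuous_in_subspaceT => s; rewrite inE /= in_itv /= => /andP[s1 _].
  have s0 : s != 0 by rewrite gt_eqF // (lt_le_trans ltr01).
  apply: (@continuous_comp _ _ _ (fun s : R => s^-1 *: z) (dist_set (closure A))).
    apply: (@continuous_comp _ _ _ (fun s : R => s^-1) (fun t : R => t *: z)).
      exact: inv_continuous.
    exact: scalel_continuous.
  exact: dist_set_continuous.
have [c cI fmin] := EVT_min S1 fc.
move: cI; rewrite in_itv /= => /andP[c1 cS].
have c0 : 0 < c := lt_le_trans ltr01 c1.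
have [fc0|fc0] := leP (f c) 0.
  exists c => //; exists (c^-1 *: z); last by rewrite scalerA mulfV ?scale1r // gt_eqF.
  by apply: dist_set0 => //; exact: closed_closure.
(* A point of the union within [r] of [z] has [s <= S] since [r <= 1], and gives [f s < f c] since
   [r <= f c], against the minimality of [f c]. *)
exfalso; pose r := Num.min (f c) 1.
have r0 : 0 < r by rewrite lt_min fc0 ltr01.
have [u [[s /= s1 [y cy <-]] ]] := cz _ (nbhsx_ballx z r r0).
rewrite -ball_normE /= => zu.
have s0 : 0 < s := lt_le_trans ltr01 s1.
have sS : s <= S.
  have : s * e <= `|z| + 1.
    apply: (@le_trans _ _ `|s *: y|); first by rewrite normrZ gtr0_norm // ler_pM2l // cAe.
    rewrite -(subKr z (s *: y)) (le_trans (ler_normB _ _)) // lerD2l ltW //.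
    by apply: lt_le_trans zu _; rewrite ge_min lexx orbT.
  by rewrite -ler_pdivlMr // => h; rewrite (le_trans h) // /S lerDr.
have := fmin s; rewrite in_itv /= s1 sS => /(_ isT); apply/negP; rewrite -ltNge.
apply: (@le_lt_trans _ _ `|s^-1 *: z - y|); first exact: dist_set_le.
have -> : s^-1 *: z - y = s^-1 *: (z - s *: y) by rewrite scalerBr scalerA mulVf ?scale1r // gt_eqF.
rewrite normrZ gtr0_norm ?invr_gt0 //; apply: (@le_lt_trans _ _ `|z - s *: y|).
  by rewrite ler_piMl // invf_le1.
by apply: lt_le_trans zu _; rewrite ge_min lexx.
Qed.

(* Relative to |z|, so that the thickening of an up-set is again an up-set. *)
Definition rel_thick U (delta : R) : set Rd := [set z | dist_set U z <= delta * `|z|].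

Lemma rel_thick_closed U delta : U !=set0 -> closed (rel_thick U delta).
Proof.
move=> U0; have -> : rel_thick U delta = (fun z : Rd => dist_set U z - delta * `|z|) @^-1` [set x | x <= 0].
  by apply/seteqP; split => z; rewrite /rel_thick /= subr_le0.
apply: preimage_closed; last exact: closed_le.
move=> z _; apply: (@continuousB R R Rd (dist_set U) (fun z => delta * `|z|)).
  exact: dist_set_continuous.
apply: (@continuousM R Rd (fun=> delta) (fun z => `|z|)); first exact: cst_continuous.
exact: norm_continuous.
Qed.

Lemma dist_set_dilate U s z : upset U -> U !=set0 -> 1 <= s -> dist_set U (s *: z) <= s * dist_set U z.
Proof.
move=> uU U0 s1; have s0 : 0 < s := lt_le_trans ltr01 s1.
rewrite -ler_pdivrMl //; apply/ler_addgt0Pr => e e0.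
have [u Uu zu] : exists2 y, U y & `|z - y| < dist_set U z + e by apply: dist_set_lt => //; rewrite ltrDl.
apply: le_trans (ltW zu); rewrite ler_pdivrMl //.
apply: le_trans (dist_set_le (s *: z) (uU s u s1 Uu)) _.
by rewrite -scalerBr normrZ gtr0_norm.
Qed.

Lemma rel_thick_upset U delta : upset U -> U !=set0 -> upset (rel_thick U delta).
Proof.
move=> uU U0 s z s1; rewrite /rel_thick /= => h; have s0 : 0 < s := lt_le_trans ltr01 s1.
apply: (le_trans (dist_set_dilate z uU U0 s1)).
by rewrite normrZ gtr0_norm // mulrCA ler_pM2l.
Qed.

Lemma rel_thick_away U delta (e : R) : 0 < e -> (forall y, U y -> e <= `|y|) ->
  U !=set0 -> 0 <= delta <= 1 -> ~ closure (rel_thick U delta) 0.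
Proof.
move=> e0 Ue U0 /andP[d0 d1]; apply: (@away0_ge _ _ _ (e / 3)); first by rewrite divr_gt0.
move=> y hy; rewrite leNgt; apply/negP => ye.
have [u Uu yu] : exists2 u, U u & `|y - u| < 2 / 3 * e.
  apply: dist_set_lt => //; apply: le_lt_trans hy _.
  have : delta * `|y| <= `|y| by rewrite ler_piMl.
  lra.
have : `|u| <= `|y| + `|y - u| by rewrite -{1}(subKr y u) (le_trans (ler_normB _ _)).
have := Ue _ Uu; lra.
Qed.

(** The erosion is applied before dilating, so an absolute margin suffices: [up_dilations] of the
    eroded set is an up-set anyway. *)
Definition inner A (delta : R) : set Rd := [set y | delta < dist_set (~` A) y].

Lemma inner_open A delta : ~` A !=set0 -> open (inner A delta).
Proof.
move=> A0; apply: (@open_comp _ _ (dist_set (~` A)) [set x | delta < x]); last exact: open_gt.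
by move=> y _; exact: dist_set_continuous.
Qed.

Lemma inner_ball A delta y z : inner A delta y -> `|y - z| <= delta -> A z.
Proof.
move=> h yz; apply: contrapT => nAz; move: h; rewrite /inner /= ltNge => /negP; apply.
by apply: le_trans yz; exact: dist_set_le.
Qed.

Lemma inner_sub A delta : 0 <= delta -> inner A delta `<=` A.
Proof. by move=> d0 y h; apply: (inner_ball h); rewrite subrr normr0. Qed.

Context (mu : {measure set (borel (punctured R d)) -> \bar R}).
Hypothesis mu_radon : radon mu.

(** The thickenings decrease to the closed set [U] as [delta] tends to 0. Continuity from above
    applies because for [delta <= 1] they stay bounded away from 0. *)
Lemma rel_thick_rmeas U (t e : R) : closed U -> 0 < e -> (forall y, U y -> e <= `|y|) ->
  U !=set0 -> rmeas mu U < t -> forall delta0 : R, 0 < delta0 ->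
  exists2 delta, 0 < delta <= delta0 & rmeas mu (rel_thick U delta) < t.
Proof.
move=> cU e0 Ue U0 Ut delta0 delta00.
pose c0 k : R := Num.min 1 delta0 * k.+1%:R^-1.
have m0 : 0 < Num.min 1 delta0 by rewrite lt_min ltr01.
have c0_gt0 k : 0 < c0 k by rewrite /c0 mulr_gt0 // invr_gt0.
have c0_le k : c0 k <= Num.min 1 delta0 by rewrite /c0 ler_piMr ?(ltW m0) // invf_le1 // ler1n.
have c01 k : 0 <= c0 k <= 1 by rewrite (ltW (c0_gt0 k)) (le_trans (c0_le k)) // ge_min lexx.
have c0S k l : (k <= l)%N -> c0 l <= c0 k.
  by move=> kl; rewrite /c0 ler_pM2l // lef_pV2 ?posrE ?ltr0n // ler_nat.
have UE : U = \bigcap_k rel_thick U (c0 k).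
  apply/seteqP; split => [x Ux k _|x hx].
    rewrite /rel_thick /=; apply: (@le_trans _ _ 0); last by rewrite mulr_ge0 // ltW.
    by have := dist_set_le x Ux; rewrite subrr normr0.
  apply: dist_set0 => //; apply/ler_addgt0Pr => h h0; rewrite add0r.
  have h' : 0 < h / (Num.min 1 delta0 * (`|x| + 1)) by rewrite divr_gt0 // mulr_gt0 // ltr_wpDl.
  have [k] := ltr_add_invr h'; rewrite add0r => kh.
  have := hx k I; rewrite /rel_thick /= => /le_trans; apply.
  apply: (@le_trans _ _ (c0 k * (`|x| + 1))); first by rewrite ler_wpM2l ?lerDl // ltW.
  move: kh; rewrite ltr_pdivlMr ?mulr_gt0 ?ltr_wpDl // => /ltW; rewrite /c0.
  by rewrite mulrCA mulrA.
have cl k := @rel_thick_closed U (c0 k) U0.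
have mcl k := borel_closed (cl k).
have aw k := rel_thick_away e0 Ue U0 (c01 k).
have cv : emeas mu (rel_thick U (c0 k)) @[k --> \oo] --> emeas mu U.
  rewrite /emeas [in X in _ --> X]UE embed_bigcap.
  apply: (@nonincreasing_cvg_mu _ (borel (punctured R d)) R mu (fun k => embed (rel_thick U (c0 k)))).
  - by apply: emeas_fin.
  - by move=> k; exact: embed_measurable.
  - by apply: bigcapT_measurable => k; exact: embed_measurable.
  - move=> k l kl; apply/subsetPset; apply: sub_embed => x; rewrite /rel_thick /= => /le_trans; apply.
    by rewrite ler_wpM2r // c0S.
have Ut' : (emeas mu U < t%:E)%E.
  by rewrite /emeas emeasE ?lte_fin //; [exact: borel_closed|exact: away0_ge Ue].
have [k _ /(_ _ (leqnn k)) kt] := cvge_near_lt cv Ut'.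
exists (c0 k); first by rewrite c0_gt0 (le_trans (c0_le k)) // ge_min lexx orbT.
by move: kt; rewrite /= /emeas emeasE // lte_fin.
Qed.

(** The eroded sets increase to the interior of [A], and [up_dilations] commutes with unions, so
    continuity from below applies. *)
Lemma inner_rmeas A (t : R) : ~ closure A 0 -> t < rmeas mu (up_dilations (interior A)) ->
  exists2 delta : R, 0 < delta & t < rmeas mu (up_dilations (inner A delta)).
Proof.
move=> A0 Ut.
have Ane : ~` A !=set0 by exists 0 => /subset_closure.
pose c0 k : R := k.+1%:R^-1.
have c0_gt0 k : 0 < c0 k by rewrite invr_gt0.
have c0S k l : (k <= l)%N -> c0 l <= c0 k.
  by move=> kl; rewrite lef_pV2 ?posrE ?ltr0n // ler_nat.
have AE : up_dilations (interior A) = \bigcup_k up_dilations (inner A (c0 k)).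
  apply/seteqP; split => [_ [s s1 [y Ay <-]]|_ [k _ [s s1 [y Ay <-]]]].
    have fy : 0 < dist_set (~` A) y.
      move: Ay => /nbhs_ballP[r /= r0 rA]; apply: (lt_le_trans r0).
      have [u nAu] := Ane; apply: lb_le_inf; first by exists `|y - u|; exists u.
      move=> _ [v nAv <-]; rewrite leNgt; apply/negP => yv; apply: nAv; apply: rA.
      by rewrite -ball_normE.
    have [k] := ltr_add_invr fy; rewrite add0r => kh.
    by exists k => //; exists s => //; exists y.
  exists s => //; exists y => //.
  have := @inner_open A (c0 k) Ane; rewrite openE => /(_ _ Ay); apply: filterS.
  by apply: inner_sub; exact: ltW.
have [e e0 Ae] := away0P A0.
have aw k : ~ closure (up_dilations (inner A (c0 k))) 0.
  apply: (@away0_ge _ _ _ e e0); apply: up_dilations_norm_ge; first exact: ltW.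
  by move=> y /(inner_sub (ltW (c0_gt0 k))); exact: Ae.
have op k : open (up_dilations (inner A (c0 k))) by apply: up_dilations_open; exact: inner_open.
have mop k := borel_open (op k).
have cv : emeas mu (up_dilations (inner A (c0 k))) @[k --> \oo] --> emeas mu (up_dilations (interior A)).
  rewrite /emeas [in X in _ --> X]AE embed_bigcup.
  apply: (@nondecreasing_cvg_mu _ (borel (punctured R d)) R mu (fun k => embed (up_dilations (inner A (c0 k))))).
  - by move=> k; exact: embed_measurable.
  - by apply: bigcup_measurable => k _; exact: embed_measurable.
  - move=> k l kl; apply/subsetPset; apply: sub_embed; apply: sub_up_dilations => y.
    by rewrite /inner /=; apply: le_lt_trans; exact: c0S.
have Ut' : (t%:E < emeas mu (up_dilations (interior A)))%E.
  rewrite /emeas emeasE ?lte_fin //.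
    by apply: borel_open; apply: up_dilations_open; exact: open_interior.
  apply: (@away0_ge _ _ _ e e0); apply: up_dilations_norm_ge; first exact: ltW.
  by move=> y /interior_subset; exact: Ae.
have [k _ /(_ _ (leqnn k)) kt] := cvge_near_gt cv Ut'.
exists (c0 k) => //; by move: kt; rewrite /= /emeas emeasE // lte_fin.
Qed.

End upsets.

(** * Consequences of regular variation for an arbitrary normalizing sequence *)

Section rv_facts.
Context (R : realType) (d : nat) (disp : measure_display)
  (Omega : measurableType disp) (P : probability Omega R).
Local Notation Rd := 'rV[R]_d.+1.
Context (X : {RV P >-> borel Rd}) (alpha : R)
  (mu : {measure set (borel (punctured R d)) -> \bar R}).
Hypothesis alpha_gt1 : 1 < alpha.
Hypothesis rvX : regularly_varying X alpha mu.
Context (a : nat -> R).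
Hypothesis a_gt0 : forall n, 0 < a n.
Hypothesis a_norm : normalizing X a.
Local Notation p := (tailp X).

Let alpha_gt0 : 0 < alpha := lt_trans ltr01 alpha_gt1.

Lemma rv_upset_lt F t : upset F -> closed F -> ~ closure F 0 -> rmeas mu F < t ->
  \forall n \near \oo, rlaw X n (a n) F < t.
Proof.
case: rvX => _ radon_mu mu_inf [a' [a'0 a'nd a'oo a'norm vmu]] hom.
exact: (upset_rlaw_lt alpha_gt0 radon_mu mu_inf hom a'0 vmu a'norm a_norm).
Qed.

Lemma rv_upset_gt G t : upset G -> open G -> ~ closure G 0 -> t < rmeas mu G ->
  \forall n \near \oo, t < rlaw X n (a n) G.
Proof.
case: rvX => _ radon_mu mu_inf [a' [a'0 a'nd a'oo a'norm vmu]] hom.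
exact: (upset_rlaw_gt alpha_gt0 radon_mu mu_inf hom a'0 vmu a'norm a_gt0 a_norm).
Qed.

Lemma rv_rmeas_dilate c U : 0 < c -> measurable (U : set (borel Rd)) -> ~ closure U 0 ->
  rmeas mu (dilate c U) = c `^ (- alpha) * rmeas mu U.
Proof. by case: rvX => _ radon_mu _ _ hom; exact: (rmeas_dilate radon_mu hom). Qed.

Lemma rv_tailp_lt c t : 0 < c -> c `^ (- alpha) < t ->
  \forall n \near \oo, n%:R * p (c * a n) < t.
Proof.
move=> c0 ct; have : \forall n \near \oo, rlaw X n (a n) (enorm_ge c) < t.
  apply: rv_upset_lt.
  - move=> s x s1; rewrite /enorm_ge /= enormZ ?(le_trans _ s1) // => h.
    by rewrite (le_trans h) // ler_peMl // (le_trans _ h) // ltW.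
  - exact: enorm_ge_closed.
  - exact: enorm_ge_away.
  - rewrite -dilate_enorm_ge // rv_rmeas_dilate //; [|exact: borel_enorm_ge|exact: enorm_ge_away].
    case: rvX => _ radon_mu mu_inf [a' [a'0 a'nd a'oo a'norm vmu]] hom.
    apply: le_lt_trans ct; rewrite ler_piMr ?powR_ge0 //.
    exact: (rmeas_enorm_ge_le1 alpha_gt0 radon_mu mu_inf hom a'0 vmu a'norm).
by apply: filterS => n; apply: le_lt_trans; exact: rlaw_enorm_gt_le_ge.
Qed.

Lemma rv_norm_cvgy : a n @[n --> \oo] --> +oo.
Proof.
case: rvX => _ radon_mu mu_inf [a' [a'0 a'nd a'oo a'norm vmu]] hom.
apply/cvgryPge => u; have /cvgryPge/(_ (2 * u)) h1 := a'oo.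
have h2 : \forall n \near \oo, 1 / 2 * a' n <= a n.
  by apply: (near_a_ge alpha_gt0 radon_mu mu_inf hom a'0 vmu a'norm a_norm); lra.
apply: filterS (filterI h1 h2) => n [h3 h4]; lra.
Qed.

Lemma rv_moment : exists q M : R, [/\ 1 < q, q <= 2 &
  (\int[P]_w (enorm (X w : Rd) `^ q)%:E = M%:E)%E].
Proof.
case: rvX => _ radon_mu mu_inf [a' [a'0 a'nd a'oo a'norm vmu]] hom.
have hlt := near_tailpM_lt alpha_gt0 radon_mu mu_inf hom a'0 vmu a'norm.
have hgt := near_tailpM_gt alpha_gt0 radon_mu mu_inf hom a'0 vmu a'norm.
have [c [u0 [c0 c12 u00 dbl]]] := tail_doubling_le alpha_gt1 (tailp_ge0 X) (@tailp_le _ _ _ _ _ X) a'0 a'nd a'oo hlt hgt.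
have mE : measurable_fun setT (fun w => enorm (X w : Rd)).
  by apply: (measurableT_comp (@measurable_enorm R d)); exact: measurable_funPT.
have [q [q1 q2 fin]] := finite_moment mE (fun w => sqrtr_ge0 _) c0 c12 u00 dbl.
exists q, (fine (\int[P]_w (enorm (X w : Rd) `^ q)%:E)%E); split => //.
by rewrite fineK // ge0_fin_numE // integral_ge0 // => w _; rewrite lee_fin powR_ge0.
Qed.

(** [n * p (a n)] is eventually below 2 while [p u] is at least [C / u ^+ g]; hence the constant
    [2 / C]. *)
Lemma rv_poly : exists (K : R) (g : nat), 0 < K /\ \forall n \near \oo, n%:R <= K * a n ^+ g.
Proof.
case: (rvX) => _ radon_mu mu_inf [a' [a'0 a'nd a'oo a'norm vmu]] hom.
have hlt := near_tailpM_lt alpha_gt0 radon_mu mu_inf hom a'0 vmu a'norm.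
have hgt := near_tailpM_gt alpha_gt0 radon_mu mu_inf hom a'0 vmu a'norm.
have [c [u0 [c0 c1 u00 dbl]]] := tail_doubling_ge alpha_gt1 (tailp_ge0 X) (@tailp_le _ _ _ _ _ X) a'0 a'nd a'oo hlt hgt.
have pu0 := tail_gt0 (tailp_ge0 X) (@tailp_le _ _ _ _ _ X) a'oo hgt u0.
have [C [g [C0 hC]]] := tail_poly_lower (@tailp_le _ _ _ _ _ X) c0 c1 u00 pu0 dbl.
exists (2 / C), g; split; first exact: divr_gt0.
have /cvgryPgt/(_ u0) h1 := rv_norm_cvgy.
have h2 : \forall n \near \oo, n%:R * p (a n) < 2.
  by apply: (near_tailp_lt a_norm); lra.
apply: filterS (filterI h1 h2) => n [ua np].
have h3 := hC _ ua; have an := a_gt0 n.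
have ag : 0 < a n ^+ g by exact: exprn_gt0.
rewrite mulrAC ler_pdivlMr //.
have : n%:R * C <= n%:R * (p (a n) * a n ^+ g) by rewrite ler_wpM2l.
rewrite mulrA => /le_trans; apply.
by rewrite ler_pM2r // ltW.
Qed.

(** Markov's inequality of order [q] and [n * p (a n) > 1 / 2] give [a n ^ q <= 2 * n * M]. Dividing
    by [a n ^ (q - 1)], which tends to infinity, yields [a n = o(n)]. *)
Lemma rv_norm_small (rho : R) : 0 < rho -> \forall n \near \oo, a n <= rho * n%:R.
Proof.
move=> rho0; have [q [M [q1 q2 mom]]] := rv_moment.
have M0 : 0 <= M by rewrite -lee_fin -mom; apply: integral_ge0 => w _; rewrite lee_fin powR_ge0.
have mE : measurable_fun setT (fun w => enorm (X w : Rd)).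
  by apply: (measurableT_comp (@measurable_enorm R d)); exact: measurable_funPT.
have markov u : 0 < u -> u `^ q * p u <= M.
  move=> u0; rewrite -lee_fin -mom EFinM fineK ?fin_num_measure //; last exact: measurable_enorm_gt.
  rewrite -[X in P X]setIT -integral_indic //; last exact: measurable_enorm_gt.
  rewrite -ge0_integralZl_EFin ?powR_ge0 //; last first.
    by apply/measurable_EFinP; apply: measurable_indic; exact: measurable_enorm_gt.
  apply: ge0_le_integral => //.
  - by move=> w _; rewrite -EFinM lee_fin mulr_ge0 ?powR_ge0.
  - apply/measurable_EFinP; apply: measurable_funM => //.
    by apply: measurable_indic; exact: measurable_enorm_gt.
  - by apply/measurable_EFinP; exact: (measurableT_comp (measurable_powR q)).
  - move=> w _; rewrite -EFinM lee_fin indicE; case: (boolP (w \in _)) => [|_]; last by rewrite mulr0 powR_ge0.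
    rewrite inE /= mulr1 => h; apply: ge0_ler_powR; rewrite ?nnegrE ?sqrtr_ge0 ?(ltW u0) ?(ltW h) //.
    by rewrite ltW // (lt_trans ltr01).
have kap0 : 0 < q - 1 by rewrite subr_gt0.
have m0 : 0 < rho / (2 * (M + 1)) by rewrite divr_gt0 // mulr_gt0 //; lra.
have [y y0 hy] := powRN_small kap0 m0.
have /cvgryPge/(_ y) h1 := rv_norm_cvgy.
have h2 : \forall n \near \oo, 1 / 2 < n%:R * p (a n) by apply: (near_tailp_gt a_norm); lra.
apply: filterS (filterI h1 h2) => n [ya np]; have an := a_gt0 n.
have h3 := hy _ ya; have h4 := markov _ an; have aq : 0 < a n `^ q by exact: powR_gt0.
have h5 : a n = a n `^ (- (q - 1)) * a n `^ q.
  have ane : a n != 0 by rewrite gt_eqF.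
  by rewrite -powRD ?ane ?implybT // opprB subrK powRr1 // ltW.
have h6 : a n `^ q / 2 <= n%:R * M.
  apply: (@le_trans _ _ (n%:R * (a n `^ q * p (a n)))); last by rewrite ler_wpM2l.
  rewrite mulrCA ler_pM2l //; lra.
rewrite h5; apply: (@le_trans _ _ (rho / (2 * (M + 1)) * (2 * (n%:R * M)))).
  by apply: ler_pM; rewrite ?powR_ge0 //; lra.
have -> : rho / (2 * (M + 1)) * (2 * (n%:R * M)) = rho * n%:R * (M / (M + 1)).
  by field; rewrite gt_eqF //; lra.
by rewrite ler_piMr ?mulr_ge0 ?(ltW rho0) // ler_pdivrMr ?mul1r; lra.
Qed.

End rv_facts.

Section exp_powers.
Context (R : realType).

(** Since [expR (v / n) >= 1 + v / n], it suffices that [n / (n + v) <= 1 - v' / n], that is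
    [(n - v') * (n + v) >= n ^ 2]; expanded, this is the hypothesis on [v' * v]. *)
Lemma expRN_le_pow (v v' t : R) (n : nat) : 0 <= v' -> v' < v -> (0 < n)%N ->
  v' * v <= n%:R * (v - v') -> n%:R * t <= v' -> expR (- v) <= (1 - t) ^+ n.
Proof.
move=> v'0 v'v n0 hn nt.
have n0' : 0 < (n%:R : R) by rewrite ltr0n.
have v0 : 0 < v by lra.
have -> : expR (- v) = expR (- (v / n%:R)) ^+ n.
  by rewrite -expRM_natl; congr expR; field; rewrite gt_eqF.
apply: lerXn2r; rewrite ?nnegrE ?expR_ge0 //.
  rewrite subr_ge0 -(ler_pM2l n0') mulr1; nra.
apply: (@le_trans _ _ (n%:R / (n%:R + v))).
  rewrite expRN -[leRHS]invf_div lef_pV2 ?posrE ?expR_gt0 ?divr_gt0 ?addr_gt0 //.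
  apply: le_trans (expR_ge1Dx _); by rewrite mulrDl mulfV ?gt_eqF.
rewrite ler_pdivrMr ?addr_gt0 // -(ler_pM2l n0').
have h : n%:R * ((1 - t) * (n%:R + v)) = (n%:R - n%:R * t) * (n%:R + v) by ring.
have h2 : (n%:R - v') * (n%:R + v) <= (n%:R - n%:R * t) * (n%:R + v).
  by rewrite ler_wpM2r ?lerD2l ?lerN2 // addr_ge0 // ltW.
rewrite h; apply: le_trans h2; nra.
Qed.

Lemma pow_le_expRN (t : R) (n : nat) : t <= 1 -> (1 - t) ^+ n <= expR (- (n%:R * t)).
Proof.
move=> t1; rewrite -mulrN expRM_natl; apply: lerXn2r; rewrite ?nnegrE ?expR_ge0 ?subr_ge0 //.
exact: expR_ge1Dx.
Qed.

End exp_powers.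

(** * The two limit inequalities *)

Section main_limits.
Context (R : realType) (d : nat) (disp : measure_display)
  (Omega : measurableType disp) (P : probability Omega R).
Local Notation Rd := 'rV[R]_d.+1.
Context (Z : nat -> {RV P >-> borel Rd}) (alpha : R)
  (mu : {measure set (borel (punctured R d)) -> \bar R}).
Hypothesis iidZ : iid Z.
Hypothesis alpha_gt1 : 1 < alpha.
Hypothesis rvZ : regularly_varying (Z 0%N) alpha mu.
Hypothesis mean0 : mean_zero (Z 0%N).
Context (a : nat -> R).
Hypothesis a_gt0 : forall n, 0 < a n.
Hypothesis a_norm : normalizing (Z 0%N) a.
Context (A : set Rd).
Hypothesis mA : measurable (A : set (borel Rd)).
Hypothesis A_away : bounded_away0 A.
Local Notation p := (tailp (Z 0%N)).
Local Notation bad n b delta eta := (two_jumps Z n b eta `|` large_dev Z n b delta eta).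

Definition no_hit (m : nat) (B : set Rd) : set Omega :=
  \bigcap_(j in [set` iota 1 m]) [set w | ~ B (Z j w : Rd)].

Lemma measurable_no_hit m B : measurable (B : set (borel Rd)) -> measurable (no_hit m B).
Proof.
move=> mB; apply: fin_bigcap_measurable; first exact: finite_seq.
move=> j _; apply: (@measurable_rv_preimage _ _ _ _ _ Z j (~` B)); exact: measurableC.
Qed.

Lemma prob_no_hit m (B : set Rd) : measurable (B : set (borel Rd)) ->
  fine (P (no_hit m B)) = (1 - fine (P [set w | B (Z 0%N w : Rd)])) ^+ m.
Proof.
move=> mB; have mC : measurable (~` B : set (borel Rd)) by exact: measurableC.
have := iidZ.1 (iota 1 m) (fun=> ~` B) (iota_uniq _ _) (fun=> mC).
rewrite /no_hit => ->.
have e j : P (Z j @^-1` (~` B)) = (1 - fine (P [set w | B (Z 0%N w : Rd)]))%:E.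
  rewrite (iidZ.2 _ _ mC) preimage_setC probability_setC; last exact: (measurable_rv_preimage Z 0 mB).
  by rewrite EFinB fineK // fin_num_measure //; exact: (measurable_rv_preimage Z 0 mB).
rewrite (eq_bigr _ (fun j _ => e j)) -[in RHS](size_iota 1 m).
set c := 1 - _; suff -> : (\prod_(j <- iota 1 m) c%:E = (c ^+ size (iota 1 m))%:E)%E by [].
elim: (iota 1 m) => [|j J IH]; first by rewrite big_nil.
by rewrite big_cons IH -EFinM exprS.
Qed.

(** A window sum in [k A] has norm at least [e * k], too much for a window without jump. With a
    single jump [Z j] the error is at most [delta' * e / 2 * k] while [|Z j| >= e / 2 * k], so it is
    at most [delta' * |Z j|], as the relative thickening demands. *)
Lemma sub_no_hit (n : nat) (b delta' e eta : R) w : 0 < b -> 0 < eta -> 0 < e ->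
  0 < delta' <= 1 -> (forall y, A y -> e <= `|y|) ->
  ~ (bad n b (delta' * e / 2) eta) w ->
  no_hit n [set z | rel_thick (up_dilations (closure A)) delta' (b^-1 *: z)] w ->
  (longest_segment Z A n w)%:R <= b.
Proof.
move=> b0 eta0 e0 /andP[d0 d1] Ae nB nH.
set delta := delta' * e / 2 in nB.
have delta0 : 0 < delta by rewrite /delta divr_gt0 ?mulr_gt0.
have de : delta <= e / 2.
  by rewrite /delta -mulrA ler_piMl // divr_ge0 // ltW.
apply/(longest_leP _ _ _ _ (ltW b0)) => i k ikn [y Ay yS].
rewrite leNgt; apply/negP => bk.
have k0' : 0 < (k%:R : R) by exact: lt_trans bk.
have k0 : (0 < k)%N by rewrite ltr0n in k0'.
set S := walk Z (i + k) w - walk Z i w in yS.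
have Sk : e * k%:R <= `|S|.
  by rewrite -yS normrZ gtr0_norm // mulrC ler_pM2l // Ae.
have [j jI Tj] : exists2 j, j \in iota i.+1 k & eta * k%:R < enorm (Z j w : Rd).
  apply: contrapT => h.
  have := window_no_jump nB (ltW eta0) (ltW delta0) k0 ikn (ltW bk) _.
  have h' j : j \in iota i.+1 k -> enorm (Z j w : Rd) <= eta * k%:R.
    by move=> jI; rewrite leNgt; apply/negP => Tj; apply: h; exists j.
  move=> /(_ h'); rewrite -/S => h2.
  have := le_trans Sk h2; rewrite ler_pM2r //; lra.
have hS := window_one_jump nB (ltW eta0) (ltW delta0) k0 ikn (ltW bk) jI Tj.
rewrite -/S in hS.
have jn : j \in iota 1 n.
  move: jI; rewrite !mem_iota => /andP[ij jk]; rewrite (leq_trans _ ij) //= add1n ltnS.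
  by rewrite (leq_trans _ ikn) // -ltnS -addSn.
apply: (nH j jn); rewrite /rel_thick /=.
(* [k > b] makes [k / b] an admissible dilation factor. *)
have Uy : up_dilations (closure A) ((k%:R / b) *: y).
  exists (k%:R / b); first by rewrite /= ler_pdivlMr // mul1r ltW.
  by exists y => //; exact: subset_closure.
apply: (le_trans (dist_set_le _ Uy)).
have -> : b^-1 *: (Z j w : Rd) - (k%:R / b) *: y = - (b^-1 *: (S - (Z j w : Rd))).
  by rewrite -yS scalerBr opprB scalerA [b^-1 * _]mulrC.
have bV : 0 < b^-1 by rewrite invr_gt0.
rewrite normrN !normrZ gtr0_norm // mulrCA ler_pM2l // (le_trans hS) //.
have hZ : e / 2 * k%:R <= `|Z j w : Rd|.
  have : `|S| <= `|Z j w : Rd| + `|S - (Z j w : Rd)|.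
    by rewrite addrC -{1}(subrK (Z j w : Rd) S) ler_normD.
  have : delta * k%:R <= e / 2 * k%:R by rewrite ler_pM2r.
  lra.
have -> : delta * k%:R = delta' * (e / 2 * k%:R) by rewrite /delta; ring.
by rewrite ler_pM2l.
Qed.

(** The window starts just before step [j] and has length just above [b * s]. Its average differs
    from [y] by at most [K / b <= delta] through the rounding of the length and by at most [delta]
    through the other steps; the erosion by [2 * delta] absorbs both. The bound [K * b] on the jump
    keeps the window within the first [n] steps. *)
Lemma hit_longest (n j : nat) (b delta e eta K : R) w : 1 <= b -> 0 < eta -> 0 < e ->
  0 < delta -> eta <= e / 4 -> (forall y, A y -> e <= `|y|) -> K / b <= delta ->
  ~ (bad n b delta eta) w -> (0 < j)%N -> j%:R + K * b / e <= n%:R ->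
  enorm (Z j w : Rd) <= K * b ->
  up_dilations (inner A (2 * delta)) (b^-1 *: (Z j w : Rd)) ->
  b < (longest_segment Z A n w)%:R.
Proof.
move=> b1 eta0 e0 delta0 etae Ae Kb nB j0 jn TK [s /= s1 [y Ay yZ]].
have b0 : 0 < b := lt_le_trans ltr01 b1.
have s0 : 0 < s := lt_le_trans ltr01 s1.
have Ay' : A y by apply: inner_sub Ay; rewrite mulr_ge0 // ltW.
have ye := Ae _ Ay'.
have ZE : (Z j w : Rd) = (b * s) *: y by rewrite -scalerA yZ scalerA mulfV ?scale1r // gt_eqF.
have bs0 : 0 < b * s by exact: mulr_gt0.
have bsb : b <= b * s by rewrite ler_peMr // ltW.
have nZ : `|Z j w : Rd| = b * s * `|y| by rewrite ZE normrZ gtr0_norm.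
have ZT := norm_le_enorm (Z j w : Rd).
have ysK : b * s * `|y| <= K * b by rewrite -nZ (le_trans ZT).
(* Rounding strictly up gives [k > b * s >= b] and [k <= b * s + 1 <= 2 * (b * s)]; with
   [eta <= e / 4] the jump therefore exceeds [eta * k]. *)
pose k := (Num.truncn (b * s)).+1.
have kbs : b * s < k%:R by exact: truncnS_gt.
have kbs1 : k%:R <= b * s + 1 by rewrite -natr1 lerD2r truncn_le ltW.
have k0' : 0 < (k%:R : R) by rewrite ltr0n.
have bk : b < k%:R by exact: le_lt_trans kbs.
have bsKe : b * s <= K * b / e.
  rewrite ler_pdivlMr // (le_trans _ ysK) // ler_pM2l //.
(* Starting at [j.-1] compensates for the unit added by rounding [k] up. *)
have ikn : (j.-1 + k <= n)%N.
  rewrite -(ler_nat R) natrD; have : (j.-1%:R : R) + 1 = j%:R by rewrite natr1 prednK.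
  lra.
have jI : j \in iota j.-1.+1 k by rewrite mem_iota prednK // leqnn /= /k addnS ltnS leq_addr.
have Tj : eta * k%:R < enorm (Z j w : Rd).
  apply: lt_le_trans ZT; rewrite nZ.
  have h1 : eta * k%:R <= e / 4 * (2 * (b * s)).
    by apply: ler_pM => //; [exact: ltW|lra].
  have h2 : b * s * e <= b * s * `|y| by rewrite ler_pM2l.
  have h3 : 0 < b * s * e by exact: mulr_gt0.
  lra.
have hS := window_one_jump nB (ltW eta0) (ltW delta0) (ltn0Sn _) ikn (ltW bk) jI Tj.
set S := walk Z (j.-1 + k) w - walk Z j.-1 w in hS.
have kne : (k%:R : R) != 0 by rewrite gt_eqF.
have Av : A (k%:R^-1 *: S).
  apply: (inner_ball Ay).
  have -> : y - k%:R^-1 *: S = (y - k%:R^-1 *: (Z j w : Rd)) - k%:R^-1 *: (S - (Z j w : Rd)).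
    by rewrite (scalerBr k%:R^-1 S (Z j w : Rd)) opprB addrA subrK.
  apply: (le_trans (ler_normB _ _)).
  have h1 : `|k%:R^-1 *: (S - (Z j w : Rd))| <= delta.
    by rewrite normrZ gtr0_norm ?invr_gt0 // ler_pdivrMl // mulrC.
  have h2 : `|y - k%:R^-1 *: (Z j w : Rd)| <= K / b.
    have -> : y - k%:R^-1 *: (Z j w : Rd) = ((k%:R - b * s) / k%:R) *: y.
      rewrite ZE scalerA mulrBl mulfV // scalerBl scale1r; congr (_ - _ *: _); ring.
    rewrite normrZ ger0_norm; last by rewrite divr_ge0 ?subr_ge0 ?(ltW kbs) ?(ltW k0').
    apply: (@le_trans _ _ (1 / k%:R * `|y|)).
      rewrite ler_wpM2r // ler_wpM2r ?invr_ge0 ?(ltW k0') //; lra.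
    have yK : `|y| <= K.
      rewrite -(ler_pM2l b0) [b * K]mulrC; apply: le_trans ysK.
      by rewrite ler_wpM2r.
    have K0 : 0 <= K := le_trans (normr_ge0 y) yK.
    rewrite div1r mulrC; apply: (@le_trans _ _ (K / k%:R)).
      by rewrite ler_wpM2r ?invr_ge0 // ltW.
    by rewrite ler_wpM2l // lef_pV2 ?posrE // ltW.
  lra.
rewrite ltNge; apply/negP => /(longest_leP _ _ _ _ (ltW b0)) h.
have hd : dilate k%:R A S.
  by exists (k%:R^-1 *: S) => //; rewrite scalerA mulfV // scale1r.
by have := h j.-1 k ikn hd; rewrite leNgt bk.
Qed.

Lemma upset_dilate (c : R) (U : set Rd) : upset U -> upset (dilate c U).
Proof.
move=> uU s _ s1 [y Uy <-]; exists (s *: y); first exact: uU.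
by rewrite !scalerA mulrC.
Qed.

Lemma bad_small (x delta : R) : 0 < x -> 0 < delta ->
  exists2 eta0 : R, 0 < eta0 & forall eta, 0 < eta -> eta <= eta0 -> forall e, 0 < e ->
    \forall n \near \oo, fine (P (bad n (x * a n) delta eta)) < e.
Proof.
move=> x0 delta0.
have [q [M [q1 q2 mom]]] := rv_moment alpha_gt1 rvZ.
have [K [g [K0 hK]]] := rv_poly alpha_gt1 rvZ a_gt0 a_norm.
have aoo := rv_norm_cvgy alpha_gt1 rvZ a_norm.
apply: (bad_event_small iidZ mean0 q1 q2 mom (K := K / x ^+ g) (g := g) delta0).
- by move=> n; exact: mulr_gt0.
- apply/cvgryPge => u; have /cvgryPge/(_ (u / x)) := aoo; apply: filterS => n.
  by rewrite ler_pdivrMr // mulrC.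
- apply: filterS hK => n; rewrite exprMn mulrA divfK //.
  by rewrite expf_neq0 // gt_eqF.
- move=> c c0; exists ((c * x) `^ (- alpha) + 1).
  have cx : 0 < c * x by exact: mulr_gt0.
  have : (c * x) `^ (- alpha) < (c * x) `^ (- alpha) + 1 by rewrite ltrDl.
  move=> /(rv_tailp_lt alpha_gt1 rvZ a_gt0 a_norm cx); apply: filterS => n.
  by rewrite mulrA => /ltW.
Qed.

Lemma near_prob_ge (x e : R) : 0 < x -> 0 < e -> A !=set0 ->
  \forall n \near \oo,
    expR (- (x `^ (- alpha) * rmeas mu (up_dilations (closure A)))) - e <=
    fine (P [set w | (longest_segment Z A n w)%:R <= x * a n]).
Proof.
move=> x0 e0 [y0 Ay0]; case: (rvZ) => _ radon_mu _ _ _.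
set U := up_dilations (closure A); pose v0 := x `^ (- alpha) * rmeas mu U.
have xa : 0 < x `^ (- alpha) by exact: powR_gt0.
have v00 : 0 <= v0 by rewrite mulr_ge0 ?rmeas_ge0 // ltW.
(* The gap from [v0] to [v'] pays for the thickening and the limit, the gap from [v'] to [v] for
   replacing the power by an exponential. Together they cost [e / 2], and the bad event costs the
   rest. *)
pose v' := v0 + e / 4; pose v := v0 + e / 2.
have [ep ep0 Aep] := away0P A_away.
have Uep : forall z, U z -> ep <= `|z|.
  apply: up_dilations_norm_ge; first exact: ltW.
  exact: closure_norm_ge.
have U0 : U !=set0.
  exists y0; exists 1 => //=; exists y0; last by rewrite scale1r.
  exact: subset_closure.
have cU : closed U by exact: up_dilations_closed.
have Ut : rmeas mu U < v' / x `^ (- alpha).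
  by rewrite ltr_pdivlMr // mulrC -/v0 /v' ltrDl divr_gt0.
have [delta' dd Vt] := rel_thick_rmeas radon_mu cU ep0 Uep U0 Ut ltr01.
have /andP[d0 d1] := dd.
set V := rel_thick U delta' in Vt.
have cV : closed V by exact: rel_thick_closed.
have mV := borel_closed cV.
have aV : ~ closure V 0 by apply: (rel_thick_away ep0 Uep U0); rewrite (ltW d0).
have uV : upset V by apply: rel_thick_upset => //; exact: upset_up_dilations.
have h1 : \forall n \near \oo, rlaw (Z 0%N) n (a n) (dilate x V) < v'.
  apply: (rv_upset_lt alpha_gt1 rvZ a_norm).
  - exact: upset_dilate.
  - exact: dilate_closed.
  - exact: away0_dilate.
  - by rewrite (rv_rmeas_dilate rvZ) // mulrC -ltr_pdivlMr.
have delta0 : 0 < delta' * ep / 2 by rewrite divr_gt0 ?mulr_gt0.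
have [eta eta0 hbad] := bad_small x0 delta0.
have e20 : 0 < e / 2 by rewrite divr_gt0.
have h2 := hbad eta eta0 (lexx _) _ e20.
have h3 : \forall n \near \oo, v' * v / (v - v') <= (n%:R : R) by exact: nbhs_infty_ger.
have h4 := nbhs_infty_gt 0.
apply: filterS (filterI (filterI h1 h2) (filterI h3 h4)) => n [[]].
rewrite -rlaw_dilate // /rlaw; set b := x * a n; move=> k1 k2 [k3 k4].
have b0 : 0 < b by exact: mulr_gt0.
pose B : set Rd := [set z | V (b^-1 *: z)].
have mB : measurable (B : set (borel Rd)).
  have ms := continuous_borel_measurable_borel (@scaler_continuous R Rd b^-1).
  by have := ms measurableT V mV; rewrite setTI.
have mle : measurable [set w | (longest_segment Z A n w)%:R <= b].
  by apply: measurable_longest_le => //; exact: ltW.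
have mbad : measurable (bad n b (delta' * ep / 2) eta).
  by apply: measurableU; [exact: measurable_two_jumps|exact: measurable_large_dev].
have incl : no_hit n B `<=` [set w | (longest_segment Z A n w)%:R <= b] `|` bad n b (delta' * ep / 2) eta.
  move=> w nH; have [?|nB] := pselect (bad n b (delta' * ep / 2) eta w); first by right.
  left; exact: (sub_no_hit b0 eta0 ep0 dd Aep nB nH).
have g1 : fine (P (no_hit n B)) <= fine (P [set w | (longest_segment Z A n w)%:R <= b]) + fine (P (bad n b (delta' * ep / 2) eta)).
  apply: le_trans (fine_probU P mle mbad); apply: le_fine_prob => //.
    exact: measurable_no_hit.
  exact: measurableU.
have vv : v' < v by rewrite /v' /v; lra.
have g2 : expR (- v) <= fine (P (no_hit n B)).
  rewrite prob_no_hit //; apply: (@expRN_le_pow _ v v') => //.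
  - by rewrite addr_ge0 // divr_ge0 // ltW.
  - by rewrite -ler_pdivrMr // subr_gt0.
  - exact: ltW.
have g3 : expR (- v0) - e / 2 <= expR (- v).
  rewrite /v opprD expRD.
  have h5 : 1 - e / 2 <= expR (- (e / 2)) by exact: expR_ge1Dx.
  have h6 : expR (- v0) <= 1 by rewrite -[leRHS]expR0 ler_expR oppr_le0.
  have h7 := expR_ge0 (- v0).
  apply: (@le_trans _ _ (expR (- v0) * (1 - e / 2))); last by rewrite ler_wpM2l.
  nra.
rewrite -/v0; lra.
Qed.

Lemma near_prob_le (x e : R) : 0 < x -> 0 < e ->
  \forall n \near \oo,
    fine (P [set w | (longest_segment Z A n w)%:R <= x * a n]) <=
    expR (- (x `^ (- alpha) * rmeas mu (up_dilations (interior A)))) + e.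
Proof.
move=> x0 e0; case: (rvZ) => _ radon_mu _ _ _.
set U := up_dilations (interior A); pose v1 := x `^ (- alpha) * rmeas mu U.
have xa : 0 < x `^ (- alpha) by exact: powR_gt0.
have v10 : 0 <= v1 by rewrite mulr_ge0 ?rmeas_ge0 // ltW.
(* [f] is the loss allowed in the exponent: [f <= 1 / 2] gives [expR f <= 1 + 2 * f], and
   [f <= e / 8] makes this worth at most [e / 4]. If [v1 <= f], the claimed bound is already at
   least 1. *)
pose f := Num.min (e / 8) (1 / 2).
have f0 : 0 < f by rewrite lt_min !divr_gt0.
have fe : f <= e / 8 by rewrite ge_min lexx.
have f12 : f <= 1 / 2 by rewrite ge_min lexx orbT.
have [v1f|fv1] := leP v1 f.
  apply: nearW => n; apply: (@le_trans _ _ 1).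
    rewrite -lee_fin fineK ?fin_num_measure ?probability_le1 //.
      by apply: measurable_longest_le => //; rewrite mulr_ge0 // ltW.
    by apply: measurable_longest_le => //; rewrite mulr_ge0 // ltW.
  rewrite -/v1; have := expR_ge1Dx (- v1); lra.
pose v' := v1 - f / 2; pose v := v1 - f.
have v0 : 0 < v by rewrite /v; lra.
have vv' : v < v' by rewrite /v /v'; lra.
have v'0 : 0 < v' by lra.
have [ep ep0 Aep] := away0P A_away.
have Ane : ~` A !=set0 by exists 0 => /subset_closure.
have Ut : v' / x `^ (- alpha) < rmeas mu U.
  by rewrite ltr_pdivrMr // [_ * x `^ _]mulrC -/v1 /v'; lra.
have [dd dd0 Gt] := inner_rmeas radon_mu A_away Ut.
pose delta := dd / 2; have delta0 : 0 < delta by rewrite divr_gt0.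
have ddE : dd = 2 * delta by rewrite /delta; field.
rewrite ddE in Gt.
have d20 : 0 <= 2 * delta by rewrite mulr_ge0 // ltW.
set G := up_dilations (inner A (2 * delta)) in Gt.
have oG : open G by apply: up_dilations_open; exact: inner_open.
have mG := borel_open oG.
have aG : ~ closure G 0.
  apply: (@away0_ge _ _ _ ep ep0); apply: up_dilations_norm_ge; first exact: ltW.
  by move=> y /(inner_sub d20); exact: Aep.
have h1 : \forall n \near \oo, v' < rlaw (Z 0%N) n (a n) (dilate x G).
  apply: (rv_upset_gt alpha_gt1 rvZ a_gt0 a_norm).
  - apply: upset_dilate; exact: upset_up_dilations.
  - exact: dilate_open.
  - exact: away0_dilate.
  - by rewrite (rv_rmeas_dilate rvZ) // mulrC -ltr_pdivrMr.
have [eta1 eta10 hbad] := bad_small x0 delta0.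
pose eta := Num.min eta1 (ep / 4).
have eta0 : 0 < eta by rewrite lt_min eta10 divr_gt0.
have eta_le : eta <= eta1 by rewrite ge_min lexx.
have eta_ep : eta <= ep / 4 by rewrite ge_min lexx orbT.
have e40 : 0 < e / 4 by rewrite divr_gt0.
have h2 := hbad eta eta0 eta_le _ e40.
(* [y] is so large that, up to probability [e / 4], none of the first [n] steps exceeds [y * a n],
   which is [K * b] below. *)
have [y y0 hy] := powRN_small (lt_trans ltr01 alpha_gt1) (divr_gt0 e0 (ltr0n _ 8)).
pose K := y / x.
have K0 : 0 < K by exact: divr_gt0.
have yK : y `^ (- alpha) < e / 4 by apply: (le_lt_trans (hy _ (lexx _))); lra.
have h3 : \forall n \near \oo, n%:R * p (y * a n) < e / 4.
  exact: (rv_tailp_lt alpha_gt1 rvZ a_gt0 a_norm).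
have /cvgryPge aoo := rv_norm_cvgy alpha_gt1 rvZ a_norm.
have h4 := aoo (1 / x); have h5 := aoo (K / delta / x).
(* A window fits if its start leaves room [c = O(a n)], defined below and at most [rho * n]. With
   rounding, at most [2 * rho * n] positions are lost, and [rho] is such that [v / v' * n]
   remain. *)
pose rho := (1 - v / v') / 2.
have rho0 : 0 < rho by rewrite /rho divr_gt0 // subr_gt0 ltr_pdivrMr // mul1r.
have rho' : 0 < rho / (K * x / ep) by rewrite divr_gt0 // !mulr_gt0 ?invr_gt0.
have h6 := rv_norm_small alpha_gt1 rvZ a_gt0 a_norm rho'.
have h7 : \forall n \near \oo, 1 / rho <= (n%:R : R) by exact: nbhs_infty_ger.
apply: filterS (filterI (filterI (filterI h1 h2) (filterI h3 h4)) (filterI h5 (filterI h6 h7))) => n.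
move=> [[[k1 k2] [k3 k4]] [k5 [k6 k7]]]; move: k1 k2.
rewrite -rlaw_dilate // /rlaw; set b := x * a n; move=> k1 k2.
have b0 : 0 < b by exact: mulr_gt0.
have b1 : 1 <= b by rewrite /b [x * _]mulrC -ler_pdivrMr.
have Kb : K / b <= delta.
  by rewrite ler_pdivrMr // [delta * b]mulrC -ler_pdivrMr // /b [x * _]mulrC -ler_pdivrMr.
pose c := K * b / ep.
have c0 : 0 <= c.
  by apply: mulr_ge0; [apply: mulr_ge0; exact: ltW|rewrite invr_ge0 ltW].
have cn : c <= rho * n%:R.
  have : K * x / ep * a n <= rho * n%:R.
    have Kx0 : 0 < K * x / ep by apply: divr_gt0 => //; exact: mulr_gt0.
    by rewrite mulrC -ler_pdivlMr // mulrAC.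
  by apply: le_trans; rewrite /c /b; have -> : K * (x * a n) / ep = K * x / ep * a n by ring.
pose m := (n - (Num.truncn c).+1)%N.
have nn0 : 0 < (n%:R : R) by apply: lt_le_trans k7; rewrite divr_gt0.
have mn : v / v' * n%:R <= m%:R.
  have t1 : ((Num.truncn c).+1%:R : R) <= c + 1 by rewrite -natr1 lerD2r truncn_le.
  have t2 : 1 <= rho * n%:R by rewrite mulrC -ler_pdivrMr.
  have t3 : ((Num.truncn c).+1%:R : R) <= 2 * rho * n%:R by lra.
  have t4 : (n%:R : R) - (Num.truncn c).+1%:R <= m%:R.
    by rewrite lerBlDr -natrD ler_nat /m addnC -leq_subLR.
  have t5 : 2 * rho = 1 - v / v' by rewrite /rho; field; rewrite gt_eqF.
  rewrite t5 in t3; lra.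
pose B : set Rd := [set z | G (b^-1 *: z)].
have mB : measurable (B : set (borel Rd)).
  have ms := continuous_borel_measurable_borel (@scaler_continuous R Rd b^-1).
  by have := ms measurableT G mG; rewrite setTI.
have mle : measurable [set w | (longest_segment Z A n w)%:R <= b].
  by apply: measurable_longest_le => //; exact: ltW.
have mbad : measurable (bad n b delta eta).
  by apply: measurableU; [exact: measurable_two_jumps|exact: measurable_large_dev].
pose huge := \big[setU/set0]_(j <- iota 1 n) [set w | K * b < enorm (Z j w : Rd)].
have mhuge : measurable huge by apply: bigsetU_measurable => j _; exact: measurable_enorm_gt.
have incl : [set w | (longest_segment Z A n w)%:R <= b] `<=` no_hit m B `|` (huge `|` bad n b delta eta).
  move=> w wb; have [?|nB] := pselect (bad n b delta eta w); first by right; right.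
  have [?|nh] := pselect (huge w); first by right; left.
  left => j; rewrite /= mem_iota => /andP[j1 jm] GZ.
  have jm' : (j <= m)%N by rewrite -ltnS -add1n.
  (* Without room, natural subtraction makes [m] zero and no [j] remains. *)
  have hm : ((Num.truncn c).+1 <= n)%N.
    rewrite leqNgt; apply/negP => h; move: jm'; rewrite /m (eqP (_ : (n - _ == 0)%N)) ?leqn0.
      by move=> /eqP j0; rewrite j0 in j1.
    by rewrite subn_eq0 ltnW.
  have jn : (j <= n)%N by rewrite (leq_trans jm') // leq_subr.
  have jc : j%:R + K * b / ep <= n%:R.
    apply: (@le_trans _ _ ((m + (Num.truncn c).+1)%N%:R)); last by rewrite ler_nat /m subnK.
    by rewrite natrD lerD ?ler_nat // ltW // truncnS_gt.
  have TK : enorm (Z j w : Rd) <= K * b.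
    rewrite leNgt; apply/negP => h; apply: nh; apply: (mem_bigsetU (i := j)) => //.
    by rewrite mem_iota j1 add1n ltnS.
  have := hit_longest b1 eta0 ep0 delta0 eta_ep Aep Kb nB j1 jc TK GZ.
  by rewrite ltNge wb.
have P3 : fine (P huge) <= e / 4.
  apply: (@le_trans _ _ ((size (iota 1 n))%:R * p (y * a n))); last by rewrite size_iota ltW.
  apply: union_bound_const => [j|j _]; first exact: measurable_enorm_gt.
  have -> : K * b = y * a n by rewrite /K /b; field; rewrite gt_eqF.
  have h8 : P [set w | y * a n < enorm (Z j w : Rd)] = P [set w | y * a n < enorm (Z 0%N w : Rd)].
    exact: (iidZ.2 j _ (@borel_enorm_gt R d (y * a n))).
  by rewrite h8.
have mno : measurable (no_hit m B) by exact: measurable_no_hit.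
have g1 : fine (P [set w | (longest_segment Z A n w)%:R <= b]) <= fine (P (no_hit m B)) + (fine (P huge) + fine (P (bad n b delta eta))).
  apply: (@le_trans _ _ (fine (P (no_hit m B `|` (huge `|` bad n b delta eta))))).
    apply: le_fine_prob => //; apply: measurableU => //; exact: measurableU.
  apply: (le_trans (fine_probU P mno (measurableU _ _ mhuge mbad))).
  by rewrite lerD2l; exact: fine_probU.
have g2 : fine (P (no_hit m B)) <= expR (- v).
  rewrite prob_no_hit //; set t := fine _.
  have t1 : t <= 1.
    by rewrite -lee_fin fineK ?fin_num_measure ?probability_le1 //; exact: (measurable_rv_preimage Z 0 mB).
  have t0 : 0 <= t by exact: fine_ge0.
  apply: (le_trans (pow_le_expRN _ t1)); rewrite ler_expR lerN2.
  apply: (@le_trans _ _ (v / v' * n%:R * t)); last by rewrite ler_wpM2r.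
  rewrite -mulrA; apply: (@le_trans _ _ (v / v' * v')); first by rewrite divfK // gt_eqF.
  by apply: ler_wpM2l; [apply: divr_ge0; exact: ltW|exact: ltW].
have g3 : expR (- v) <= expR (- v1) + e / 4.
  rewrite /v opprB addrC expRD.
  have h8 := expR_le_quadratic f12.
  have h9 : expR (- v1) <= 1 by rewrite -[leRHS]expR0 ler_expR oppr_le0.
  have h10 := expR_ge0 (- v1).
  have h11 : expR f <= 1 + 2 * f by rewrite expr2 in h8; nra.
  apply: (@le_trans _ _ (expR (- v1) * (1 + 2 * f))); first by rewrite ler_wpM2l.
  nra.
rewrite -/v1; lra.
Qed.

End main_limits.

Lemma near_limn_esup_le (R : realType) (u : nat -> \bar R) (M : \bar R) :
  (\forall n \near \oo, (u n <= M)%E) -> (limn_esup u <= M)%E.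
Proof.
move=> h; rewrite /limn_esup /limf_esup; apply: ge_ereal_inf.
exists (ereal_sup (u @` [set n | (u n <= M)%E])); first by exists [set n | (u n <= M)%E].
by apply: ge_ereal_sup => _ [n un <-].
Qed.

Lemma near_limn_einf_ge (R : realType) (u : nat -> \bar R) (M : \bar R) :
  (\forall n \near \oo, (M <= u n)%E) -> (M <= limn_einf u)%E.
Proof.
move=> h; rewrite /limn_einf leeNr; apply: near_limn_esup_le.
by apply: filterS h => n; rewrite leeN2.
Qed.

(** * From the limit inequalities to the rescaled longest segment *)

Section conclusion.
Context (R : realType) (d : nat) (disp : measure_display)
  (Omega : measurableType disp) (P : probability Omega R).
Local Notation Rd := 'rV[R]_d.+1.
Context (Z : nat -> {RV P >-> borel Rd}) (alpha : R)
  (mu : {measure set (borel (punctured R d)) -> \bar R}).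
Hypothesis iidZ : iid Z.
Hypothesis alpha_gt1 : 1 < alpha.
Hypothesis rvZ : regularly_varying (Z 0%N) alpha mu.
Hypothesis mean0 : mean_zero (Z 0%N).
Context (a : nat -> R).
Hypothesis a_gt0 : forall n, 0 < a n.
Hypothesis a_norm : normalizing (Z 0%N) a.
Context (A : set Rd).
Hypothesis mA : measurable (A : set (borel Rd)).
Hypothesis A_away : bounded_away0 A.

Local Notation Rn := (fun n w => (a n)^-1 * (longest_segment Z A n w)%:R).
Local Notation r n x := (fine (P [set w | Rn n w <= x])).

Lemma Rn_leE n x : [set w | Rn n w <= x] = [set w | (longest_segment Z A n w)%:R <= x * a n].
Proof.
by apply/seteqP; split => w /=; rewrite ler_pdivrMl // mulrC.
Qed.

Lemma measurable_Rn_le n x : measurable [set w | Rn n w <= x].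
Proof.
have [x0|x0] := leP 0 x.
  by rewrite Rn_leE; apply: measurable_longest_le => //; rewrite mulr_ge0 // ltW.
rewrite (_ : [set w | _] = set0) //; apply/seteqP; split => w //=.
by rewrite leNgt (lt_le_trans x0) // mulr_ge0 // invr_ge0 ltW.
Qed.

Lemma measurable_Rn n : measurable_fun setT (Rn n).
Proof.
apply: (measurability _ (RGenOInfty.measurableE R)) => _ [_ [x ->] <-].
rewrite setTI (_ : _ @^-1` _ = ~` [set w | Rn n w <= x]).
  by apply: measurableC; exact: measurable_Rn_le.
by apply/seteqP; split => w /=; rewrite in_itv /= andbT ltNge => /negP.
Qed.

Lemma probRnE n x : P [set w | Rn n w <= x] = (r n x)%:E.
Proof. by rewrite fineK // fin_num_measure //; exact: measurable_Rn_le. Qed.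

Lemma emeas_closureE : mu (embed (up_dilations (closure A))) =
  (rmeas mu (up_dilations (closure A)))%:E.
Proof.
case: (rvZ) => _ radon_mu _ _ _; apply: emeasE => //.
  by apply: borel_closed; exact: up_dilations_closed.
have [e e0 Ae] := away0P A_away; apply: (@away0_ge _ _ _ e e0).
by apply: up_dilations_norm_ge; [exact: ltW|exact: closure_norm_ge].
Qed.

Lemma emeas_interiorE : mu (embed (up_dilations (interior A))) =
  (rmeas mu (up_dilations (interior A)))%:E.
Proof.
case: (rvZ) => _ radon_mu _ _ _; apply: emeasE => //.
  by apply: borel_open; apply: up_dilations_open; exact: open_interior.
have [e e0 Ae] := away0P A_away; apply: (@away0_ge _ _ _ e e0).
by apply: up_dilations_norm_ge; [exact: ltW|move=> y /interior_subset; exact: Ae].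
Qed.

Lemma near_prob_Rn_ge (x e : R) : 0 < x -> 0 < e -> \forall n \near \oo,
  expR (- (x `^ (- alpha) * rmeas mu (up_dilations (closure A)))) - e <= r n x.
Proof.
(* The thickening argument needs a nonempty set, the distance to the empty set being 0 by default.
   For [A] empty the longest segment is 0 and the probability is 1. *)
move=> x0 e0; have [A0|/set0P A0] := eqVneq A set0; last first.
  have := near_prob_ge iidZ alpha_gt1 rvZ mean0 a_gt0 a_norm mA A_away x0 e0 A0.
  by apply: filterS => n; rewrite Rn_leE.
apply: nearW => n.
have -> : [set w | Rn n w <= x] = setT.
  apply/seteqP; split => w //= _; rewrite ler_pdivrMl //.
  apply/(longest_leP _ _ _ _ _) => [|i k _]; first by rewrite mulr_ge0 // ltW.
  by rewrite A0 => -[].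
rewrite probability_setT /=.
have : expR (- (x `^ (- alpha) * rmeas mu (up_dilations (closure A)))) <= 1.
  by rewrite -[leRHS]expR0 ler_expR oppr_le0 mulr_ge0 ?powR_ge0 ?rmeas_ge0.
lra.
Qed.

Lemma near_prob_Rn_le (x e : R) : 0 < x -> 0 < e -> \forall n \near \oo,
  r n x <= expR (- (x `^ (- alpha) * rmeas mu (up_dilations (interior A)))) + e.
Proof.
move=> x0 e0.
have := near_prob_le iidZ alpha_gt1 rvZ mean0 a_gt0 a_norm mA A_away x0 e0.
by apply: filterS => n; rewrite Rn_leE.
Qed.

Lemma le_prob_Rn n x y : x <= y -> r n x <= r n y.
Proof.
move=> xy; apply: le_fine_prob; try exact: measurable_Rn_le.
by move=> w /= /le_trans; apply.
Qed.

Lemma prob_Rn_lt0 n x : x < 0 -> r n x = 0.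
Proof.
move=> x0; rewrite (_ : [set w | _] = set0) ?measure0 //; apply/seteqP; split => w //=.
by rewrite leNgt (lt_le_trans x0) // mulr_ge0 // invr_ge0 ltW.
Qed.

End conclusion.

Section frechet.
Context (R : realType) (alpha : R) (alpha_gt0 : 0 < alpha).

Lemma expRN_powRN_small (v e : R) : 0 < v -> 0 < e -> exists2 y : R, 0 < y & expR (- (y `^ (- alpha) * v)) < e.
Proof.
move=> v0 e0; have m0 : 0 < e^-1 / v by rewrite divr_gt0 // invr_gt0.
have [y [y0 yE _ _]] := powRN_surj alpha_gt0 m0.
exists y => //; rewrite yE divfK ?gt_eqF // expRN -[ltRHS]invrK ltf_pV2 ?posrE ?expR_gt0 ?invr_gt0 //.
by apply: lt_le_trans (expR_ge1Dx _); rewrite ltrDr.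
Qed.

Context (disp : measure_display) (T : measurableType disp) (P : probability T R) (W : {RV P >-> R}).
Hypothesis frechetW : std_frechet alpha W.

Lemma measurable_W_le x : measurable [set t | W t <= x].
Proof.
have -> : [set t | W t <= x] = W @^-1` `]-oo, x]%classic.
  by apply/seteqP; split => t /=; rewrite in_itv.
by rewrite -[X in measurable X]setTI; apply: measurable_funPT.
Qed.

(** [std_frechet] prescribes the law on the positive half-line only; nonpositive levels follow by
    letting a positive level tend to 0. *)
Lemma frechet_le0 x : x <= 0 -> P [set t | W t <= x] = 0%E.
Proof.
move=> x0; apply/eqP; rewrite eq_le measure_ge0 andbT; apply/lee_addgt0Pr => e e0; rewrite add0e.
have [y y0 ye] := expRN_powRN_small (@ltr01 R) e0.
apply: (@le_trans _ _ (P [set t | W t <= y])).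
  apply: le_measure; rewrite ?inE; try exact: measurable_W_le.
  by move=> t /= /le_trans; apply; rewrite (le_trans x0) // ltW.
by rewrite frechetW // lee_fin ltW // -[y `^ _]mulr1.
Qed.

End frechet.

Unset Implicit Arguments.
Set Strict Implicit.

Theorem theorem4p2 (R : realType) (d : nat) (disp : measure_display)
    (Omega : measurableType disp) (P : probability Omega R)
    (Z : nat -> {RV P >-> borel 'rV[R]_d.+1}) (alpha : R)
    (mu : {measure set (borel (punctured R d)) -> \bar R})
    (iidZ : iid Z) (alpha_gt1 : 1 < alpha)
    (rvZ : regularly_varying (Z 0%N) alpha mu)
    (mean0 : mean_zero (Z 0%N))
    (a : nat -> R) (a_gt0 : forall n, 0 < a n) (a_incr : nondecreasing_seq a)
    (a_norm : normalizing (Z 0%N) a)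
    (A : set 'rV[R]_d.+1) (mA : measurable (A : set (borel 'rV[R]_d.+1)))
    (A_away : bounded_away0 A) :
  let Rn n w := (a n)^-1 * (longest_segment Z A n w)%:R in
  let mu_cl := mu (embed (up_dilations (closure A))) in
  let mu_int := mu (embed (up_dilations (interior A))) in
  (forall x : R, 0 < x ->
    let p n := P [set w | Rn n w <= x] in
    [/\ (expeR (- ((x `^ (- alpha))%:E * mu_cl)) <= limn_einf p)%E,
        (limn_einf p <= limn_esup p)%E &
        (limn_esup p <= expeR (- ((x `^ (- alpha))%:E * mu_int)))%E])
  /\
  (mu_int = mu_cl ->
    forall (disp' : measure_display) (T' : measurableType disp')
      (P' : probability T' R) (W : {RV P' >-> R}), std_frechet alpha W ->
    cvg_in_distribution P P' Rn
      (fun t => fine mu_cl `^ alpha^-1 * W t)).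
Proof.
move=> Rn mu_cl mu_int.
have alpha_gt0 : 0 < alpha := lt_trans ltr01 alpha_gt1.
have clE : mu_cl = (rmeas mu (up_dilations (closure A)))%:E by exact: (emeas_closureE rvZ A_away).
have intE : mu_int = (rmeas mu (up_dilations (interior A)))%:E by exact: (emeas_interiorE rvZ A_away).
pose r n x := fine (P [set w | Rn n w <= x]).
have rE n x : P [set w | Rn n w <= x] = (r n x)%:E by exact: probRnE.
have rge := near_prob_Rn_ge iidZ alpha_gt1 rvZ mean0 a_gt0 a_norm mA A_away.
have rle := near_prob_Rn_le iidZ alpha_gt1 rvZ mean0 a_gt0 a_norm mA A_away.
split=> [x x0 p|int_cl disp' T' P' W frW].
  split; last 2 first.
  - exact: limn_einf_sup.
  - rewrite intE -EFinM -EFinN /=; apply/lee_addgt0Pr => e e0; apply: near_limn_esup_le.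
    by apply: filterS (rle x e x0 e0) => n h; rewrite /p rE -EFinD lee_fin.
  - rewrite clE -EFinM -EFinN /=; apply/lee_addgt0Pr => e e0; rewrite -leeBlDr //.
    apply: near_limn_einf_ge.
    by apply: filterS (rge x e x0 e0) => n h; rewrite /p rE -EFinB lee_fin.
set v := rmeas mu (up_dilations (closure A)) in clE rge.
have vE : rmeas mu (up_dilations (interior A)) = v.
  by apply: EFin_inj; rewrite -intE -clE.
rewrite vE in rle; rewrite clE /=; set c := v `^ alpha^-1.
have v0 : 0 <= v by exact: rmeas_ge0.
split=> [n||x cx].
- exact: measurable_Rn.
- by apply: measurable_funM => //; exact: measurable_funPT.
suff [l -> hl] : exists2 l : R, P' [set t | c * W t <= x] = l%:E & (r n x @[n --> \oo] --> l).
  have -> : (fun n => P [set w | Rn n w <= x]) = (fun n => (r n x)%:E).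
    by apply/funext => n; exact: rE.
  by apply: cvg_EFin => //; exact: nearW.
have alphaV : alpha^-1 != 0 by rewrite invr_eq0 gt_eqF.
have [x0|x0] := ltP 0 x.
  exists (expR (- (x `^ (- alpha) * v))).
    (* For [v = 0] the limit variable is the constant 0, and both sides equal 1 at positive [x]. *)
    have [ve0|vn0] := eqVneq v 0.
      rewrite /c ve0 powR0 // mulr0 oppr0 expR0.
      rewrite (_ : [set t | _] = setT) ?probability_setT //.
      by apply/seteqP; split => t //= _; rewrite mul0r ltW.
    have vp : 0 < v by rewrite lt0r vn0.
    have cp : 0 < c by exact: powR_gt0.
    have -> : [set t | c * W t <= x] = [set t | W t <= x / c].
      by apply/seteqP; split => t /=; rewrite ler_pdivlMr // mulrC.
    rewrite frW ?divr_gt0 //; congr (expR (- _))%:E.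
    rewrite powRM ?invr_ge0 ?(ltW x0) ?(ltW cp) //; congr (_ * _).
    rewrite -(powR_inv1 (ltW cp)) -powRrM mulN1r opprK /c -powRrM mulVf ?powRr1 //.
    by rewrite gt_eqF.
  apply/cvgrPdist_le => e e0.
  apply: filterS (filterI (rge x e x0 e0) (rle x e x0 e0)) => n [h1 h2].
  rewrite ler_distl; apply/andP; split; [rewrite lerBlDr|]; move: h1 h2; rewrite -/(r n x); lra.
have [ve0|vn0] := eqVneq v 0.
  have c0 : c = 0 by rewrite /c ve0 powR0.
  (* The point mass at 0 has a distribution function that jumps there, so [x = 0] contradicts [cx]:
     the value is 1 at 0 and 0 at [- (e / 2)]. *)
  have [xz|xn0] := eqVneq x 0.
    exfalso; move: cx; rewrite xz.
    have F0 : P' [set t | c * W t <= 0] = 1%E.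
      rewrite (_ : [set t | _] = setT) ?probability_setT //.
      by apply/seteqP; split => t //= _; rewrite c0 mul0r.
    move=> /(_ [set z | (0 < z)%E]); rewrite F0 => /(_ _)[].
      by apply: open_nbhs_nbhs; split; [exact: open_ereal_gt_ereal|rewrite /= lte01].
    move=> e /= e0 /(_ (- (e / 2))); rewrite /= sub0r opprK.
    rewrite gtr0_norm ?divr_gt0 // ltr_pdivrMr // ltr_pMr // ltr1n => /(_ isT).
    rewrite (_ : [set t | _] = set0) ?measure0 ?ltxx //.
    apply/seteqP; split => t //=; rewrite c0 mul0r leNgt oppr_lt0 divr_gt0 //.
  have xl : x < 0 by rewrite lt_neqAle xn0.
  exists 0.
    rewrite (_ : [set t | _] = set0) ?measure0 //.
    by apply/seteqP; split => t //=; rewrite c0 mul0r leNgt xl.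
  under eq_cvg do rewrite /r (prob_Rn_lt0 _ a_gt0 _ _ xl); exact: cvg_cst.
have vp : 0 < v by rewrite lt0r vn0.
have cp : 0 < c by exact: powR_gt0.
exists 0.
  have -> : [set t | c * W t <= x] = [set t | W t <= x / c].
    by apply/seteqP; split => t /=; rewrite ler_pdivlMr // mulrC.
  by apply: (frechet_le0 alpha_gt0 frW); rewrite pmulr_lle0 // invr_gt0.
apply/cvgrPdist_le => e e0.
have e20 : 0 < e / 2 by rewrite divr_gt0.
(* For [x <= 0] the limit is 0: by monotonicity the probability at [x] is at most the one at a small
   positive level [y]. *)
have [y y0 ye] := expRN_powRN_small alpha_gt0 vp e20.
apply: filterS (rle y (e / 2) y0 e20) => n h.
rewrite sub0r normrN ger0_norm ?fine_ge0 //.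
have : r n x <= r n y by apply: (le_prob_Rn _ a_gt0) => //; rewrite (le_trans x0) // ltW.
rewrite -/(r n y) in h; lra.
Qed.
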